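(* Let $0<\alpha\le 1$ be fixed and let $C_n(\alpha)=\gamma_n(\alpha)-\frac{1}{\alpha}(\log\alpha)^n$. With the notation defined in the context, $$C_n(\alpha)\sim\frac{Be^{nA}}{\sqrt{n}}\left\{\cos(na+b-2\pi\alpha)\left(1+\frac{c_1}{n}+\frac{c_2}{n^2}\right)-\sin(na+b-2\pi\alpha)\left(\frac{d_1}{n}+\frac{d_2}{n^2}\right)\right\}\qquad(n\to\infty),$$ that is, as $n\to\infty$ through the positive integers, $$C_n(\alpha)=\frac{Be^{nA}}{\sqrt{n}}\left\{\cos(na+b-2\pi\alpha)\left(1+\frac{c_1}{n}+\frac{c_2}{n^2}\right)-\sin(na+b-2\pi\alpha)\left(\frac{d_1}{n}+\frac{d_2}{n^2}\right)+o(n^{-2})\right\}.$$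
   Context: The generalized Stieltjes constants $\gamma_n(\alpha)$ are defined by the Laurent expansion of the Hurwitz zeta function about $s=1$: $\zeta(s,\alpha)=\frac{1}{s-1}+\sum_{n=0}^\infty \frac{(-1)^n}{n!}\gamma_n(\alpha) (s-1)^n$. For a positive integer $n$, let $t_0=t_0(n)=u+iv$ ($u,v$ real) be the principal solution of $t e^t=\frac{ni}{2\pi}$, i.e. $t_0=W_0(ni/(2\pi))$ with $W_0$ the principal branch of the Lambert function (so $u>0$, $0<v<\pi/2$). Define $$A=\tfrac12\log(u^2+v^2)-\frac{u}{u^2+v^2},\qquad a=\arctan\left(\frac{v}{u}\right)+\frac{v}{u^2+v^2},$$ $$B=2\sqrt{2\pi}\left|\frac{t_0}{\sqrt{1+t_0}}\right|,\qquad b=\tfrac12\pi-v-\tfrac12\arctan\left(\frac{v}{1+u}\right).$$ Let $$\wp_2(t_0)=2-18t_0-20t_0^2-3t_0^3+2t_0^4,$$ $$\wp_4(t_0)=4-72t_0-332t_0^2-8028t_0^3-19644t_0^4-20280t_0^5-9911t_0^6-1884t_0^7+4t_0^8,$$ and define real numbers $c_1,d_1,c_2,d_2$ (functions of $t_0$, with no explicit dependence on $n$ other than through $t_0$) by $$c_1+id_1=\frac{\wp_2(t_0)}{24(1+t_0)^3},\qquad c_2+id_2=\frac{\wp_4(t_0)}{1152(1+t_0)^6}+\frac{(4+3t_0)t_0^2}{2(1+t_0)^2}.$$ *)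

(* Defs.v *)
(* Stdlib reals with Coquelicot: complex numbers, series and derivatives. *)
From Stdlib Require Import Reals Factorial.
From Coquelicot Require Import Coquelicot.
Open Scope R_scope.

Definition Cexp (z : C) : C := (exp (Re z) * cos (Im z), exp (Re z) * sin (Im z)).

(* Principal branch: the root has argument in (-PI/2, PI/2], so that negative
   reals have roots with positive imaginary part. *)
Definition Csqrt (z : C) : C :=
  let x := sqrt ((Cmod z + Re z) / 2) in
  let y := sqrt ((Cmod z - Re z) / 2) in
  if Rle_dec 0 (Im z) then (x, y) else (x, - y).

(* [zeta] is s |-> zeta(s, alpha): the Dirichlet series
   sum_(k >= 0) (k + alpha)^(-s) on Re s > 1, continued analytically to
   C \ {1}. Its value at the pole s = 1 is irrelevant. *)
Definition is_hurwitz_zeta (alpha : R) (zeta : C -> C) : Prop :=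
  (forall s : C, 1 < Re s ->
     is_series (K := C_AbsRing) (V := C_NormedModule)
       (fun k : nat => Cexp (- s * RtoC (ln (INR k + alpha)))%C) (zeta s)) /\
  (forall s : C, s <> RtoC 1 ->
     ex_derive (K := C_AbsRing) (V := C_NormedModule) zeta s).

(* [gamma n] is gamma_n(alpha): the Laurent expansion
   zeta(s, alpha) = 1/(s-1) + sum_n (-1)^n / n! gamma_n (s-1)^n
   holds on a punctured disc around s = 1. *)
Definition is_stieltjes (alpha : R) (gamma : nat -> R) : Prop :=
  exists zeta : C -> C, is_hurwitz_zeta alpha zeta /\
  exists r : R, 0 < r /\
    forall s : C, 0 < Cmod (s - 1)%C < r ->
      is_pseries (K := C_AbsRing) (V := C_NormedModule)
        (fun n : nat => RtoC ((-1) ^ n / INR (fact n) * gamma n))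
        (s - 1)%C (zeta s - 1 / (s - 1))%C.

(* w = W_0(z). The range of the principal branch is bounded by the curve
   x = - y cot y, -PI < y < PI, which meets the real axis at -1; its upper half
   belongs to the range (it is the image of the upper side of the cut
   z < -1/e), its lower half does not. *)
Definition is_lambertW0 (z w : C) : Prop :=
  (w * Cexp w)%C = z /\
  - PI < Im w < PI /\
  (Im w = 0 -> -1 <= Re w) /\
  (0 < Im w -> - (Im w * (cos (Im w) / sin (Im w))) <= Re w) /\
  (Im w < 0 -> - (Im w * (cos (Im w) / sin (Im w))) < Re w).

(* In the following t stands for t_0 = u + iv, so Re t = u and Im t = v. *)

Definition coefA (t : C) : R :=
  / 2 * ln (Re t ^ 2 + Im t ^ 2) - Re t / (Re t ^ 2 + Im t ^ 2).

Definition coefa (t : C) : R :=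
  atan (Im t / Re t) + Im t / (Re t ^ 2 + Im t ^ 2).

Definition coefB (t : C) : R :=
  2 * sqrt (2 * PI) * Cmod (t / Csqrt (1 + t))%C.

Definition coefb (t : C) : R :=
  / 2 * PI - Im t - / 2 * atan (Im t / (1 + Re t)).

Definition wp2 (t : C) : C :=
  (2 - 18 * t - 20 * t ^ 2 - 3 * t ^ 3 + 2 * t ^ 4)%C.

Definition wp4 (t : C) : C :=
  (4 - 72 * t - 332 * t ^ 2 - 8028 * t ^ 3 - 19644 * t ^ 4 - 20280 * t ^ 5
   - 9911 * t ^ 6 - 1884 * t ^ 7 + 4 * t ^ 8)%C.

(* c_1 + i d_1 and c_2 + i d_2. *)
Definition coef1 (t : C) : C := (wp2 t / (24 * (1 + t) ^ 3))%C.

Definition coef2 (t : C) : C :=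
  (wp4 t / (1152 * (1 + t) ^ 6)
   + (4 + 3 * t) * t ^ 2 / (2 * (1 + t) ^ 2))%C.

Definition coefc1 (t : C) : R := Re (coef1 t).
Definition coefd1 (t : C) : R := Im (coef1 t).
Definition coefc2 (t : C) : R := Re (coef2 t).
Definition coefd2 (t : C) : R := Im (coef2 t).

(* Main.v *)
Require Import Defs.
From Stdlib Require Import Reals Factorial Lra Lia FunctionalExtensionality.
From Coquelicot Require Import Coquelicot.
Open Scope R_scope.

(** Why the expansion holds.

    Put X = alpha + 1/2. Comparing neighbouring vertical lines, with a kernel that
    has one pole per strip, gives the midpoint form of the Abel-Plana formula
    ([abel_plana_strip]). Applied to z^(-1-x) and summed over all strips it yields
    ([hurwitz_sum])
      zeta(1+x, alpha) - alpha^(-1-x)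
        = X^(-x) / x + 2 int_0^oo Im ((X+iy)^(-1-x)) / (e^(2 pi y) + 1) dy.
    Both sides are expanded in powers of x; as real power series that agree for
    small x > 0 have equal coefficients, the Laurent expansion gives
    ([stieltjes_formula])
      gamma_n = ln^n alpha / alpha - ln^(n+1) X / (n+1)
        + 2 int_0^oo Im (Log^n z / z) / (e^(2 pi y) + 1) dy,   z = X + iy.
    The middle term is bounded, so the whole asymptotic behaviour sits in the
    integral. Working on the line Re z = X rather than Re z = alpha keeps Log z
    bounded near the real axis for every alpha in (0, 1].

    Replacing 1 / (e^(2 pi y) + 1) by e^(-2 pi y) turns the integral into
    Re (e^(-2 pi i alpha) int Log^n z / z e^(2 pi i z) dz) along the upward ray
    from X. The correction, of size e^(-4 pi y), is exponentially smaller
    ([second_harmonic_bound]). The phase n log (Log z) + 2 pi i z is stationary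
    where Log z = t with t e^t = n i / (2 pi). The ray is therefore deformed
    ([sweep_segment], [sweep_spiral]) into the spiral z = e^(t (1+s)),
    -1 <= s <= delta, followed by the vertical ray from its end point. On the
    spiral the integrand equals t^(n+1) e^(-n/t) times
      (1+s)^n exp (- (n/t) (e^(ts) - 1)),
    whose saddle point is s = 0 ([spiral_integrand]). Away from s = 0 this and the
    final ray are exponentially small ([left_tail_bound], [ray_bound]).

    Near s = 0 the integrand is e^(-n (1+t) s^2 / 2) times a polynomial in s, with an
    error that is controlled by a calculus of truncated expansions ([jet_mult],
    [jet_exp], [local_pointwise]). The Gaussian moments follow by parts
    ([gauss_moment_rec]), their combination is exactly
    1 + coef1 t / n + coef2 t / n^2 ([coef_identity]), and the zeroth moment is
    sqrt (2 pi / (n (1+t))) up to an exponentially small factor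
    ([gauss_integral]). The polar form of the resulting product is the amplitude and
    the phase of the theorem ([main_term_polar]).

    As Re t grows like ln n and |t| <= Re t + 2, the choice delta = n^(-2/5) makes
    every error o(n^(-2)) relative to the amplitude ([relative_error]). *)

(** * Calculus of complex-valued functions of a real variable *)

(** Complex-valued functions are differentiated through their real and imaginary parts,
    so that automatic differentiation and the real fundamental theorem of calculus apply
    coordinatewise. *)
Definition cderive (g : R -> C) (x : R) (l : C) : Prop :=
  is_derive (fun y => Re (g y)) x (Re l) /\ is_derive (fun y => Im (g y)) x (Im l).

Definition ccont {U : UniformSpace} (g : U -> C) (x : U) : Prop :=
  continuous (U := R_UniformSpace) (fun y => Re (g y)) x /\
  continuous (U := R_UniformSpace) (fun y => Im (g y)) x.

Definition CInt (g : R -> C) (a b : R) : C :=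
  (RInt (fun y => Re (g y)) a b, RInt (fun y => Im (g y)) a b).

(** Only used on the right half-plane, where it is the principal logarithm; the
    arctangent formula for the argument is wrong elsewhere. *)
Definition Clog (z : C) : C := (ln (Cmod z), atan (Im z / Re z)).

Lemma is_derive_eq (f : R -> R) x (l l' : R) : is_derive f x l -> l = l' -> is_derive f x l'.
Proof. now intros H <-. Qed.

Lemma cderive_eq (g : R -> C) x l l' : cderive g x l -> l = l' -> cderive g x l'.
Proof. now intros H <-. Qed.

Lemma cderive_ext (f g : R -> C) x l :
  (forall y, f y = g y) -> cderive f x l -> cderive g x l.
Proof.
  intros E [H1 H2]; split.
  - eapply is_derive_ext; [|exact H1]; intros; simpl; now rewrite E.
  - eapply is_derive_ext; [|exact H2]; intros; simpl; now rewrite E.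
Qed.

Lemma cderive_const c x : cderive (fun _ => c) x 0.
Proof. split; simpl; apply @is_derive_const. Qed.

Lemma cderive_RtoC (f : R -> R) x l : is_derive f x l -> cderive (fun y => RtoC (f y)) x (RtoC l).
Proof. intros H; split; simpl; [exact H|apply @is_derive_const]. Qed.

Lemma cderive_plus f g x l m :
  cderive f x l -> cderive g x m -> cderive (fun y => f y + g y)%C x (l + m)%C.
Proof. intros [A B] [D E]; split; simpl; apply @is_derive_plus; assumption. Qed.

Lemma cderive_opp f x l : cderive f x l -> cderive (fun y => - f y)%C x (- l)%C.
Proof. intros [A B]; split; simpl; apply @is_derive_opp; assumption. Qed.

Lemma cderive_minus f g x l m :
  cderive f x l -> cderive g x m -> cderive (fun y => f y - g y)%C x (l - m)%C.
Proof. intros H K; apply cderive_plus, cderive_opp; assumption. Qed.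

Lemma is_derive_Rmult (f g : R -> R) x l m :
  is_derive f x l -> is_derive g x m ->
  is_derive (fun y => f y * g y) x (l * g x + f x * m).
Proof.
  intros A B.
  apply (is_derive_mult f g x l m A B). intros; apply Rmult_comm.
Qed.

Lemma cderive_mult f g x l m :
  cderive f x l -> cderive g x m ->
  cderive (fun y => f y * g y)%C x (l * g x + f x * m)%C.
Proof.
  intros [A B] [D E]; split; simpl.
  - replace (_ + _) with
      ((Re l * Re (g x) + Re (f x) * Re m) - (Im l * Im (g x) + Im (f x) * Im m))
      by (unfold Re, Im; ring).
    apply @is_derive_minus; apply is_derive_Rmult; assumption.
  - replace (_ + _) with
      ((Re l * Im (g x) + Re (f x) * Im m) + (Im l * Re (g x) + Im (f x) * Re m))
      by (unfold Re, Im; ring).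
    apply @is_derive_plus; apply is_derive_Rmult; assumption.
Qed.

Lemma cderive_cmult c f x l : cderive f x l -> cderive (fun y => c * f y)%C x (c * l)%C.
Proof.
  intros H. eapply cderive_eq; [apply (cderive_mult _ _ _ _ _ (cderive_const c x) H)|].
  ring.
Qed.

Lemma Cneq0_sq z : z <> RtoC 0 -> fst z ^ 2 + snd z ^ 2 <> 0.
Proof.
  intros Hz K. apply Hz. destruct z as [a b]; simpl in *.
  assert (a = 0) by nra. assert (b = 0) by nra. now subst.
Qed.

(** Writing the function as a pair of real functions lets a goal about it be handed to
    automatic differentiation. *)
Lemma cderive_pairP (f : R -> C) x l (P : Prop) :
  (forall a b : R -> R, is_derive a x (fst l) -> is_derive b x (snd l) ->
     f = (fun y => (a y, b y)) -> P) ->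
  cderive f x l -> P.
Proof.
  intros K [A B]. apply (K (fun y => fst (f y)) (fun y => snd (f y)) A B).
  apply functional_extensionality. intros y. now destruct (f y).
Qed.

Lemma cderive_inv f x l :
  cderive f x l -> f x <> RtoC 0 -> cderive (fun y => / f y)%C x (- l / (f x * f x))%C.
Proof.
  intros H; pattern f; revert H; apply cderive_pairP. intros a b A B -> Hz.
  pose proof (Cneq0_sq _ Hz) as Hq. destruct l as [l1 l2]; simpl in A, B, Hq.
  assert (Hd : a x * a x + b x * b x <> 0) by (intros K; apply Hq; lra).
  assert (Hd2 : (a x * a x - b x * b x) * (a x * a x - b x * b x) +
    (a x * b x + b x * a x) * (a x * b x + b x * a x) <> 0).
  { replace (_ + _) with ((a x * a x + b x * b x) * (a x * a x + b x * b x)) by ring.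
    now apply Rmult_integral_contrapositive. }
  split; unfold Re, Im; simpl; (eapply is_derive_eq; [auto_derive; [|reflexivity]|]).
  - repeat split; try (exists l1; exact A); try (exists l2; exact B); try exact Hq.
  - rewrite ?(is_derive_unique (fun y => a y) x l1 A : Derive (fun y => a y) x = l1),
      ?(is_derive_unique (fun y => b y) x l2 B : Derive (fun y => b y) x = l2).
    field. split; assumption.
  - repeat split; try (exists l1; exact A); try (exists l2; exact B); try exact Hq.
  - rewrite ?(is_derive_unique (fun y => a y) x l1 A : Derive (fun y => a y) x = l1),
      ?(is_derive_unique (fun y => b y) x l2 B : Derive (fun y => b y) x = l2).
    field. split; assumption.
Qed.

Lemma cderive_exp f x l :
  cderive f x l -> cderive (fun y => Cexp (f y)) x (l * Cexp (f x))%C.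
Proof.
  apply cderive_pairP. intros a b A B ->. destruct l as [l1 l2]; simpl in A, B.
  split; unfold Cexp, Re, Im; simpl; (eapply is_derive_eq; [auto_derive; [|reflexivity]|]).
  - repeat split; try (exists l1; exact A); try (exists l2; exact B).
  - rewrite ?(is_derive_unique (fun y => a y) x l1 A : Derive (fun y => a y) x = l1),
      ?(is_derive_unique (fun y => b y) x l2 B : Derive (fun y => b y) x = l2). ring.
  - repeat split; try (exists l1; exact A); try (exists l2; exact B).
  - rewrite ?(is_derive_unique (fun y => a y) x l1 A : Derive (fun y => a y) x = l1),
      ?(is_derive_unique (fun y => b y) x l2 B : Derive (fun y => b y) x = l2). ring.
Qed.

Lemma cderive_log f x l :
  cderive f x l -> 0 < Re (f x) -> cderive (fun y => Clog (f y)) x (l / f x)%C.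
Proof.
  intros H; pattern f; revert H; apply cderive_pairP. intros a b A B -> Hp.
  destruct l as [l1 l2]; simpl in A, B, Hp.
  assert (Hs : 0 < a x * (a x * 1) + b x * (b x * 1)) by nra.
  split; unfold Clog, Cmod, Re, Im; simpl; (eapply is_derive_eq; [auto_derive; [|reflexivity]|]).
  - repeat split; try (exists l1; exact A); try (exists l2; exact B); try exact Hs.
    apply sqrt_lt_R0, Hs.
  - rewrite ?(is_derive_unique (fun y => a y) x l1 A : Derive (fun y => a y) x = l1),
      ?(is_derive_unique (fun y => b y) x l2 B : Derive (fun y => b y) x = l2).
    set (q := sqrt _).
    assert (Hq : 0 < q) by apply sqrt_lt_R0, Hs.
    assert (Hqq : q * q = a x * (a x * 1) + b x * (b x * 1))
      by (apply sqrt_sqrt; lra).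
    match goal with |- ?u * / (2 * q) * / q = _ =>
      replace (u * / (2 * q) * / q) with ((a x * l1 + b x * l2) / (q * q))
        by (field; lra) end.
    rewrite Hqq. field. lra.
  - repeat split; try (exists l1; exact A); try (exists l2; exact B); lra.
  - rewrite ?(is_derive_unique (fun y => a y) x l1 A : Derive (fun y => a y) x = l1),
      ?(is_derive_unique (fun y => b y) x l2 B : Derive (fun y => b y) x = l2). field. nra.
Qed.

Lemma cderive_pow f x l n :
  cderive f x l ->
  cderive (fun y => f y ^ n)%C x (RtoC (INR n) * f x ^ (pred n) * l)%C.
Proof.
  intros H. induction n as [|n IH].
  - simpl. eapply cderive_eq; [apply cderive_const|]. ring.
  - eapply cderive_eq; [apply (cderive_mult _ _ _ _ _ H IH)|].
    rewrite S_INR, RtoC_plus. destruct n; simpl; ring.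
Qed.

Lemma cderive_cont f x l : cderive f x l -> ccont f x.
Proof.
  intros [A B]; split; apply (ex_derive_continuous (V := R_NormedModule));
    eexists; eassumption.
Qed.

Section Cont.
Context {U : UniformSpace}.
Implicit Types f g : U -> C.

Lemma ccont_ext f g x : (forall y, f y = g y) -> ccont f x -> ccont g x.
Proof.
  intros E [H1 H2]; split.
  - apply (continuous_ext (fun y => Re (f y))); [intros; now rewrite E|exact H1].
  - apply (continuous_ext (fun y => Im (f y))); [intros; now rewrite E|exact H2].
Qed.

Lemma ccont_const c x : ccont (fun _ : U => c) x.
Proof. split; apply continuous_const. Qed.

Lemma ccont_RtoC (f : U -> R) x : continuous f x -> ccont (fun y => RtoC (f y)) x.
Proof. intros H; split; simpl; [exact H|apply continuous_const]. Qed.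

Lemma ccont_plus f g x : ccont f x -> ccont g x -> ccont (fun y => f y + g y)%C x.
Proof.
  intros [A B] [D E]; split; simpl; apply @continuous_plus; assumption.
Qed.

Lemma ccont_opp f x : ccont f x -> ccont (fun y => - f y)%C x.
Proof.
  intros [A B]; split; simpl; apply @continuous_opp; assumption.
Qed.

Lemma ccont_minus f g x : ccont f x -> ccont g x -> ccont (fun y => f y - g y)%C x.
Proof. intros; apply ccont_plus, ccont_opp; assumption. Qed.

Lemma ccont_mult f g x : ccont f x -> ccont g x -> ccont (fun y => f y * g y)%C x.
Proof.
  intros [A B] [D E]; split; simpl.
  - apply @continuous_minus; apply @continuous_mult; assumption.
  - apply @continuous_plus; apply @continuous_mult; assumption.
Qed.

Lemma ccont_pow f x n : ccont f x -> ccont (fun y => f y ^ n)%C x.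
Proof.
  intros H; induction n; simpl; [apply ccont_const|apply ccont_mult; assumption].
Qed.

Lemma continuous_Rcomp (f : U -> R) (h : R -> R) x :
  continuous f x -> ex_derive h (f x) -> continuous (fun y => h (f y)) x.
Proof.
  intros A B. apply (continuous_comp f h x A).
  apply (ex_derive_continuous (V := R_NormedModule)), B.
Qed.

Lemma ccont_exp f x : ccont f x -> ccont (fun y => Cexp (f y)) x.
Proof.
  intros [A B]; split; unfold Cexp; simpl; apply @continuous_mult;
    apply continuous_Rcomp; try assumption; auto_derive; exact I.
Qed.

Lemma ccont_inv f x : ccont f x -> f x <> RtoC 0 -> ccont (fun y => / f y)%C x.
Proof.
  intros [A B] Hz. pose proof (Cneq0_sq _ Hz) as Hz'. simpl in Hz'.
  assert (K : continuous (fun y => / (Re (f y) * Re (f y) + Im (f y) * Im (f y))) x).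
  { apply (continuous_Rcomp _ (fun s => / s)).
    - apply @continuous_plus; apply @continuous_mult; assumption.
    - auto_derive. intros K; apply Hz'. unfold Re, Im in K. nra. }
  split; simpl.
  - eapply continuous_ext; [|apply (continuous_mult _ _ _ A K)].
    intros y; unfold mult; simpl. unfold Rdiv, Re, Im. now rewrite !Rmult_1_r.
  - eapply continuous_ext; [|apply (continuous_mult _ _ _ (continuous_opp _ _ B) K)].
    intros y; unfold mult, opp; simpl. unfold Rdiv, Re, Im. now rewrite !Rmult_1_r.
Qed.

Lemma ccont_log f x : ccont f x -> 0 < Re (f x) -> ccont (fun y => Clog (f y)) x.
Proof.
  intros [A B] Hp; split; unfold Clog; simpl.
  - assert (Hs : 0 < Re (f x) * Re (f x) + Im (f x) * Im (f x)) by nra.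
    eapply continuous_ext with
      (f := fun y => ln (sqrt (Re (f y) * Re (f y) + Im (f y) * Im (f y)))).
    + intros y. unfold Cmod, Re, Im. simpl. now rewrite !Rmult_1_r.
    + apply (continuous_Rcomp _ (fun s => ln (sqrt s))).
      * apply @continuous_plus; apply @continuous_mult; assumption.
      * auto_derive. repeat split; auto. now apply sqrt_lt_R0.
  - apply (continuous_Rcomp _ atan); [|auto_derive; exact I].
    apply @continuous_mult; [exact B|].
    apply (continuous_Rcomp _ (fun s => / s) _ A). auto_derive. lra.
Qed.
End Cont.

(** Continuity of F is expressed for the product uniformity on pairs of reals, hence the
    passage through the filter of product neighbourhoods. *)
Lemma ccont_comp {U : UniformSpace} (F : C -> C) (g : U -> C) x :
  ccont (U := prod_UniformSpace R_UniformSpace R_UniformSpace) F (g x) ->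
  ccont g x -> ccont (fun y => F (g y)) x.
Proof.
  intros [A B] [D E].
  assert (K : filterlim g (locally x)
     (locally (T := prod_UniformSpace R_UniformSpace R_UniformSpace) (g x))).
  { intros P HP.
    assert (Q := filterlim_pair _ _ D E).
    destruct HP as [e He].
    assert (HQ : filter_prod (locally (Re (g x))) (locally (Im (g x)))
       (fun p : R * R => P p)).
    { apply (Filter_prod _ _ _ (fun u => ball (Re (g x)) e u)
        (fun u => ball (Im (g x)) e u)).
      - now exists e. - now exists e.
      - intros u v Hu Hv. apply He. split; assumption. }
    specialize (Q _ HQ). unfold filtermapi, filtermap in *.
    eapply filter_imp; [|exact Q]. intros y Hy. simpl in Hy.
    destruct (g y); exact Hy. }
  split.
  - exact (filterlim_comp _ _ _ g (fun z => Re (F z)) _ _ _ K A).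
  - exact (filterlim_comp _ _ _ g (fun z => Im (F z)) _ _ _ K B).
Qed.

(** * Complex integrals over real intervals *)

Lemma ccont_ex_Re g a b : a <= b -> (forall x, a <= x <= b -> ccont g x) ->
  ex_RInt (fun y => Re (g y)) a b.
Proof.
  intros H K. apply (ex_RInt_continuous (V := R_CompleteNormedModule)).
  intros x Hx. rewrite Rmin_left, Rmax_right in Hx by exact H. exact (proj1 (K x Hx)).
Qed.

Lemma ccont_ex_Im g a b : a <= b -> (forall x, a <= x <= b -> ccont g x) ->
  ex_RInt (fun y => Im (g y)) a b.
Proof.
  intros H K. apply (ex_RInt_continuous (V := R_CompleteNormedModule)).
  intros x Hx. rewrite Rmin_left, Rmax_right in Hx by exact H. exact (proj2 (K x Hx)).
Qed.

Lemma Ceq z w : Re z = Re w -> Im z = Im w -> z = w.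
Proof. destruct z, w; simpl; intros; now subst. Qed.

Lemma CInt_ext f g a b : a <= b -> (forall x, a < x < b -> f x = g x) ->
  CInt f a b = CInt g a b.
Proof.
  intros H E. apply Ceq; simpl; apply RInt_ext; intros x Hx;
    rewrite Rmin_left, Rmax_right in Hx by exact H; now rewrite E.
Qed.

Lemma CInt_FTC G g a b : a <= b ->
  (forall x, a <= x <= b -> cderive G x (g x)) ->
  (forall x, a <= x <= b -> ccont g x) ->
  CInt g a b = (G b - G a)%C.
Proof.
  intros H D K. apply Ceq; simpl;
  apply is_RInt_unique.
  - apply (is_RInt_derive (fun y => Re (G y)) (fun y => Re (g y))); intros x Hx;
      rewrite Rmin_left, Rmax_right in Hx by exact H; [exact (proj1 (D x Hx))|exact (proj1 (K x Hx))].
  - apply (is_RInt_derive (fun y => Im (G y)) (fun y => Im (g y))); intros x Hx;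
      rewrite Rmin_left, Rmax_right in Hx by exact H; [exact (proj2 (D x Hx))|exact (proj2 (K x Hx))].
Qed.

Lemma CInt_plus f g a b : a <= b ->
  (forall x, a <= x <= b -> ccont f x) -> (forall x, a <= x <= b -> ccont g x) ->
  CInt (fun x => f x + g x)%C a b = (CInt f a b + CInt g a b)%C.
Proof.
  intros H Kf Kg. apply Ceq; simpl; apply (RInt_plus (V := R_CompleteNormedModule));
    auto using ccont_ex_Re, ccont_ex_Im.
Qed.

Lemma CInt_cmult c f a b : a <= b ->
  (forall x, a <= x <= b -> ccont f x) ->
  CInt (fun x => c * f x)%C a b = (c * CInt f a b)%C.
Proof.
  intros H Kf. pose proof (ccont_ex_Re f a b H Kf) as X. pose proof (ccont_ex_Im f a b H Kf) as Y.
  apply Ceq; simpl.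
  - change (RInt (fun y => minus (scal (fst c) (Re (f y))) (scal (snd c) (Im (f y)))) a b =
       minus (scal (fst c) (RInt (fun y => Re (f y)) a b)) (scal (snd c) (RInt (fun y => Im (f y)) a b))).
    rewrite (RInt_minus (V := R_CompleteNormedModule)); [|apply @ex_RInt_scal; assumption..].
    rewrite !(RInt_scal (V := R_CompleteNormedModule)); auto.
  - change (RInt (fun y => plus (scal (fst c) (Im (f y))) (scal (snd c) (Re (f y)))) a b =
       plus (scal (fst c) (RInt (fun y => Im (f y)) a b)) (scal (snd c) (RInt (fun y => Re (f y)) a b))).
    rewrite (RInt_plus (V := R_CompleteNormedModule)); [|apply @ex_RInt_scal; assumption..].
    rewrite !(RInt_scal (V := R_CompleteNormedModule)); auto.
Qed.

Lemma CInt_Chasles f a b c : a <= b -> b <= c ->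
  (forall x, a <= x <= c -> ccont f x) ->
  CInt f a c = (CInt f a b + CInt f b c)%C.
Proof.
  intros H1 H2 K.
  assert (K1 : forall x, a <= x <= b -> ccont f x) by (intros; apply K; lra).
  assert (K2 : forall x, b <= x <= c -> ccont f x) by (intros; apply K; lra).
  apply Ceq; simpl; symmetry; apply (RInt_Chasles (V := R_CompleteNormedModule));
    auto using ccont_ex_Re, ccont_ex_Im.
Qed.

(** Rotating by a constant reduces the modulus of a complex integral to real integrals
    of real parts. *)
Lemma Re_cmult_CInt_le c f h a b : a <= b ->
  (forall x, a <= x <= b -> ccont f x) ->
  (forall x, a <= x <= b -> Cmod (f x) <= h x) ->
  ex_RInt h a b ->
  Re (c * CInt f a b)%C <= Cmod c * RInt h a b.
Proof.
  intros H K B E. rewrite <- CInt_cmult by assumption.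
  replace (Cmod c * RInt h a b) with (RInt (fun x => Cmod c * h x) a b)
    by exact (RInt_scal (V := R_CompleteNormedModule) h a b (Cmod c) E).
  apply (RInt_le (fun x => Re (c * f x)%C)); [exact H| | |].
  - apply (ccont_ex_Re (fun x => (c * f x)%C)); [exact H|]. intros x Hx.
    apply ccont_mult; [apply ccont_const|exact (K x Hx)].
  - exact (ex_RInt_scal (V := R_NormedModule) h a b (Cmod c) E).
  - intros x Hx. eapply Rle_trans; [apply Rle_abs|].
    eapply Rle_trans; [apply (re_le_Cmod (c * f x)%C)|].
    rewrite Cmod_mult. apply Rmult_le_compat_l; [apply Cmod_ge_0|]. apply B. lra.
Qed.

(** The constant c of the preceding lemma is taken to be the conjugate of the integral. *)
Lemma CInt_norm f h a b : a <= b ->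
  (forall x, a <= x <= b -> ccont f x) ->
  (forall x, a <= x <= b -> Cmod (f x) <= h x) ->
  ex_RInt h a b ->
  Cmod (CInt f a b) <= RInt h a b.
Proof.
  intros H K B E.
  pose proof (Re_cmult_CInt_le (Cconj (CInt f a b)) f h a b H K B E) as R.
  rewrite Cmod_conj in R. pose proof (Cmod2_alt (CInt f a b)) as Q.
  destruct (Req_dec (Cmod (CInt f a b)) 0) as [Z|NZ].
  - rewrite Z. apply RInt_ge_0; auto.
    intros x Hx. apply Rle_trans with (2 := B x ltac:(lra)), Cmod_ge_0.
  - assert (P : 0 < Cmod (CInt f a b)) by (pose proof (Cmod_ge_0 (CInt f a b)); lra).
    apply Rmult_le_reg_l with (1 := P). refine (Rle_trans _ _ _ _ R). right.
    transitivity (Cmod (CInt f a b) ^ 2); [ring|]. rewrite Q.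
    destruct (CInt f a b) as [p q]. simpl. ring.
Qed.

Lemma CInt_norm_const f M a b : a <= b ->
  (forall x, a <= x <= b -> ccont f x) ->
  (forall x, a <= x <= b -> Cmod (f x) <= M) ->
  Cmod (CInt f a b) <= M * (b - a).
Proof.
  intros H K B. eapply Rle_trans.
  - apply (CInt_norm f (fun _ => M)); auto. apply ex_RInt_const.
  - rewrite RInt_const. unfold scal; simpl; unfold mult; simpl. lra.
Qed.

(** * Holomorphic functions and the sweeping of vertical segments *)

(** Complex differentiability at z with derivative F' z, stated as a chain rule along
    differentiable curves through z: this is the only form in which it is used, and it
    composes without any limit argument. *)
Definition hol (F F' : C -> C) (z : C) : Prop :=
  forall (g : R -> C) x l, g x = z -> cderive g x l ->
    cderive (fun y => F (g y)) x (F' z * l)%C.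

Definition ccont2 (F : C -> C) (z : C) : Prop :=
  ccont (U := prod_UniformSpace R_UniformSpace R_UniformSpace) F z.

Lemma ccont_coords : forall w : C, ccont2 (fun z => z) w.
Proof. intros w; split; [apply continuous_fst|apply continuous_snd]. Qed.

Lemma cderive_vline z x : cderive (fun y => z + Ci * RtoC y)%C x Ci.
Proof.
  eapply cderive_eq.
  - apply cderive_plus; [apply cderive_const|]. apply cderive_cmult, cderive_RtoC.
    apply (is_derive_id (K := R_AbsRing)).
  - simpl. apply Ceq; simpl; unfold one; simpl; ring.
Qed.

(** Differentiation under the integral sign; the derivative is needed on a slightly
    larger y-interval because joint continuity of the derivative is a neighbourhood
    condition at the end points. *)
Lemma CInt_param (f df : R -> R -> C) a b c d x :
  a < x < b -> c <= d ->
  (forall s y, a < s < b -> c <= y <= d -> cderive (fun s => f s y) s (df s y)) ->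
  (exists r, 0 < r /\ forall y, c - r < y < d + r ->
     forall s, a < s < b -> cderive (fun s => f s y) s (df s y)) ->
  (forall y, c <= y <= d -> ccont (U := prod_UniformSpace R_UniformSpace R_UniformSpace)
     (fun p => df (fst p) (snd p)) (x, y)) ->
  (forall s y, a < s < b -> c <= y <= d -> ccont (f s) y) ->
  cderive (fun s => CInt (f s) c d) x (CInt (df x) c d).
Proof.
  intros Hx Hcd D [r [Hr Dr]] Cd Cf.
  assert (Hloc : locally x (fun s => a < s < b)).
  { apply (open_and (fun s => a < s) (fun s => s < b)); [apply open_gt|apply open_lt|exact Hx]. }
  assert (Gen : forall h : C -> R,
    (h = Re \/ h = Im) ->
    is_derive (K := R_AbsRing) (V := R_NormedModule)
      (fun s => RInt (fun y => h (f s y)) c d) x (RInt (fun y => h (df x y)) c d)).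
  { intros h Hh.
    assert (Dh : forall s y, a < s < b -> c - r < y < d + r ->
       is_derive (fun s => h (f s y)) s (h (df s y))).
    { intros s y Hs Hy. destruct Hh as [-> | ->]; apply (Dr y Hy s Hs). }
    assert (E : RInt (fun y => h (df x y)) c d =
                RInt (fun y => Derive (fun u => h (f u y)) x) c d).
    { apply RInt_ext. intros y Hy. rewrite Rmin_left, Rmax_right in Hy by exact Hcd.
      symmetry. apply is_derive_unique, Dh; lra. }
    rewrite E.
    apply (is_derive_RInt_param (fun s y => h (f s y))).
    - eapply filter_imp; [|exact Hloc]. intros s Hs y Hy.
      rewrite Rmin_left, Rmax_right in Hy by exact Hcd.
      exists (h (df s y)). apply Dh; lra.
    - intros y Hy. rewrite Rmin_left, Rmax_right in Hy by exact Hcd.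
      apply continuity_2d_pt_ext_loc with (fun u v => h (df u v)).
      + destruct Hloc as [e He].
        assert (Hm : 0 < Rmin e r) by (apply Rmin_glb_lt; [apply cond_pos|exact Hr]).
        exists (mkposreal _ Hm). simpl. intros u v Hu Hv. symmetry.
        apply is_derive_unique, Dh.
        * apply He. apply (Rlt_le_trans _ _ _ Hu), Rmin_l.
        * assert (Rabs (v - y) < r) by (apply (Rlt_le_trans _ _ _ Hv), Rmin_r).
          apply Rabs_def2 in H. lra.
      + apply continuity_2d_pt_filterlim. specialize (Cd y Hy).
        destruct Hh as [-> | ->]; apply Cd.
    - eapply filter_imp; [|exact Hloc]. intros s Hs.
      destruct Hh as [-> | ->]; [apply ccont_ex_Re|apply ccont_ex_Im];
        auto. }
  split; unfold CInt.
  - cbv [Re Im fst snd].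
    pose proof (Gen Re (or_introl eq_refl)) as G1. cbv [Re Im fst snd] in G1. exact G1.
  - cbv [Re Im fst snd].
    pose proof (Gen Im (or_intror eq_refl)) as G1. cbv [Re Im fst snd] in G1. exact G1.
Qed.

(** The form of Cauchy's theorem used throughout: moving the foot z of a vertical
    segment along a curve changes the integral over the segment by the integrals along
    the bottom and top edges. Differentiating in s under the integral turns the
    derivative of F along the curve into a y-derivative, so that the inner integral
    telescopes. *)
Lemma sweep (F F' : C -> C) (z dz : R -> C) a0 a b b0 c H r :
  a0 < a -> a <= b -> b < b0 -> c <= H -> 0 < r ->
  (forall s, a0 < s < b0 -> cderive z s (dz s)) ->
  (forall s, a0 < s < b0 -> ccont dz s) ->
  (forall s y, a0 < s < b0 -> c - r < y ->
     hol F F' (z s + Ci * RtoC y)%C /\ ccont2 F' (z s + Ci * RtoC y)%C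
     /\ ccont2 F (z s + Ci * RtoC y)%C) ->
  (CInt (fun y => Ci * F (z b + Ci * RtoC y)) c H
   - CInt (fun y => Ci * F (z a + Ci * RtoC y)) c H
   = CInt (fun s => (F (z s + Ci * RtoC H) - F (z s + Ci * RtoC c)) * dz s) a b)%C.
Proof.
  intros Ha Hab Hb HH Hr Dz Cz HF. symmetry.
  apply (CInt_FTC (fun s => CInt (fun y => Ci * F (z s + Ci * RtoC y))%C c H)); [exact Hab| |].
  - intros s Hs.
    assert (Hs' : a0 < s < b0) by lra.
    replace ((F (z s + Ci * RtoC H) - F (z s + Ci * RtoC c)) * dz s)%C
      with (CInt (fun y => dz s * (F' (z s + Ci * RtoC y) * Ci))%C c H).
    + assert (Hc : forall (y : R), c - r < y -> forall s, a0 < s < b0 ->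
        cderive (fun s0 => (Ci * F (z s0 + Ci * RtoC y))%C) s
          (dz s * (F' (z s + Ci * RtoC y) * Ci))%C).
      { intros y Hy s1 Hs1. eapply cderive_eq.
        - apply cderive_cmult. apply (proj1 (HF s1 y Hs1 Hy)); [reflexivity|].
          apply cderive_plus; [apply Dz, Hs1|apply cderive_const].
        - ring. }
      apply (CInt_param (fun s y => (Ci * F (z s + Ci * RtoC y))%C)
         (fun s y => (dz s * (F' (z s + Ci * RtoC y) * Ci))%C) a0 b0 c H s Hs' HH).
      * intros; apply Hc; lra.
      * exists r. split; [exact Hr|]. intros; apply Hc; lra.
      * intros y Hy. simpl.
        assert (Kz : ccont (U := prod_UniformSpace R_UniformSpace R_UniformSpace)
                  (fun p : R * R => z (fst p)) (s, y)).
        { destruct (cderive_cont _ _ _ (Dz s Hs')) as [A B].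
          split; [apply (continuous_comp fst (fun s => Re (z s)))
                 |apply (continuous_comp fst (fun s => Im (z s)))];
            try apply continuous_fst; assumption. }
        assert (Kd : ccont (U := prod_UniformSpace R_UniformSpace R_UniformSpace)
                  (fun p : R * R => dz (fst p)) (s, y)).
        { destruct (Cz s Hs') as [A B].
          split; [apply (continuous_comp fst (fun s => Re (dz s)))
                 |apply (continuous_comp fst (fun s => Im (dz s)))];
            try apply continuous_fst; assumption. }
        apply ccont_mult; [exact Kd|]. apply ccont_mult; [|apply ccont_const].
        apply (ccont_comp F' (fun p : R * R => (z (fst p) + Ci * RtoC (snd p))%C)).
        -- exact (proj1 (proj2 (HF s y Hs' ltac:(lra)))).
        -- apply ccont_plus; [exact Kz|]. apply ccont_mult; [apply ccont_const|].
           apply ccont_RtoC, continuous_snd.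
      * intros s1 y Hs1 Hy. apply ccont_mult; [apply ccont_const|].
        apply (ccont_comp F (fun y : R => (z s1 + Ci * RtoC y)%C)).
        -- exact (proj2 (proj2 (HF s1 y Hs1 ltac:(lra)))).
        -- apply (cderive_cont _ _ _ (cderive_vline _ _)).
    + rewrite (CInt_FTC (fun y => dz s * F (z s + Ci * RtoC y))%C).
      * ring.
      * exact HH.
      * intros y Hy. apply cderive_cmult.
        apply (proj1 (HF s y Hs' ltac:(lra))); [reflexivity|apply cderive_vline].
      * intros y Hy. apply ccont_mult; [apply ccont_const|].
        apply ccont_mult; [|apply ccont_const].
        apply (ccont_comp F' (fun y : R => (z s + Ci * RtoC y)%C)).
        -- exact (proj1 (proj2 (HF s y Hs' ltac:(lra)))).
        -- apply (cderive_cont _ _ _ (cderive_vline _ _)).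
  - intros s Hs. assert (Hs' : a0 < s < b0) by lra.
    apply ccont_mult; [|apply Cz, Hs'].
    apply ccont_minus.
    + apply (ccont_comp F (fun s => (z s + Ci * RtoC H)%C)); [apply HF; lra|].
      apply ccont_plus; [apply (cderive_cont _ _ _ (Dz s Hs'))|apply ccont_const].
    + apply (ccont_comp F (fun s => (z s + Ci * RtoC c)%C)); [apply HF; lra|].
      apply ccont_plus; [apply (cderive_cont _ _ _ (Dz s Hs'))|apply ccont_const].
Qed.

Lemma hol_ext F G F' G' z : (forall w, F w = G w) -> F' z = G' z -> hol F F' z -> hol G G' z.
Proof.
  intros E E' H g x l Hg D. eapply cderive_ext; [intros; apply E|]. rewrite <- E'.
  now apply H.
Qed.

Lemma hol_const c z : hol (fun _ => c) (fun _ => 0) z.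
Proof. intros g x l Hg D. eapply cderive_eq; [apply cderive_const|ring]. Qed.

Lemma hol_id z : hol (fun w => w) (fun _ => 1) z.
Proof. intros g x l Hg D. eapply cderive_eq; [exact D|ring]. Qed.

Lemma hol_plus F G F' G' z : hol F F' z -> hol G G' z ->
  hol (fun w => F w + G w)%C (fun w => F' w + G' w)%C z.
Proof.
  intros HF HG g x l Hg D. eapply cderive_eq; [apply cderive_plus; [apply HF|apply HG]; eassumption|ring].
Qed.

Lemma hol_mult F G F' G' z : hol F F' z -> hol G G' z ->
  hol (fun w => F w * G w)%C (fun w => F' w * G w + F w * G' w)%C z.
Proof.
  intros HF HG g x l Hg D. subst z.
  eapply cderive_eq; [apply cderive_mult; [apply HF|apply HG]; try reflexivity; eassumption|].
  simpl. ring.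
Qed.

Lemma hol_inv F F' z : hol F F' z -> F z <> RtoC 0 ->
  hol (fun w => / F w)%C (fun w => - F' w / (F w * F w))%C z.
Proof.
  intros HF HZ g x l Hg D. subst z.
  eapply cderive_eq; [apply cderive_inv; [apply HF; [reflexivity|exact D]|exact HZ]|].
  simpl. field. exact HZ.
Qed.

Lemma hol_exp F F' z : hol F F' z ->
  hol (fun w => Cexp (F w)) (fun w => F' w * Cexp (F w))%C z.
Proof.
  intros HF g x l Hg D. subst z.
  eapply cderive_eq; [apply cderive_exp; apply HF; [reflexivity|exact D]|].
  simpl. ring.
Qed.

Lemma hol_log z : 0 < Re z -> hol Clog (fun w => / w)%C z.
Proof.
  intros HZ g x l Hg D. subst z.
  eapply cderive_eq; [apply cderive_log; [exact D|exact HZ]|].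
  unfold Cdiv. ring.
Qed.

Lemma hol_pow F F' z n : hol F F' z ->
  hol (fun w => F w ^ n)%C (fun w => RtoC (INR n) * F w ^ (pred n) * F' w)%C z.
Proof.
  intros HF g x l Hg D. subst z.
  eapply cderive_eq; [apply cderive_pow; apply HF; [reflexivity|exact D]|].
  simpl. ring.
Qed.

(** * The complex exponential and a periodic kernel with poles at the integers *)

Lemma Cexp_plus z w : Cexp (z + w)%C = (Cexp z * Cexp w)%C.
Proof.
  destruct z as [a b], w as [c d]. unfold Cexp.
  apply Ceq; simpl; rewrite exp_plus, ?cos_plus, ?sin_plus; ring.
Qed.

Lemma Cexp_0 : Cexp 0 = 1.
Proof. unfold Cexp. apply Ceq; simpl; rewrite exp_0, ?cos_0, ?sin_0; ring. Qed.

Lemma Cmod_Cexp z : Cmod (Cexp z) = exp (Re z).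
Proof.
  unfold Cexp, Cmod. simpl.
  replace (_ + _) with (Rsqr (exp (Re z)) * (Rsqr (sin (Im z)) + Rsqr (cos (Im z))))
    by (unfold Rsqr; ring).
  rewrite sin2_cos2, Rmult_1_r. apply sqrt_Rsqr. left. apply exp_pos.
Qed.

Lemma Cexp_RtoC x : Cexp (RtoC x) = RtoC (exp x).
Proof. unfold Cexp. apply Ceq; simpl; rewrite ?cos_0, ?sin_0; ring. Qed.

Lemma Cexp_neq0 z : Cexp z <> RtoC 0.
Proof.
  intros K. pose proof (Cmod_Cexp z) as H. rewrite K, Cmod_0 in H.
  pose proof (exp_pos (Re z)). lra.
Qed.

Lemma Cexp_opp z : Cexp (- z)%C = (/ Cexp z)%C.
Proof.
  assert (E : (Cexp (- z) * Cexp z)%C = RtoC 1).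
  { rewrite <- Cexp_plus, <- Cexp_0. f_equal. ring. }
  rewrite <- (Cmult_1_l (/ Cexp z)), <- E. field. apply Cexp_neq0.
Qed.

Lemma Cexp_mult_nat n z : Cexp (RtoC (INR n) * z)%C = (Cexp z ^ n)%C.
Proof.
  induction n as [|n IH].
  - simpl. rewrite Cmult_0_l. apply Cexp_0.
  - rewrite S_INR, RtoC_plus, Cmult_plus_distr_r, Cexp_plus, IH, Cmult_1_l. simpl. ring.
Qed.

Lemma incr_of_derive (f df : R -> R) a b : a <= b ->
  (forall x, a <= x <= b -> is_derive f x (df x)) ->
  (forall x, a <= x <= b -> 0 <= df x) -> f a <= f b.
Proof.
  intros H D P. destruct (MVT_gen f a b df) as [c [Hc E]].
  - intros x Hx. rewrite Rmin_left, Rmax_right in Hx by exact H. apply D; lra.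
  - intros x Hx. rewrite Rmin_left, Rmax_right in Hx by exact H.
    apply continuity_pt_filterlim.
    apply (ex_derive_continuous (V := R_NormedModule)). eexists. apply D; lra.
  - rewrite Rmin_left, Rmax_right in Hc by exact H. specialize (P c Hc). nra.
Qed.

Lemma sin_ge_quarter x : 0 <= x <= PI / 2 -> x / 4 <= sin x.
Proof.
  intros [H0 H1]. pose proof PI_4 as P4. pose proof PI_RGT_0.
  destruct (Rle_lt_dec x (PI / 3)) as [Hs|Hs].
  - assert (sin 0 - 0 / 2 <= sin x - x / 2).
    { apply (incr_of_derive (fun t => sin t - t / 2) (fun t => cos t - 1 / 2)); [exact H0| |].
      - intros t _. auto_derive; [exact I|field].
      - intros t Ht. rewrite <- cos_PI3.
        assert (cos (PI / 3) <= cos t) by (apply cos_decr_1; lra). lra. }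
    rewrite sin_0 in *. lra.
  - assert (sin (PI / 6) <= sin x) by (apply sin_incr_1; lra).
    rewrite sin_PI6 in *. lra.
Qed.

(** Since |e^(a+ib) - 1|^2 = (e^a - 1)^2 + 2 e^a (1 - cos b), the estimate reduces to
    e^a - 1 >= a and 1 - cos b >= b^2 / 32 for |b| <= PI. *)
Lemma Cexp_minus_one_ge w : 0 <= Re w -> Rabs (Im w) <= PI ->
  Cmod w / 4 <= Cmod (Cexp w - 1)%C.
Proof.
  destruct w as [a b]. simpl. intros Ha Hb.
  assert (H1 : 1 + a <= exp a) by apply exp_ineq1_le.
  assert (H2 : Rabs b / 2 / 4 <= sin (Rabs b / 2)).
  { apply sin_ge_quarter. pose proof (Rabs_pos b). lra. }
  assert (H3 : b * b / 32 <= 1 - cos b).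
  { replace (cos b) with (cos (Rabs b)).
    2:{ unfold Rabs. destruct (Rcase_abs b); [apply cos_neg|reflexivity]. }
    replace (cos (Rabs b)) with (cos (2 * (Rabs b / 2))) by (f_equal; field).
    rewrite cos_2a_sin.
    replace (b * b) with (Rabs b * Rabs b)
      by (unfold Rabs; destruct (Rcase_abs b); ring).
    pose proof (Rabs_pos b). nra. }
  apply Rsqr_incr_0_var; [|apply Cmod_ge_0].
  replace (Rsqr (Cmod (a, b) / 4)) with (Cmod (a, b) ^ 2 / 16) by (unfold Rsqr; field).
  replace (Rsqr (Cmod (Cexp (a, b) - 1)%C)) with (Cmod (Cexp (a, b) - 1)%C ^ 2) by (unfold Rsqr; ring).
  rewrite !Cmod2_alt. unfold Cexp. simpl.
  pose proof (sin2_cos2 b) as SC. unfold Rsqr in SC.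
  match goal with |- _ <= ?r => replace r with
    ((exp a - 1) * (exp a - 1) + 2 * exp a * (1 - cos b)
      + exp a * exp a * (sin b * sin b + cos b * cos b - 1)) by ring end.
  rewrite SC.
  assert (a * a <= (exp a - 1) * (exp a - 1)) by nra.
  assert (1 * (b * b / 32) <= exp a * (1 - cos b)) by (apply Rmult_le_compat; nra).
  nra.
Qed.

Lemma Cexp_neq1 w : w <> RtoC 0 -> Rabs (Im w) < 2 * PI -> Cexp w <> RtoC 1.
Proof.
  intros Hw Hi E. apply Hw.
  assert (R : Re w = 0).
  { pose proof (Cmod_Cexp w) as M. rewrite E, Cmod_1 in M.
    apply exp_inv. rewrite exp_0. lra. }
  apply Ceq; [exact R|]. simpl.
  assert (Cs : cos (Im w) = 1).
  { apply (f_equal Re) in E. unfold Cexp in E. simpl in E. rewrite R, exp_0 in E. lra. }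
  set (b := Im w) in *.
  assert (S : sin (Rabs b / 2) = 0).
  { replace (cos b) with (cos (2 * (Rabs b / 2))) in Cs.
    - rewrite cos_2a_sin in Cs. nra.
    - replace (2 * (Rabs b / 2)) with (Rabs b) by field.
      unfold Rabs. destruct (Rcase_abs b); [apply cos_neg|reflexivity]. }
  destruct (Req_dec (Rabs b) 0) as [Z|NZ].
  - unfold Rabs in Z. destruct (Rcase_abs b); lra.
  - exfalso. pose proof (Rabs_pos b).
    assert (0 < sin (Rabs b / 2)) by (apply sin_gt_0; lra). lra.
Qed.

(** The Fermi factor 1 / (e^(2 pi y) + 1), the kernel of the midpoint Abel-Plana
    formula. *)
Definition fermi (y : R) : R := / (exp (2 * PI * y) + 1).

Lemma fermi_pos y : 0 < fermi y.
Proof. apply Rinv_0_lt_compat. pose proof (exp_pos (2 * PI * y)). lra. Qed.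

Lemma fermi_le y : fermi y <= exp (- (2 * PI * y)).
Proof.
  unfold fermi. rewrite exp_Ropp. apply Rinv_le_contravar; [apply exp_pos|].
  lra.
Qed.

(** With fermi_le: the Fermi factor is e^(-2 pi y) up to an error between 0 and e^(-4 pi
    y). *)
Lemma fermi_ge y : exp (- (2 * PI * y)) - exp (- (4 * PI * y)) <= fermi y.
Proof.
  unfold fermi. replace (4 * PI * y) with (2 * PI * y + 2 * PI * y) by ring.
  rewrite Ropp_plus_distr, exp_plus, !exp_Ropp.
  pose proof (exp_pos (2 * PI * y)) as P. set (e := exp _) in *.
  apply Rmult_le_reg_l with (e * e * (e + 1)); [nra|].
  replace (e * e * (e + 1) * (/ e - / e * / e)) with (e * e - 1) by (field; lra).
  replace (e * e * (e + 1) * / (e + 1)) with (e * e) by (field; lra). lra.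
Qed.

Lemma fermi_cont y : continuous fermi y.
Proof.
  apply (ex_derive_continuous (V := R_NormedModule)). unfold fermi. auto_derive.
  pose proof (exp_pos (2 * PI * y)). lra.
Qed.

(** 1 / (e^(-2 pi i w) - 1) has a simple pole at each integer, real part -1/2 on the
    real axis in between, and equals minus the Fermi factor on the lines Re w = 1/2 and
    Re w = -1/2. *)
Definition pole_kernel (w : C) : C := (/ (Cexp (- (2 * PI) * Ci * w) - 1))%C.

Lemma pole_kernel_arg (w : C) : (- (2 * PI) * Ci * w)%C = (2 * PI * Im w, - (2 * PI * Re w)).
Proof. destruct w; apply Ceq; simpl; ring. Qed.

Lemma pole_kernel_den w : w <> RtoC 0 -> Rabs (Re w) < 1 ->
  (Cexp (- (2 * PI) * Ci * w) - 1)%C <> RtoC 0.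
Proof.
  intros Hw Hr K. assert (E : Cexp (- (2 * PI) * Ci * w)%C = RtoC 1).
  { rewrite <- (Cplus_0_l 1), <- K. ring. }
  revert E. apply Cexp_neq1; rewrite pole_kernel_arg.
  - intros E. apply Hw. pose proof PI_RGT_0. inversion E.
    apply Ceq; simpl; nra.
  - simpl. pose proof PI_RGT_0. rewrite Rabs_Ropp, Rabs_mult, (Rabs_pos_eq (2 * PI)) by lra. nra.
Qed.

Lemma pole_kernel_bound w : w <> RtoC 0 -> Rabs (Re w) <= 1 / 2 -> 0 <= Im w ->
  Cmod (pole_kernel w) <= / Cmod w.
Proof.
  intros Hw Hr Hi. unfold pole_kernel. rewrite Cmod_inv by (apply pole_kernel_den; [exact Hw|lra]).
  apply Rinv_le_contravar; [now apply Cmod_gt_0|].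
  pose proof PI_RGT_0. pose proof PI2_3_2 as P3.
  refine (Rle_trans _ _ _ _ (Cexp_minus_one_ge _ _ _)).
  - rewrite !Cmod_mult, Cmod_Ci, Cmod_opp, <- RtoC_mult, Cmod_R, Rabs_pos_eq by lra.
    pose proof (Cmod_ge_0 w). nra.
  - rewrite pole_kernel_arg. simpl. nra.
  - rewrite pole_kernel_arg. simpl. rewrite Rabs_Ropp, Rabs_mult, (Rabs_pos_eq (2 * PI)) by lra. nra.
Qed.

Lemma pole_kernel_top w : 1 <= Im w -> Cmod (pole_kernel w) <= 2 * exp (- (2 * PI * Im w)).
Proof.
  intros Hi. unfold pole_kernel. pose proof PI_RGT_0. pose proof PI2_3_2 as P3.
  assert (E : exp (2 * PI * Im w) - 1 <= Cmod (Cexp (- (2 * PI) * Ci * w) - 1)%C).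
  { pose proof (Cmod_triangle (Cexp (- (2 * PI) * Ci * w) - 1)%C 1) as T.
    replace (Cexp (- (2 * PI) * Ci * w) - 1 + 1)%C with (Cexp (- (2 * PI) * Ci * w)) in T by ring.
    rewrite Cmod_Cexp, pole_kernel_arg, Cmod_1 in T. simpl in T. rewrite pole_kernel_arg. lra. }
  assert (B : 2 <= exp (2 * PI * Im w)).
  { apply Rle_trans with (1 + 2 * PI * Im w); [nra|]. apply exp_ineq1_le. }
  rewrite Cmod_inv.
  - rewrite exp_Ropp. apply Rle_trans with (/ (exp (2 * PI * Im w) / 2)).
    + apply Rinv_le_contravar; lra.
    + right. field. pose proof (exp_pos (2 * PI * Im w)). lra.
  - intros K. rewrite K, Cmod_0 in E. lra.
Qed.

Lemma pole_kernel_edge (y s : R) : (s = 1 / 2 \/ s = - (1 / 2)) ->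
  pole_kernel (RtoC s + Ci * RtoC y)%C = RtoC (- fermi y).
Proof.
  intros Hs. unfold pole_kernel. rewrite pole_kernel_arg.
  assert (E : Cexp (2 * PI * Im (RtoC s + Ci * RtoC y), - (2 * PI * Re (RtoC s + Ci * RtoC y)))
     = RtoC (- exp (2 * PI * y))).
  { unfold Cexp. apply Ceq; simpl;
    replace (0 * y + 1 * 0) with 0 by ring; replace (s + (0 * y - 1 * 0)) with s by ring;
    replace (0 + (0 * 0 + 1 * y)) with y by ring;
    rewrite cos_neg || rewrite sin_neg; destruct Hs as [-> | ->].
    - replace (2 * PI * (1/2)) with PI by field. rewrite cos_PI. ring.
    - replace (2 * PI * (-(1/2))) with (-PI) by field. rewrite cos_neg, cos_PI. ring.
    - replace (2 * PI * (1/2)) with PI by field. rewrite sin_PI. ring.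
    - replace (2 * PI * (-(1/2))) with (-PI) by field. rewrite sin_neg, sin_PI. ring. }
  rewrite E. unfold fermi. pose proof (exp_pos (2 * PI * y)).
  rewrite <- RtoC_minus, <- RtoC_inv by lra. f_equal. field. lra.
Qed.

Lemma pole_kernel_real s : s <> 0 -> Rabs s < 1 -> Re (pole_kernel (RtoC s)) = - (1 / 2).
Proof.
  intros H0 H1. pose proof (pole_kernel_den (RtoC s)) as D. unfold pole_kernel. rewrite pole_kernel_arg in *.
  simpl in *. unfold Cexp in *. simpl in *.
  rewrite !Rmult_0_r, !exp_0, !Rmult_1_l in *.
  assert (D' := D (fun K => H0 (RtoC_inj _ _ K)) H1). clear D.
  set (c := cos _) in *. set (n := sin _) in *.
  assert (SC : n * n + c * c = 1) by apply sin2_cos2.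
  assert (c <> 1).
  { intros K. apply D'. apply Ceq; simpl; nra. }
  match goal with |- _ / ?d = _ => replace d with (2 * (1 - c)) end.
  - field. lra.
  - transitivity (n * n + c * c + 1 - 2 * c); [rewrite SC; ring|ring].
Qed.

Definition pole_kernel' (w : C) : C :=
  (2 * PI * Ci * Cexp (- (2 * PI) * Ci * w) * (pole_kernel w * pole_kernel w))%C.

Lemma hol_pole_kernel p z : z <> p -> Rabs (Re (z - p)%C) < 1 ->
  hol (fun w => pole_kernel (w - p))%C (fun w => pole_kernel' (w - p))%C z.
Proof.
  intros Hz Hr.
  assert (Hn : (z - p)%C <> RtoC 0).
  { intros K. apply Hz. replace z with (z - p + p)%C by ring. rewrite K. ring. }
  pose proof (pole_kernel_den _ Hn Hr) as D.
  eapply hol_ext; [reflexivity| |apply hol_inv; [apply hol_plus;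
    [apply hol_exp, hol_mult; [apply hol_const|apply hol_plus; [apply hol_id|apply hol_const]]
    |apply hol_const]|exact D]].
  simpl. unfold pole_kernel', pole_kernel, Cminus in *. field. intros K. apply D. rewrite <- K. ring.
Qed.

Lemma ccont2_pole_kernel p z : z <> p -> Rabs (Re (z - p)%C) < 1 ->
  ccont2 (fun w => pole_kernel (w - p))%C z /\ ccont2 (fun w => pole_kernel' (w - p))%C z.
Proof.
  intros Hz Hr.
  assert (Hn : (z - p)%C <> RtoC 0).
  { intros K. apply Hz. replace z with (z - p + p)%C by ring. rewrite K. ring. }
  pose proof (pole_kernel_den _ Hn Hr) as D.
  assert (K0 : ccont2 (fun w => Cexp (- (2 * PI) * Ci * (w - p)))%C z).
  { unfold ccont2. apply ccont_exp, ccont_mult; [apply ccont_const|].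
    apply ccont_minus; [apply ccont_coords|apply ccont_const]. }
  assert (K1 : ccont2 (fun w => pole_kernel (w - p))%C z).
  { unfold ccont2, pole_kernel. apply ccont_inv; [|exact D].
    apply ccont_minus; [exact K0|apply ccont_const]. }
  split; [exact K1|]. unfold ccont2, pole_kernel' in *.
  apply ccont_mult; [|now apply ccont_mult]. apply ccont_mult; [apply ccont_const|exact K0].
Qed.

(** Lets the width of the excluded neighbourhood of the pole tend to 0. *)
Lemma Rle_of_lin_eps x y K : (forall e, 0 < e <= 1 / 2 -> x <= y + K * e) -> x <= y.
Proof.
  intros H. destruct (Rle_lt_dec x y) as [L|L]; [exact L|exfalso].
  set (k := Rabs K + 1). assert (Hk : 1 <= k) by (unfold k; pose proof (Rabs_pos K); lra).
  (* Small enough that K e cannot exceed half the gap x - y. *)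
  set (e := Rmin (1/2) ((x - y) / (2 * k))).
  assert (He : 0 < e). { apply Rmin_glb_lt; [lra|]. apply Rdiv_lt_0_compat; lra. }
  assert (He1 : e <= 1/2) by apply Rmin_l.
  assert (He2 : e <= (x - y) / (2 * k)) by apply Rmin_r.
  specialize (H e (conj He He1)).
  assert (K * e <= k * e). { apply Rmult_le_compat_r; [lra|]. unfold k. pose proof (Rle_abs K). lra. }
  assert (k * e <= (x - y) / 2).
  { apply Rmult_le_compat_l with (r := k) in He2; [|lra].
    replace (k * ((x - y) / (2 * k))) with ((x - y) / 2) in He2 by (field; lra). exact He2. }
  lra.
Qed.

(** * The midpoint Abel-Plana formula on one strip *)

Section Strip.
Variables (f f' : C -> C) (p M M1 : R).
Hypothesis Hf : forall z, Rabs (Re z - p) < 3 / 4 ->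
  hol f f' z /\ ccont2 f z /\ ccont2 f' z.
Hypothesis Hreal : forall s, Rabs s < 3 / 4 -> Im (f (RtoC (p + s))) = 0.
Hypothesis HM : forall z, Rabs (Re z - p) <= 1 / 2 -> 0 <= Im z -> Cmod (f z) <= M.
Hypothesis HM1 : forall z, Rabs (Re z - p) <= 1 / 2 -> 0 <= Im z ->
  Cmod (f z - f p)%C <= M1 * Cmod (z - p)%C.

Let G (z : C) : C := ((f z - f p) * pole_kernel (z - p))%C.
Let G' (z : C) : C := (f' z * pole_kernel (z - p) + (f z - f p) * pole_kernel' (z - p))%C.

Lemma strip_hol z : Rabs (Re z - p) < 3 / 4 -> z <> RtoC p ->
  hol G G' z /\ ccont2 G' z /\ ccont2 G z.
Proof.
  intros Hz Hn. destruct (Hf z Hz) as [H1 [H2 H3]].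
  assert (Hr : Rabs (Re (z - p)%C) < 1) by (change (Rabs (Re z - p) < 1); lra).
  destruct (ccont2_pole_kernel p z Hn Hr) as [K1 K2].
  split; [|split].
  - eapply hol_ext; [reflexivity| |apply hol_mult; [apply hol_plus; [exact H1|apply hol_const]
      |apply hol_pole_kernel; [exact Hn|exact Hr]]].
    simpl. unfold G'. unfold Cminus. ring.
  - apply ccont_plus; apply ccont_mult; try assumption.
    apply ccont_minus; [exact H2|apply ccont_const].
  - apply ccont_mult; try assumption. apply ccont_minus; [exact H2|apply ccont_const].
Qed.

Lemma strip_M1 : 0 <= M1.
Proof.
  pose proof (HM1 (p, 1)) as H. simpl in H.
  assert (E : (p, 1) = (RtoC p + Ci)%C) by (apply Ceq; simpl; ring).
  assert (H' : Cmod (f (p, 1) - f p)%C <= M1 * Cmod ((p, 1) - p)%C).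
  { apply H; [|lra]. rewrite Rminus_diag, Rabs_R0. lra. }
  replace ((p, 1) - p)%C with Ci in H' by (apply Ceq; simpl; ring).
  rewrite Cmod_Ci in H'. pose proof (Cmod_ge_0 (f (p, 1) - f p)%C). lra.
Qed.

(** Subtracting f p makes the singularity at p removable: the Lipschitz bound on f
    cancels the pole of the kernel. *)
Lemma strip_bound z : Rabs (Re z - p) <= 1 / 2 -> 0 <= Im z -> Cmod (Ci * G z)%C <= M1.
Proof.
  intros Hz Hi. rewrite Cmod_mult, Cmod_Ci, Rmult_1_l. unfold G. rewrite Cmod_mult.
  pose proof strip_M1 as P1.
  destruct (Req_dec (Cmod (z - p)%C) 0) as [Z|NZ].
  - apply Cmod_eq_0 in Z. pose proof (HM1 z Hz Hi) as H. rewrite Z, Cmod_0 in H.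
    pose proof (Cmod_ge_0 (f z - f p)%C). replace (Cmod (f z - f p)%C) with 0 by lra. lra.
  - assert (NZ' : (z - p)%C <> RtoC 0) by (intros K; apply NZ; rewrite K; apply Cmod_0).
    assert (Pz : 0 < Cmod (z - p)%C) by now apply Cmod_gt_0.
    apply Rle_trans with (M1 * Cmod (z - p)%C * / Cmod (z - p)%C).
    + apply Rmult_le_compat; try apply Cmod_ge_0; [apply HM1; assumption|].
      apply pole_kernel_bound; [exact NZ'|exact Hz|change (0 <= Im z - 0); lra].
    + right. field. lra.
Qed.

Lemma strip_top z : Rabs (Re z - p) <= 1 / 2 -> 1 <= Im z ->
  Cmod (G z) <= 4 * M * exp (- (2 * PI * Im z)).
Proof.
  intros Hz Hi. unfold G. rewrite Cmod_mult.
  apply Rle_trans with ((2 * M) * (2 * exp (- (2 * PI * Im z)))); [|right; ring].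
  apply Rmult_le_compat; try apply Cmod_ge_0.
  - unfold Cminus. eapply Rle_trans; [apply Cmod_triangle|]. rewrite Cmod_opp.
    assert (Cmod (f z) <= M) by (apply HM; lra).
    assert (Cmod (f p) <= M).
    { apply HM; simpl; [rewrite Rminus_diag, Rabs_R0|]; lra. }
    lra.
  - pose proof (pole_kernel_top (z - p)%C) as Q.
    replace (Im (z - p)%C) with (Im z) in Q by (simpl; unfold Im; ring). apply Q. exact Hi.
Qed.

Let W (s : R) (c d : R) : C := CInt (fun y => Ci * G (RtoC (p + s) + Ci * RtoC y))%C c d.

Lemma strip_pt_Re s y : Re (RtoC (p + s) + Ci * RtoC y)%C = p + s.
Proof. simpl. ring. Qed.
Lemma strip_pt_Im s y : Im (RtoC (p + s) + Ci * RtoC y)%C = y.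
Proof. simpl. ring. Qed.
Lemma strip_pt_neq s y : s <> 0 \/ y <> 0 -> (RtoC (p + s) + Ci * RtoC y)%C <> RtoC p.
Proof.
  intros H K. pose proof (f_equal Re K) as K1. pose proof (f_equal Im K) as K2.
  rewrite strip_pt_Re in K1. rewrite strip_pt_Im in K2. simpl in K1, K2. destruct H; lra.
Qed.

Lemma strip_cont s y : Rabs s < 3 / 4 -> s <> 0 \/ y <> 0 ->
  ccont (fun y => Ci * G (RtoC (p + s) + Ci * RtoC y))%C y.
Proof.
  intros Hs Hn. apply ccont_mult; [apply ccont_const|].
  apply (ccont_comp G (fun y : R => (RtoC (p + s) + Ci * RtoC y)%C)).
  - apply strip_hol; [|apply strip_pt_neq, Hn]. rewrite strip_pt_Re.
    now replace (p + s - p) with s by ring.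
  - exact (cderive_cont _ _ _ (cderive_vline _ _)).
Qed.

Lemma strip_sweep a0 b0 a b c Y r : a0 < a -> a <= b -> b < b0 -> c <= Y -> 0 < r ->
  - (3 / 4) <= a0 -> b0 <= 3 / 4 ->
  (forall s y, a0 < s < b0 -> c - r < y -> s <> 0 \/ y <> 0) ->
  (W b c Y - W a c Y)%C = CInt (fun s => G (RtoC (p + s) + Ci * RtoC Y)
      - G (RtoC (p + s) + Ci * RtoC c))%C a b.
Proof.
  intros H1 H2 H3 H4 H5 H6 H7 H8. unfold W.
  rewrite (sweep G G' (fun s => RtoC (p + s)) (fun _ => RtoC 1) a0 a b b0 c Y r); auto.
  - apply CInt_ext; [exact H2|]. intros; ring.
  - intros s Hs. apply cderive_RtoC. auto_derive; [exact I|ring].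
  - intros s Hs. apply ccont_const.
  - intros s y Hs Hy. apply strip_hol; [|apply strip_pt_neq, (H8 s y Hs Hy)].
    rewrite strip_pt_Re. replace (p + s - p) with s by ring. apply Rabs_def1; lra.
Qed.

Lemma strip_cont_h c s : Rabs s < 3 / 4 -> s <> 0 \/ c <> 0 ->
  ccont (fun s => G (RtoC (p + s) + Ci * RtoC c))%C s.
Proof.
  intros Hs Hn. apply (ccont_comp G (fun s : R => (RtoC (p + s) + Ci * RtoC c)%C)).
  - apply strip_hol; [|apply strip_pt_neq, Hn]. rewrite strip_pt_Re.
    now replace (p + s - p) with s by ring.
  - apply ccont_plus; [|apply ccont_const]. apply ccont_RtoC.
    apply (ex_derive_continuous (V := R_NormedModule)). auto_derive. exact I.
Qed.

(** Crossing the pole costs only O(s0). Below height s0 the two vertical segments are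
    short and the integrand is bounded; above height s0 the sweep avoids p and runs over
    a base of width 2 s0. *)
Lemma strip_jump s0 Y : 0 < s0 <= 1 / 2 -> 1 <= Y ->
  Cmod (W s0 0 Y - W (- s0) 0 Y)%C <= 6 * M1 * s0.
Proof.
  intros Hs HY. pose proof strip_M1 as PM.
  (* Each segment is cut at height s0. *)
  assert (A1 : forall s, s = s0 \/ s = - s0 -> W s 0 Y = (W s 0 s0 + W s s0 Y)%C).
  { intros s Hss. apply CInt_Chasles; [lra|lra|]. intros y Hy. apply strip_cont.
    - destruct Hss as [-> | ->]; apply Rabs_def1; lra. - left. destruct Hss; lra. }
  assert (A2 : forall s, s = s0 \/ s = - s0 -> Cmod (W s 0 s0) <= M1 * s0).
  { intros s Hss. replace (M1 * s0) with (M1 * (s0 - 0)) by ring.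
    apply CInt_norm_const; [lra| |].
    - intros y Hy. apply strip_cont.
      + destruct Hss as [-> | ->]; apply Rabs_def1; lra. + left. destruct Hss; lra.
    - intros y Hy. apply strip_bound; [rewrite strip_pt_Re|rewrite strip_pt_Im; lra].
      replace (p + s - p) with s by ring. destruct Hss as [-> | ->]; apply Rabs_le; lra. }
  assert (A3 : Cmod (W s0 s0 Y - W (- s0) s0 Y)%C <= 4 * M1 * s0).
  { rewrite (strip_sweep (-(3/4)) (3/4) (- s0) s0 s0 Y s0); try lra.
    - replace (4 * M1 * s0) with (2 * M1 * (s0 - - s0)) by ring.
      apply CInt_norm_const; [lra| |].
      + intros s Hss. apply ccont_minus; (apply strip_cont_h; [apply Rabs_def1; lra|right; lra]).
      + intros s Hss. unfold Cminus. eapply Rle_trans; [apply Cmod_triangle|]. rewrite Cmod_opp.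
        assert (B : forall y, 0 <= y -> Cmod (G (RtoC (p + s) + Ci * RtoC y)%C) <= M1).
        { intros y Hy. pose proof (strip_bound (RtoC (p + s) + Ci * RtoC y)%C) as B.
          rewrite Cmod_mult, Cmod_Ci, Rmult_1_l in B. apply B.
          - rewrite strip_pt_Re. replace (p + s - p) with s by ring. apply Rabs_le; lra.
          - rewrite strip_pt_Im. exact Hy. }
        pose proof (B Y ltac:(lra)). pose proof (B s0 ltac:(lra)). lra.
    - intros s y _ Hy. right. lra. }
  rewrite (A1 s0 (or_introl eq_refl)), (A1 (- s0) (or_intror eq_refl)).
  replace (W s0 0 s0 + W s0 s0 Y - (W (- s0) 0 s0 + W (- s0) s0 Y))%C
    with (W s0 0 s0 + (- W (- s0) 0 s0 + (W s0 s0 Y - W (- s0) s0 Y)))%C by ring.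
  eapply Rle_trans; [apply Cmod_triangle|].
  eapply Rle_trans; [apply Rplus_le_compat_l, Cmod_triangle|].
  rewrite Cmod_opp. pose proof (A2 s0 (or_introl eq_refl)).
  pose proof (A2 (- s0) (or_intror eq_refl)). lra.
Qed.

Let h (s : R) : R := Re (f (RtoC (p + s))) - Re (f (RtoC p)).

Lemma strip_h_cont s : Rabs s < 3 / 4 -> continuous h s.
Proof.
  intros Hs. apply (continuous_minus (fun s => Re (f (RtoC (p + s)))) (fun _ => Re (f p))).
  - assert (K : ccont (fun s : R => f (RtoC (p + s))) s).
    { apply (ccont_comp f (fun s : R => RtoC (p + s))).
      - refine (proj1 (proj2 (Hf _ _))). cbn [Re fst RtoC]. now replace (p + s - p) with s by ring.
      - apply ccont_RtoC. apply (ex_derive_continuous (V := R_NormedModule)). auto_derive. exact I. }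
    exact (proj1 K).
  - apply continuous_const.
Qed.

Lemma strip_h_bound s : Rabs s <= 1 / 2 -> Rabs (h s) <= M1 * Rabs s.
Proof.
  intros Hs. pose proof (HM1 (RtoC (p + s))) as H.
  assert (H' : Cmod (f (RtoC (p + s)) - f p)%C <= M1 * Cmod (RtoC (p + s) - p)%C).
  { apply H; simpl; [|lra]. now replace (p + s - p) with s by ring. }
  rewrite <- RtoC_minus, Cmod_R in H'. replace (p + s - p) with s in H' by ring.
  refine (Rle_trans _ _ _ _ H').
  refine (Rle_trans _ _ _ _ (re_le_Cmod _)). right. f_equal.
Qed.

(** A sweep on one side of the pole: on the real axis f is real and the kernel has real
    part -1/2, so the bottom edge contributes half the integral of f - f p, while the
    top edge is exponentially small. *)
Lemma strip_side a b Y : (0 < a /\ b <= 1 / 2) \/ (- (1 / 2) <= a /\ b < 0) -> a <= b -> 1 <= Y ->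
  Rabs (2 * Re (W b 0 Y) - 2 * Re (W a 0 Y) - RInt h a b)
    <= 8 * M * exp (- (2 * PI * Y)) * (b - a).
Proof.
  intros Hab Hle HY.
  assert (Hin : forall s, a <= s <= b -> Rabs s <= 1 / 2 /\ s <> 0).
  { intros s Hs. split; [apply Rabs_le; lra|lra]. }
  assert (E : (W b 0 Y - W a 0 Y)%C = CInt (fun s => G (RtoC (p + s) + Ci * RtoC Y)
      - G (RtoC (p + s) + Ci * RtoC 0))%C a b).
  { destruct Hab as [[Ha Hb]|[Ha Hb]].
    - apply (strip_sweep (a / 2) (3/4) a b 0 Y 1); try lra.
      intros s y Hs _. left. lra.
    - apply (strip_sweep (-(3/4)) (b / 2) a b 0 Y 1); try lra.
      intros s y Hs _. left. lra. }
  assert (C1 : forall c s, a <= s <= b -> ccont (fun s => G (RtoC (p + s) + Ci * RtoC c))%C s).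
  { intros c s Hs. destruct (Hin s Hs). apply strip_cont_h; [lra|now left]. }
  assert (ER : forall s, a < s < b -> Re (G (RtoC (p + s) + Ci * RtoC 0)%C) = - (1 / 2) * h s).
  { intros s Hs. destruct (Hin s ltac:(lra)) as [Q1 Q2].
    replace (RtoC (p + s) + Ci * RtoC 0)%C with (RtoC (p + s)) by (apply Ceq; simpl; ring).
    unfold G. rewrite <- RtoC_minus. replace (p + s - p) with s by ring.
    assert (I0 : Im (f (RtoC (p + s)) - f p)%C = 0).
    { transitivity (Im (f (RtoC (p + s))) - Im (f p)); [reflexivity|]. rewrite (Hreal s) by lra. pose proof (Hreal 0) as R0.
      rewrite Rplus_0_r in R0. rewrite R0 by (rewrite Rabs_R0; lra). ring. }
    unfold h. set (u := (f (RtoC (p + s)) - f p)%C) in *.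
    change (Re (f (RtoC (p + s))) - Re (f p)) with (Re u).
    transitivity (Re u * Re (pole_kernel s) - Im u * Im (pole_kernel s)); [reflexivity|].
    rewrite I0, (pole_kernel_real s Q2) by lra. ring. }
  assert (X1 : Re (W b 0 Y) - Re (W a 0 Y) =
    RInt (fun s => Re (G (RtoC (p + s) + Ci * RtoC Y)%C)) a b + (1 / 2) * RInt h a b).
  { transitivity (Re (W b 0 Y - W a 0 Y)%C); [reflexivity|]. rewrite E.
    assert (Eh : ex_RInt h a b).
    { apply (ex_RInt_continuous (V := R_CompleteNormedModule)). intros s Hs.
      rewrite Rmin_left, Rmax_right in Hs by exact Hle. destruct (Hin s Hs).
      apply strip_h_cont. lra. }
    assert (EY : ex_RInt (fun s => Re (G (RtoC (p + s) + Ci * RtoC Y)%C)) a b)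
      by (apply (ccont_ex_Re (fun s => G (RtoC (p + s) + Ci * RtoC Y)%C)); auto).
    pose proof (RInt_scal (V := R_CompleteNormedModule) h a b (1 / 2) Eh) as S.
    change (scal (1/2) (RInt h a b)) with (1 / 2 * RInt h a b) in S. rewrite <- S.
    pose proof (RInt_plus (V := R_CompleteNormedModule) _ _ a b EY
      (ex_RInt_scal (V := R_NormedModule) h a b (1/2) Eh)) as P.
    refine (eq_trans _ P).
    unfold CInt. cbv [Re Im fst snd] in *.
    apply (RInt_ext (V := R_CompleteNormedModule)). intros s Hs.
    rewrite Rmin_left, Rmax_right in Hs by exact Hle.
    specialize (ER s Hs).
    change (fst (G (RtoC (p + s) + Ci * RtoC Y) - G (RtoC (p + s) + Ci * RtoC 0))%C =
      fst (G (RtoC (p + s) + Ci * RtoC Y)%C) + 1 / 2 * h s).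
    change (fst (G (RtoC (p + s) + Ci * RtoC 0)%C) = - (1 / 2) * h s) in ER.
    set (u := G (RtoC (p + s) + Ci * RtoC Y)%C) in *.
    set (v := G (RtoC (p + s) + Ci * RtoC 0)%C) in *.
    transitivity (fst u - fst v); [reflexivity|]. rewrite ER. field. }
  replace (2 * Re (W b 0 Y) - 2 * Re (W a 0 Y) - RInt h a b) with
    (2 * RInt (fun s => Re (G (RtoC (p + s) + Ci * RtoC Y)%C)) a b) by lra.
  rewrite Rabs_mult, (Rabs_pos_eq 2) by lra.
  assert (Cmod (CInt (fun s => G (RtoC (p + s) + Ci * RtoC Y)%C) a b)
     <= 4 * M * exp (- (2 * PI * Y)) * (b - a)).
  { apply CInt_norm_const; [exact Hle|auto|]. intros s Hs. destruct (Hin s Hs).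
    pose proof (strip_top (RtoC (p + s) + Ci * RtoC Y)%C) as T.
    rewrite strip_pt_Re, strip_pt_Im in T. apply T; [|exact HY].
    now replace (p + s - p) with s by ring. }
  pose proof (re_le_Cmod (CInt (fun s => G (RtoC (p + s) + Ci * RtoC Y)%C) a b)) as RL.
  change (Rabs (RInt (fun s => Re (G (RtoC (p + s) + Ci * RtoC Y)%C)) a b) <=
    Cmod (CInt (fun s => G (RtoC (p + s) + Ci * RtoC Y)%C) a b)) in RL. lra.
Qed.

(** On the two edges of the strip the kernel is real, and subtracting the real number f
    p does not change imaginary parts. *)
Lemma strip_edge s Y : s = 1 / 2 \/ s = - (1 / 2) -> 0 <= Y ->
  Re (W s 0 Y) = RInt (fun y => Im (f (RtoC (p + s) + Ci * RtoC y)%C) * fermi y) 0 Y.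
Proof.
  intros Hs HY. unfold W, CInt. cbn [Re Im fst snd]. unfold Re at 1. cbn [fst].
  apply (RInt_ext (V := R_CompleteNormedModule)). intros y _.
  unfold G. replace (RtoC (p + s) + Ci * RtoC y - p)%C with (RtoC s + Ci * RtoC y)%C
    by (rewrite RtoC_plus; ring).
  rewrite (pole_kernel_edge y s Hs).
  pose proof (Hreal 0) as R0. rewrite Rplus_0_r, Rabs_R0 in R0. specialize (R0 ltac:(lra)).
  set (u := f (RtoC (p + s) + Ci * RtoC y)%C). set (v := f p) in *.
  destruct u, v. simpl in *. subst. ring.
Qed.

(** The three sweeps from -1/2 to -e, across the pole, and from e to 1/2 are added, and
    e tends to 0. *)
Lemma abel_plana_strip Y : 1 <= Y ->
  Rabs (2 * RInt (fun y => Im (f (RtoC (p + 1 / 2) + Ci * RtoC y)%C) * fermi y) 0 Y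
     - 2 * RInt (fun y => Im (f (RtoC (p - 1 / 2) + Ci * RtoC y)%C) * fermi y) 0 Y
     - RInt h (- (1 / 2)) (1 / 2)) <= 8 * M * exp (- (2 * PI * Y)).
Proof.
  intros HY. pose proof strip_M1 as PM.
  rewrite <- (strip_edge (1/2) Y (or_introl eq_refl)) by lra.
  replace (p - 1 / 2) with (p + - (1 / 2)) by ring.
  rewrite <- (strip_edge (-(1/2)) Y (or_intror eq_refl)) by lra.
  apply Rle_of_lin_eps with (K := 14 * M1). intros e He.
  assert (PMp : 0 <= M).
  { eapply Rle_trans; [apply (Cmod_ge_0 (f p))|]. apply HM; simpl; [|lra].
    rewrite Rminus_diag, Rabs_R0. lra. }
  pose proof (strip_side e (1/2) Y ltac:(left; lra) ltac:(lra) HY) as S1.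
  pose proof (strip_side (-(1/2)) (-e) Y ltac:(right; lra) ltac:(lra) HY) as S2.
  pose proof (strip_jump e Y He HY) as J.
  assert (J' : Rabs (Re (W e 0 Y) - Re (W (- e) 0 Y)) <= 6 * M1 * e).
  { refine (Rle_trans _ _ _ _ J). refine (Rle_trans _ _ _ _ (re_le_Cmod _)). right. reflexivity. }
  assert (Eh : forall a b, - (1/2) <= a -> a <= b -> b <= 1/2 -> ex_RInt h a b).
  { intros a b H1 H2 H3. apply (ex_RInt_continuous (V := R_CompleteNormedModule)). intros s Hs.
    rewrite Rmin_left, Rmax_right in Hs by exact H2.
    apply strip_h_cont. apply Rabs_def1; lra. }
  assert (Ch : RInt h (-(1/2)) (1/2) = RInt h (-(1/2)) (-e) + (RInt h (-e) e + RInt h e (1/2))).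
  { pose proof (RInt_Chasles (V := R_CompleteNormedModule) h (-e) e (1/2)
      (Eh (-e) e ltac:(lra) ltac:(lra) ltac:(lra)) (Eh e (1/2) ltac:(lra) ltac:(lra) ltac:(lra))) as Q1.
    change (RInt h (-e) e + RInt h e (1/2) = RInt h (-e) (1/2)) in Q1. rewrite Q1.
    symmetry. apply (RInt_Chasles (V := R_CompleteNormedModule) h (-(1/2)) (-e) (1/2)); apply Eh; lra. }
  assert (Bm : Rabs (RInt h (-e) e) <= M1 * (2 * e)).
  { replace (M1 * (2 * e)) with (M1 * (e - - e)) by ring. rewrite Rmult_comm.
    apply (abs_RInt_le_const h (-e) e M1); [lra|apply Eh; lra|].
    intros s Hs. eapply Rle_trans; [apply strip_h_bound, Rabs_le; lra|].
    assert (Rabs s <= 1) by (apply Rabs_le; lra). nra. }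
  rewrite Ch. set (Ex := exp _) in *.
  assert (0 < Ex) by apply exp_pos.
  assert (P0 : 0 <= 8 * M * Ex) by nra.
  assert (T1 : 8 * M * Ex * (1 / 2 - e) + 8 * M * Ex * (- e - - (1 / 2)) <= 8 * M * Ex) by nra.
  apply Rabs_le_between in S1. apply Rabs_le_between in S2.
  apply Rabs_le_between in J'. apply Rabs_le_between in Bm.
  apply Rabs_le. lra.
Qed.
End Strip.

(** * Improper integrals and the uniqueness of power series coefficients *)

(** The improper integral over the positive half-line, as a limit along integer end
    points; meaningful for integrands that are dominated by a multiple of e^(-y). *)
Definition half_line_int (g : R -> R) : R := real (Lim_seq (fun j => RInt g 0 (INR j))).

Lemma ex_RInt_cont (g : R -> R) a b : a <= b ->
  (forall y, a <= y <= b -> continuous g y) -> ex_RInt g a b.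
Proof.
  intros H K. apply (ex_RInt_continuous (V := R_CompleteNormedModule)).
  intros y Hy. rewrite Rmin_left, Rmax_right in Hy by exact H. exact (K y Hy).
Qed.

Lemma RInt_Chasles_R (g : R -> R) a b c : ex_RInt g a b -> ex_RInt g b c ->
  RInt g a b + RInt g b c = RInt g a c.
Proof. intros H K. exact (RInt_Chasles (V := R_CompleteNormedModule) g a b c H K). Qed.

Lemma RInt_exp_opp k a b : k <> 0 ->
  is_RInt (fun y => exp (- (k * y))) a b ((exp (- (k * a)) - exp (- (k * b))) / k).
Proof.
  intros Hk.
  replace ((exp (- (k * a)) - exp (- (k * b))) / k) with
    (minus ((fun y => - exp (- (k * y)) / k) b) ((fun y => - exp (- (k * y)) / k) a))
    by (unfold minus, plus, opp; simpl; field; exact Hk).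
  apply (is_RInt_derive (fun y => - exp (- (k * y)) / k) (fun y => exp (- (k * y)))).
  - intros y _. auto_derive; [exact I|]. field. exact Hk.
  - intros y _. apply (ex_derive_continuous (V := R_NormedModule)). auto_derive. exact I.
Qed.

Lemma RInt_exp_bound (g : R -> R) C a b : a <= b ->
  (forall y, a <= y <= b -> continuous g y) ->
  (forall y, a <= y <= b -> Rabs (g y) <= C * exp (- y)) ->
  Rabs (RInt g a b) <= C * (exp (- a) - exp (- b)).
Proof.
  intros H K B.
  pose proof (RInt_exp_opp 1 a b ltac:(lra)) as E.
  replace (C * (exp (- a) - exp (- b))) with (C * ((exp (- (1 * a)) - exp (- (1 * b))) / 1))
    by (rewrite !Rmult_1_l; field).
  apply (norm_RInt_le (V := R_NormedModule) g (fun y => C * exp (- (1 * y))) a b).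
  - exact H.
  - intros y Hy. rewrite Rmult_1_l. exact (B y Hy).
  - apply (RInt_correct (V := R_CompleteNormedModule)), ex_RInt_cont; assumption.
  - exact (is_RInt_scal (V := R_NormedModule) _ _ _ C _ E).
Qed.

Lemma half_line_int_lim (g : R -> R) C :
  (forall y, 0 <= y -> continuous g y) ->
  (forall y, 0 <= y -> Rabs (g y) <= C * exp (- y)) ->
  is_lim_seq (fun j => RInt g 0 (INR j)) (half_line_int g) /\ Rabs (half_line_int g) <= C.
Proof.
  intros K B.
  assert (C0 : 0 <= C).
  { specialize (B 0 (Rle_refl 0)). rewrite Ropp_0, exp_0 in B. pose proof (Rabs_pos (g 0)). lra. }
  assert (D : forall j k, (j <= k)%nat ->
    Rabs (RInt g 0 (INR k) - RInt g 0 (INR j)) <= C * exp (- INR j)).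
  { intros j k Hjk. pose proof (le_INR _ _ Hjk). pose proof (pos_INR j).
    assert (CH : RInt g 0 (INR j) + RInt g (INR j) (INR k) = RInt g 0 (INR k)).
    2:{ replace (RInt g 0 (INR k) - RInt g 0 (INR j)) with (RInt g (INR j) (INR k)) by lra.
      eapply Rle_trans; [apply (RInt_exp_bound g C); [lra| |]|].
      + intros; apply K; lra. + intros; apply B; lra.
      + apply Rmult_le_compat_l; [exact C0|]. pose proof (exp_pos (- INR k)). lra. }
    apply RInt_Chasles_R.
    - apply ex_RInt_cont; [lra|]. intros; apply K; lra.
    - apply ex_RInt_cont; [lra|]. intros; apply K; lra. }
  assert (Z : is_lim_seq (fun j => C * exp (- INR j)) 0).
  { replace 0 with (C * 0) by ring. apply (is_lim_seq_scal_l _ C 0).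
    apply (is_lim_comp_seq exp (fun j => - INR j) m_infty 0 is_lim_exp_m).
    - now exists O. - apply is_lim_seq_opp with (l := p_infty). apply is_lim_seq_INR. }
  assert (L : ex_finite_lim_seq (fun j => RInt g 0 (INR j))).
  { apply ex_lim_seq_cauchy_corr. intros eps.
    apply is_lim_seq_spec in Z. destruct (Z (pos_div_2 eps)) as [N HN]. exists N.
    intros n m Hn Hm. specialize (HN N (Nat.le_refl N)). rewrite Rminus_0_r in HN.
    assert (CN : C * exp (- INR N) < eps / 2).
    { apply Rle_lt_trans with (2 := HN), Rle_abs. }
    pose proof (D N n Hn) as D1. pose proof (D N m Hm) as D2.
    apply Rabs_le_between in D1. apply Rabs_le_between in D2. apply Rabs_def1; lra. }
  destruct L as [l Hl].
  assert (E : half_line_int g = l) by (unfold half_line_int; now rewrite (is_lim_seq_unique _ _ Hl)).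
  rewrite E. split; [exact Hl|].
  assert (Hl' : is_lim_seq (fun j => Rabs (RInt g 0 (INR j))) (Rabs l))
    by (apply (is_lim_seq_abs _ l), Hl).
  apply (is_lim_seq_le (fun j => Rabs (RInt g 0 (INR j))) (fun _ => C) (Rabs l) C);
    [|exact Hl'|apply is_lim_seq_const].
  intros j. pose proof (D O j ltac:(lia)) as D0. simpl in D0.
  rewrite Ropp_0, exp_0, Rmult_1_r in D0.
  rewrite (RInt_point (V := R_CompleteNormedModule)) in D0. unfold zero in D0; simpl in D0.
  now rewrite Rminus_0_r in D0.
Qed.

Lemma series_zero_head (c : nat -> R) r : 0 < r ->
  (forall x, 0 < x < r -> is_series (fun m => c m * x ^ m) 0) -> c O = 0.
Proof.
  intros Hr H.
  assert (CV : Rbar_le (Finite (r / 2)) (CV_radius c)).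
  { destruct (Rbar_le_lt_dec (Finite (r / 2)) (CV_radius c)) as [L|L]; [exact L|exfalso].
    apply (CV_disk_outside c (r / 2)).
    - rewrite Rabs_pos_eq by lra. exact L.
    - apply ex_series_lim_0. exists 0. apply H. lra. }
  assert (Co : continuity_pt (PSeries c) 0).
  { apply PSeries_continuity. rewrite Rabs_R0.
    apply Rbar_lt_le_trans with (2 := CV). simpl. lra. }
  assert (P0 : PSeries c 0 = c O) by apply PSeries_0.
  destruct (Req_dec (c O) 0) as [Z|NZ]; [exact Z|exfalso].
  destruct (Co (Rabs (c O)) (Rabs_pos_lt _ NZ)) as [d [Hd K]].
  (* A point inside both the interval of vanishing and the continuity neighbourhood. *)
  set (x := Rmin (r / 2) (d / 2)).
  assert (Hx : 0 < x) by (apply Rmin_glb_lt; lra).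
  assert (Hx1 : x <= r / 2) by apply Rmin_l. assert (Hx2 : x <= d / 2) by apply Rmin_r.
  specialize (K x). unfold dist in K; simpl in K. unfold Rdist in K.
  assert (Px : PSeries c x = 0).
  { apply is_pseries_unique. apply is_pseries_R. apply H. lra. }
  rewrite Px, P0 in K.
  assert (A : Rabs (0 - c O) < Rabs (c O)).
  { apply K. split; [split; [exact I|lra]|]. rewrite Rminus_0_r, Rabs_pos_eq; lra. }
  unfold Rminus in A. rewrite Rplus_0_l, Rabs_Ropp in A. lra.
Qed.

(** Real points to the right of 0 suffice: the constant term is the limit at 0+, and the
    series can then be divided by x. *)
Lemma series_zero_coef (c : nat -> R) r : 0 < r ->
  (forall x, 0 < x < r -> is_series (fun m => c m * x ^ m) 0) -> forall m, c m = 0.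
Proof.
  intros Hr H m. revert c H. induction m as [|m IH]; intros c H.
  - exact (series_zero_head c r Hr H).
  - apply (IH (fun k => c (S k))). intros x Hx.
    assert (S : is_series (fun k => c (S k) * x ^ (S k)) 0).
    { apply (is_series_incr_1 (fun m => c m * x ^ m) 0).
      refine (eq_ind_r (fun l => is_series (fun m => c m * x ^ m) l) (H x Hx) _).
      unfold plus; simpl. rewrite (series_zero_head c r Hr H). ring. }
    apply (is_series_scal_l (/ x)) in S.
    replace 0 with (/ x * 0) by ring.
    eapply is_series_ext; [|exact S]. intros k. simpl. unfold scal; simpl. unfold mult; simpl. field. lra.
Qed.

(** * The principal logarithm and remainders of the exponential series *)

Lemma Cmod_sqr_pos z : 0 < Re z -> 0 < Cmod z /\ z <> RtoC 0.
Proof.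
  intros H. assert (z <> RtoC 0) by (intros ->; simpl in H; lra).
  split; [now apply Cmod_gt_0|assumption].
Qed.

Lemma Re_le_Cmod z : Re z <= Cmod z.
Proof. eapply Rle_trans; [apply Rle_abs|apply re_le_Cmod]. Qed.

Lemma Cexp_Clog z : 0 < Re z -> Cexp (Clog z) = z.
Proof.
  intros H. destruct (Cmod_sqr_pos z H) as [P _]. unfold Cexp, Clog. cbn [Re Im fst snd].
  rewrite exp_ln by exact P. destruct z as [a b]. cbn [Re Im fst snd] in *.
  rewrite cos_atan, sin_atan.
  assert (E : sqrt (1 + Rsqr (b / a)) = Cmod (a, b) / a).
  { unfold Cmod. cbn [fst snd].
    replace (1 + Rsqr (b / a)) with ((a ^ 2 + b ^ 2) / Rsqr a) by (unfold Rsqr; field; lra).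
    rewrite sqrt_div_alt by (unfold Rsqr; nra). rewrite sqrt_Rsqr by lra. reflexivity. }
  rewrite E. apply Ceq; cbn [Re Im fst snd]; field; lra.
Qed.

Lemma Clog_RtoC x : 0 < x -> Clog (RtoC x) = RtoC (ln x).
Proof.
  intros H. unfold Clog. apply Ceq; cbn [Re Im fst snd RtoC].
  - now rewrite Cmod_R, Rabs_pos_eq by lra.
  - unfold Rdiv. rewrite Rmult_0_l. apply atan_0.
Qed.

Lemma Clog_Cexp w : Rabs (Im w) < PI / 2 -> Clog (Cexp w) = w.
Proof.
  intros H. apply Rabs_def2 in H. unfold Clog. apply Ceq; cbn [Re Im fst snd].
  - now rewrite Cmod_Cexp, ln_exp.
  - unfold Cexp. cbn [Re Im fst snd].
    assert (0 < cos (Im w)) by (apply cos_gt_0; lra).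
    pose proof (exp_pos (Re w)).
    replace (_ / _) with (tan (Im w)) by (unfold tan; field; lra).
    apply atan_tan. lra.
Qed.

Lemma atan_abs x : Rabs (atan x) <= PI / 2.
Proof. pose proof (atan_bound x). apply Rabs_le. lra. Qed.

Lemma Cmod_le_sum z : Cmod z <= Rabs (Re z) + Rabs (Im z).
Proof.
  replace z with (RtoC (Re z) + Ci * RtoC (Im z))%C at 1 by (apply Ceq; simpl; ring).
  eapply Rle_trans; [apply Cmod_triangle|].
  now rewrite Cmod_mult, Cmod_Ci, !Cmod_R, Rmult_1_l.
Qed.

Lemma Cmod_Clog_le z : Cmod (Clog z) <= Rabs (ln (Cmod z)) + PI / 2.
Proof.
  eapply Rle_trans; [apply Cmod_le_sum|]. unfold Clog. cbn [Re Im fst snd].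
  apply Rplus_le_compat_l, atan_abs.
Qed.

(** The sum of the first M terms of the exponential series. *)
Fixpoint exp_partial_sum (M : nat) (w : C) : C :=
  match M with O => RtoC 0 | S m => (exp_partial_sum m w + w ^ m * RtoC (/ INR (fact m)))%C end.

Lemma exp_partial_sum_0 M : exp_partial_sum (S M) 0 = 1.
Proof.
  induction M as [|M IH].
  - simpl. apply Ceq; simpl; field.
  - change (exp_partial_sum (S (S M)) 0) with (exp_partial_sum (S M) 0 + 0 ^ (S M) * RtoC (/ INR (fact (S M))))%C.
    rewrite IH. simpl. ring.
Qed.

Lemma INR_fact_pos m : 0 < INR (fact m).
Proof. apply lt_0_INR, lt_O_fact. Qed.

Lemma cderive_lin w x : cderive (fun r => RtoC r * w)%C x w.
Proof.
  eapply cderive_eq; [apply cderive_mult; [apply cderive_RtoC; apply (is_derive_id (K := R_AbsRing))|apply cderive_const]|].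
  change (RtoC one) with (RtoC 1). cbv beta. ring.
Qed.

Lemma cderive_exp_partial_sum M w x :
  cderive (fun r => exp_partial_sum (S M) (RtoC r * w)%C) x (w * exp_partial_sum M (RtoC x * w))%C.
Proof.
  induction M as [|M IH].
  - eapply cderive_ext with (f := fun _ => RtoC 1); [intros; apply Ceq; simpl; field|].
    eapply cderive_eq; [apply cderive_const|]. simpl. ring.
  - apply (cderive_ext (fun r => exp_partial_sum (S M) (RtoC r * w) + (RtoC r * w) ^ (S M) * RtoC (/ INR (fact (S M))))%C);
      [reflexivity|].
    eapply cderive_eq; [apply cderive_plus; [exact IH|]|].
    + apply cderive_mult; [|apply cderive_const]. apply cderive_pow, cderive_lin.
    + change (exp_partial_sum (S M) (RtoC x * w)%C) with
       (exp_partial_sum M (RtoC x * w) + (RtoC x * w) ^ M * RtoC (/ INR (fact M)))%C.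
      replace (/ INR (fact M)) with (INR (S M) * / INR (fact (S M))).
      2:{ rewrite fact_simpl, mult_INR. pose proof (INR_fact_pos M).
          pose proof (lt_0_INR (S M) ltac:(lia)). field. lra. }
      rewrite RtoC_mult. simpl pred. ring.
Qed.

Lemma is_RInt_pow_scal K M : is_RInt (fun r => K * r ^ M) 0 1 (K / INR (S M)).
Proof.
  pose proof (lt_0_INR (S M) ltac:(lia)) as P.
  replace (K / INR (S M)) with (minus (K * 1 ^ (S M) / INR (S M)) (K * 0 ^ (S M) / INR (S M))).
  2:{ rewrite pow1, pow_i by lia.
      change (K * 1 / INR (S M) + - (K * 0 / INR (S M)) = K / INR (S M)). field. lra. }
  apply (is_RInt_derive (fun r => K * r ^ (S M) / INR (S M)) (fun r => K * r ^ M)).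
  - intros y _. auto_derive; [exact I|]. change (K * (1 * (INR (S M) * y ^ M)) * / INR (S M) = K * y ^ M). field. lra.
  - intros y _. apply (ex_derive_continuous (V := R_NormedModule)). auto_derive. exact I.
Qed.

(** By induction on M, since the remainder of order M+1 is the integral of w times the
    remainder of order M along the segment from 0 to w. *)
Lemma Cexp_remainder M w :
  Cmod (Cexp w - exp_partial_sum M w)%C <= Cmod w ^ M / INR (fact M) * exp (Cmod w).
Proof.
  revert w. induction M as [|M IH]; intros w.
  - simpl. replace (Cexp w - 0)%C with (Cexp w) by ring. rewrite Cmod_Cexp.
    replace (1 / 1 * exp (Cmod w)) with (exp (Cmod w)) by field.
    destruct (Rle_lt_or_eq_dec _ _ (Re_le_Cmod w)) as [L|E].
    + left. now apply exp_increasing. + right. now rewrite E.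
  - assert (E : (Cexp w - exp_partial_sum (S M) w)%C =
      CInt (fun r => w * (Cexp (RtoC r * w) - exp_partial_sum M (RtoC r * w)))%C 0 1).
    { symmetry.
      rewrite (CInt_FTC (fun r => Cexp (RtoC r * w) - exp_partial_sum (S M) (RtoC r * w))%C).
      - rewrite !Cmult_0_l, !Cmult_1_l, Cexp_0, exp_partial_sum_0. ring.
      - lra.
      - intros r _. eapply cderive_eq; [apply cderive_minus; [apply cderive_exp, cderive_lin|apply cderive_exp_partial_sum]|]. cbv beta. ring.
      - intros r _. apply ccont_mult; [apply ccont_const|].
        apply ccont_minus.
        + exact (cderive_cont _ _ _ (cderive_exp _ _ _ (cderive_lin w r))).
        + clear. induction M as [|M IH]; [apply ccont_const|].
          exact (cderive_cont _ _ _ (cderive_exp_partial_sum M w r)). }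
    rewrite E. set (K := Cmod w * (Cmod w ^ M / INR (fact M)) * exp (Cmod w)).
    pose proof (is_RInt_pow_scal K M) as IP.
    eapply Rle_trans; [apply (CInt_norm _ (fun r => K * r ^ M))|].
    + lra.
    + intros r _. apply ccont_mult; [apply ccont_const|].
        apply ccont_minus.
        * exact (cderive_cont _ _ _ (cderive_exp _ _ _ (cderive_lin w r))).
        * clear. induction M as [|M IH]; [apply ccont_const|].
          exact (cderive_cont _ _ _ (cderive_exp_partial_sum M w r)).
    + intros r Hr. rewrite Cmod_mult.
      eapply Rle_trans; [apply Rmult_le_compat_l; [apply Cmod_ge_0|apply IH]|].
      rewrite Cmod_mult, Cmod_R, Rabs_pos_eq by lra. rewrite Rpow_mult_distr.
      unfold K. pose proof (Cmod_ge_0 w) as Pw. pose proof (pow_le _ M Pw) as Pm.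
      pose proof (Rinv_0_lt_compat _ (INR_fact_pos M)) as Pf.
      pose proof (pow_le r M (proj1 Hr)) as Pr.
      replace (Cmod w * (r ^ M * Cmod w ^ M / INR (fact M) * exp (r * Cmod w))) with
        (Cmod w * (Cmod w ^ M / INR (fact M)) * r ^ M * exp (r * Cmod w)) by (unfold Rdiv; ring).
      replace (Cmod w * (Cmod w ^ M / INR (fact M)) * exp (Cmod w) * r ^ M) with
        (Cmod w * (Cmod w ^ M / INR (fact M)) * r ^ M * exp (Cmod w)) by (unfold Rdiv; ring).
      apply Rmult_le_compat_l.
      * unfold Rdiv. repeat apply Rmult_le_pos; lra.
      * assert (r * Cmod w <= Cmod w) by nra.
        destruct (Rle_lt_or_eq_dec _ _ H) as [L|Q]; [left; now apply exp_increasing|right; now rewrite Q].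
    + now exists (K / INR (S M)).
    + rewrite (is_RInt_unique _ _ _ _ IP). right. unfold K.
      rewrite fact_simpl, mult_INR. pose proof (INR_fact_pos M).
      pose proof (lt_0_INR (S M) ltac:(lia)). simpl pow. field. lra.
Qed.

(** Used wherever a power has to be beaten by an exponential, with M as large as
    convenient. *)
Lemma pow_fact_le_exp u M : 0 <= u -> u ^ M / INR (fact M) <= exp u.
Proof.
  intros Hu. revert u Hu. induction M as [|M IH]; intros u Hu.
  - simpl. pose proof (exp_ineq1_le u). lra.
  - pose proof (lt_0_INR (S M) ltac:(lia)) as P. pose proof (INR_fact_pos M) as Pf.
    pose proof (INR_fact_pos (S M)) as Pf'.
    assert (HF : INR (fact (S M)) = INR (S M) * INR (fact M)) by (rewrite fact_simpl; apply mult_INR).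
    set (F := INR (fact (S M))) in *.
    assert (H : exp 0 - 0 ^ (S M) / F <= exp u - u ^ (S M) / F).
    { apply (incr_of_derive (fun t => exp t - t ^ (S M) / F)
        (fun t => exp t - t ^ M / INR (fact M))); [exact Hu| |].
      - intros t _. auto_derive; [exact I|].
        change (1 * exp t + - (1 * (INR (S M) * t ^ M) * / F) = exp t - t ^ M / INR (fact M)).
        rewrite HF. field. lra.
      - intros t Ht. specialize (IH t ltac:(lra)). lra. }
    rewrite exp_0, pow_i in H by lia. unfold Rdiv in *. rewrite Rmult_0_l in H. lra.
Qed.

(** A mean value inequality along the segment from p to z. *)
Lemma hol_mvt (F F' : C -> C) (p z : C) K :
  (forall r, 0 <= r <= 1 -> hol F F' (p + RtoC r * (z - p))%C /\
     ccont2 F' (p + RtoC r * (z - p))%C /\ Cmod (F' (p + RtoC r * (z - p))%C) <= K) ->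
  Cmod (F z - F p)%C <= K * Cmod (z - p)%C.
Proof.
  intros H.
  assert (D : forall r, cderive (fun r => p + RtoC r * (z - p))%C r (z - p)%C).
  { intros r. eapply cderive_eq; [apply cderive_plus; [apply cderive_const|apply cderive_lin]|]. ring. }
  assert (Cn : forall r, 0 <= r <= 1 -> ccont (fun r => F' (p + RtoC r * (z - p)) * (z - p))%C r).
  { intros r Hr. apply ccont_mult; [|apply ccont_const].
    apply (ccont_comp F' (fun r : R => (p + RtoC r * (z - p))%C));
      [exact (proj1 (proj2 (H r Hr)))|exact (cderive_cont _ _ _ (D r))]. }
  assert (E : (F z - F p)%C = CInt (fun r => F' (p + RtoC r * (z - p)) * (z - p))%C 0 1).
  { symmetry. rewrite (CInt_FTC (fun r => F (p + RtoC r * (z - p)))%C).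
    - f_equal; f_equal; [|f_equal]; ring.
    - lra.
    - intros r Hr. apply (proj1 (H r Hr)); [reflexivity|apply D].
    - exact Cn. }
  rewrite E. replace (K * Cmod (z - p)%C) with (K * Cmod (z - p)%C * (1 - 0)) by ring.
  apply CInt_norm_const; [lra|exact Cn|].
  intros r Hr. rewrite Cmod_mult. apply Rmult_le_compat_r; [apply Cmod_ge_0|apply (H r Hr)].
Qed.

(** * Summation of the Hurwitz series *)

(** The branch of z^(-1-x) on the right half-plane. *)
Definition power_fun (x : R) (z : C) : C := Cexp (RtoC (- (1 + x)) * Clog z)%C.
Definition power_fun' (x : R) (z : C) : C := (RtoC (- (1 + x)) * / z * power_fun x z)%C.

Lemma ccont2_Clog z : 0 < Re z -> ccont2 Clog z.
Proof. intros H. apply (ccont_log (fun w => w)); [apply ccont_coords|exact H]. Qed.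

Lemma ccont2_inv z : z <> RtoC 0 -> ccont2 (fun w => / w)%C z.
Proof. intros H. apply (ccont_inv (fun w => w)); [apply ccont_coords|exact H]. Qed.

Lemma power_fun_hol x z : 0 < Re z -> hol (power_fun x) (power_fun' x) z /\ ccont2 (power_fun x) z /\ ccont2 (power_fun' x) z.
Proof.
  intros H. assert (C1 : ccont2 (power_fun x) z).
  { apply ccont_exp. apply ccont_mult; [apply ccont_const|now apply ccont2_Clog]. }
  split; [|split; [exact C1|]].
  - eapply hol_ext; [reflexivity| |apply hol_exp, hol_mult; [apply hol_const|apply hol_log, H]].
    unfold power_fun', power_fun. ring.
  - apply ccont_mult; [|exact C1]. apply ccont_mult; [apply ccont_const|].
    apply ccont2_inv. now apply Cmod_sqr_pos.
Qed.

Lemma exp_le a b : a <= b -> exp a <= exp b.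
Proof. intros [H|H]; [left; now apply exp_increasing|right; now rewrite H]. Qed.

Lemma ln_le_mono a b : 0 < a -> a <= b -> ln a <= ln b.
Proof. intros P [H|H]; [left; now apply ln_increasing|right; now rewrite H]. Qed.

Lemma power_fun_mod x z : Cmod (power_fun x z) = exp (- (1 + x) * ln (Cmod z)).
Proof.
  unfold power_fun. rewrite Cmod_Cexp. f_equal. unfold Clog. cbn [Re Im fst snd Cmult RtoC]. ring.
Qed.

Lemma power_fun_le x c z : 0 <= x -> 0 < c -> c <= Re z -> Cmod (power_fun x z) <= exp (- (1 + x) * ln c).
Proof.
  intros Hx Hc Hz. rewrite power_fun_mod. apply exp_le.
  assert (ln c <= ln (Cmod z)).
  { apply ln_le_mono; [exact Hc|]. apply Rle_trans with (1 := Hz), Re_le_Cmod. }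
  nra.
Qed.

Lemma power_fun_real x s : 0 < s -> power_fun x (RtoC s) = RtoC (exp (- (1 + x) * ln s)).
Proof. intros H. unfold power_fun. rewrite Clog_RtoC, <- RtoC_mult by exact H. apply Cexp_RtoC. Qed.

Lemma power_fun_half x z : 0 < x <= 1 -> 1 / 4 <= Re z -> Cmod (power_fun x z) <= 16.
Proof.
  intros Hx Hz. eapply Rle_trans; [apply (power_fun_le x (1/4)); lra|].
  replace (1/4) with (/ 4) by field. rewrite ln_Rinv by lra.
  apply Rle_trans with (exp (ln 4 + ln 4)).
  - apply exp_le. assert (0 < ln 4) by (rewrite <- ln_1; apply ln_increasing; lra). nra.
  - rewrite exp_plus, exp_ln by lra. lra.
Qed.

Section HurwitzSum.
Variable x : R.
Hypothesis Hx : 0 < x <= 1.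

Let g (s : R) : R := exp (- (1 + x) * ln s).
Let E (s : R) : R := - exp (- x * ln s) / x.
Let gH (c y : R) : R := Im (power_fun x (RtoC c + Ci * RtoC y)%C) * fermi y.

Lemma line_Re c y : Re (RtoC c + Ci * RtoC y)%C = c.
Proof. simpl. ring. Qed.

Lemma fermi_exp_le y : 0 <= y -> fermi y <= exp (- y).
Proof.
  intros Hy. eapply Rle_trans; [apply fermi_le|]. apply exp_le.
  pose proof PI2_3_2. nra.
Qed.

Lemma gH_cont c y : 0 < c -> continuous (gH c) y.
Proof.
  intros Hc. apply (continuous_mult (fun y => Im (power_fun x (RtoC c + Ci * RtoC y)%C)) fermi);
    [|apply fermi_cont].
  assert (K : ccont (fun y : R => power_fun x (RtoC c + Ci * RtoC y)%C) y).
  { apply (ccont_comp (power_fun x) (fun y : R => (RtoC c + Ci * RtoC y)%C)).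
    - exact (proj1 (proj2 (power_fun_hol x _ ltac:(rewrite line_Re; exact Hc)))).
    - exact (cderive_cont _ _ _ (cderive_vline _ _)). }
  exact (proj2 K).
Qed.

Lemma Im_le_Cmod z : Rabs (Im z) <= Cmod z.
Proof.
  refine (Rle_trans _ _ _ _ (Rmax_Cmod z)). apply Rmax_r.
Qed.

Lemma gH_bound c y : 0 < c -> 0 <= y -> Rabs (gH c y) <= g c * exp (- y).
Proof.
  intros Hc Hy. unfold gH. rewrite Rabs_mult, (Rabs_pos_eq (fermi y)) by (left; apply fermi_pos).
  apply Rmult_le_compat; [apply Rabs_pos|left; apply fermi_pos| |now apply fermi_exp_le].
  eapply Rle_trans; [apply Im_le_Cmod|]. apply power_fun_le; [lra|exact Hc|rewrite line_Re; lra].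
Qed.

Lemma gH_lim c : 0 < c -> is_lim_seq (fun j => RInt (gH c) 0 (INR j)) (half_line_int (gH c)) /\
  Rabs (half_line_int (gH c)) <= g c.
Proof.
  intros Hc. apply half_line_int_lim; intros y Hy; [now apply gH_cont|now apply gH_bound].
Qed.

Lemma is_derive_E s : 0 < s -> is_derive E s (g s).
Proof.
  intros Hs. unfold E, g. auto_derive; [exact Hs|].
  replace (- (1 + x) * ln s) with (- x * ln s + - ln s) by ring.
  rewrite exp_plus, exp_Ropp, exp_ln by exact Hs. field. lra.
Qed.

(** One strip: E is the primitive of s^(-1-x), so the integral over the strip is a
    difference of its values, and g p is the term of the Hurwitz series at the midpoint
    p. *)
Lemma hurwitz_step p : 1 <= p ->
  2 * half_line_int (gH (p + 1 / 2)) - 2 * half_line_int (gH (p - 1 / 2)) = E (p + 1 / 2) - E (p - 1 / 2) - g p.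
Proof.
  intros Hp.
  set (h := fun s => Re (power_fun x (RtoC (p + s))) - Re (power_fun x (RtoC p))).
  assert (S : forall Y, 1 <= Y -> Rabs (2 * RInt (gH (p + 1 / 2)) 0 Y - 2 * RInt (gH (p - 1 / 2)) 0 Y
     - RInt h (- (1 / 2)) (1 / 2)) <= 8 * 16 * exp (- (2 * PI * Y))).
  { intros Y HY. apply (abel_plana_strip (power_fun x) (power_fun' x) p 16 128).
    - intros z Hz. apply power_fun_hol. apply Rabs_def2 in Hz. lra.
    - intros s Hs. apply Rabs_def2 in Hs. rewrite power_fun_real by lra. reflexivity.
    - intros z Hz _. apply Rabs_le_between in Hz. apply power_fun_half; [exact Hx|lra].
    - intros z Hz _. apply Rabs_le_between in Hz. apply hol_mvt with (F' := power_fun' x).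
      intros r Hr. set (w := (p + RtoC r * (z - p))%C).
      assert (Hw : 1 / 2 <= Re w).
      { unfold w. replace (Re (p + RtoC r * (z - p))%C) with (p + r * (Re z - p)) by (simpl; unfold Re; ring).
        nra. }
      destruct (power_fun_hol x w ltac:(lra)) as [A1 [A2 A3]]. repeat (split; [assumption|]).
      unfold power_fun'. rewrite !Cmod_mult, Cmod_R, Rabs_Ropp, Rabs_pos_eq by lra.
      rewrite Cmod_inv by (apply Cmod_sqr_pos; lra).
      assert (B1 : / Cmod w <= 2).
      { replace 2 with (/ (1/2)) by field. apply Rinv_le_contravar; [lra|].
        apply Rle_trans with (1 := Hw), Re_le_Cmod. }
      assert (0 < / Cmod w) by (apply Rinv_0_lt_compat; apply Cmod_sqr_pos; lra).
      assert (B2' : Cmod (power_fun x w) <= 16) by (apply power_fun_half; lra).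
      pose proof (Cmod_ge_0 (power_fun x w)).
      assert ((1 + x) * / Cmod w <= 4) by nra. assert (0 <= (1 + x) * / Cmod w) by nra. nra.
    - exact HY. }
  assert (Eh : RInt h (- (1 / 2)) (1 / 2) = E (p + 1 / 2) - E (p - 1 / 2) - g p).
  { assert (I1 : is_RInt (fun s => g (p + s) - g p) (- (1/2)) (1/2)
       (minus ((fun s => E (p + s) - s * g p) (1/2)) ((fun s => E (p + s) - s * g p) (-(1/2))))).
    { apply (is_RInt_derive (fun s => E (p + s) - s * g p) (fun s => g (p + s) - g p)).
      - intros s Hs. rewrite Rmin_left, Rmax_right in Hs by lra.
        apply (is_derive_minus (V := R_NormedModule) (fun s => E (p + s)) (fun s => s * g p)).
        + replace (g (p + s)) with (1 * g (p + s)) by ring.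
          apply (is_derive_comp E (fun s => p + s)); [apply is_derive_E; lra|].
          auto_derive; [exact I|ring].
        + auto_derive; [exact I|ring].
      - intros s Hs. rewrite Rmin_left, Rmax_right in Hs by lra.
        apply (ex_derive_continuous (V := R_NormedModule)). unfold g. auto_derive. lra. }
    rewrite (RInt_ext h (fun s => g (p + s) - g p)).
    - rewrite (is_RInt_unique _ _ _ _ I1). unfold minus, plus, opp; simpl.
      replace (p + - (1/2)) with (p - 1/2) by ring. field.
    - intros s Hs. rewrite Rmin_left, Rmax_right in Hs by lra. unfold h.
      rewrite !power_fun_real by lra. reflexivity. }
  rewrite <- Eh.
  destruct (gH_lim (p + 1/2) ltac:(lra)) as [L1 _]. destruct (gH_lim (p - 1/2) ltac:(lra)) as [L2 _].
  assert (L : is_lim_seq (fun j => 2 * RInt (gH (p + 1/2)) 0 (INR j) - 2 * RInt (gH (p - 1/2)) 0 (INR j)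
      - RInt h (- (1/2)) (1/2))
     (2 * half_line_int (gH (p + 1/2)) - 2 * half_line_int (gH (p - 1/2)) - RInt h (- (1/2)) (1/2))).
  { apply is_lim_seq_minus'; [apply is_lim_seq_minus'|apply is_lim_seq_const].
    - apply (is_lim_seq_scal_l _ 2 (half_line_int (gH (p + 1/2)))), L1.
    - apply (is_lim_seq_scal_l _ 2 (half_line_int (gH (p - 1/2)))), L2. }
  assert (Z : is_lim_seq (fun j => 2 * RInt (gH (p + 1/2)) 0 (INR j) - 2 * RInt (gH (p - 1/2)) 0 (INR j)
      - RInt h (- (1/2)) (1/2)) 0).
  { apply is_lim_seq_abs_0. apply is_lim_seq_le_le_loc with (fun _ => 0) (fun j => 128 * exp (- INR j)).
    - exists 1%nat. intros j Hj. split; [apply Rabs_pos|].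
      apply le_INR in Hj. simpl in Hj. eapply Rle_trans; [apply S; exact Hj|].
      replace (8 * 16) with 128 by ring. apply Rmult_le_compat_l; [lra|]. apply exp_le.
      pose proof PI2_3_2. nra.
    - apply is_lim_seq_const.
    - replace 0 with (128 * 0) by ring. apply (is_lim_seq_scal_l _ 128 0).
      apply (is_lim_comp_seq exp (fun j => - INR j) m_infty 0 is_lim_exp_m).
      + now exists O. + apply is_lim_seq_opp with (l := p_infty). apply is_lim_seq_INR. }
  pose proof (is_lim_seq_unique _ _ L) as U1. pose proof (is_lim_seq_unique _ _ Z) as U2.
  rewrite U1 in U2. injection U2. intros U. lra.
Qed.

Lemma lim_exp_ln (k c : R) : 0 < k -> 0 < c ->
  is_lim_seq (fun N => exp (- k * ln (c + INR N))) 0.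
Proof.
  intros Hk Hc.
  assert (L1 : is_lim_seq (fun N => c + INR N) p_infty).
  { apply (is_lim_seq_plus (fun _ => c) INR c p_infty p_infty);
      [apply is_lim_seq_const|apply is_lim_seq_INR|reflexivity]. }
  assert (L2 : is_lim_seq (fun N => ln (c + INR N)) p_infty).
  { apply (is_lim_comp_seq ln _ p_infty p_infty is_lim_ln_p); [now exists O|exact L1]. }
  apply (is_lim_comp_seq exp (fun N => - k * ln (c + INR N)) m_infty 0 is_lim_exp_m); [now exists O|].
  assert (L3 : is_lim_seq (fun N => - k * ln (c + INR N)) (Rbar_mult (- k) p_infty)).
  { apply (is_lim_seq_scal_l _ (- k) p_infty L2). }
  replace (Rbar_mult (- k) p_infty) with m_infty in L3; [exact L3|].
  simpl. destruct (Rle_dec 0 (- k)) as [Q|Q]; [exfalso; lra|reflexivity].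
Qed.

(** The strips telescope; the boundary terms at X + N + 1 vanish as N grows because both
    E and the edge integral decay. *)
Lemma hurwitz_sum alpha (S : R) : 0 < alpha ->
  is_series (fun k => g (alpha + 1 + INR k)) S ->
  S = exp (- x * ln (alpha + 1 / 2)) / x + 2 * half_line_int (gH (alpha + 1 / 2)).
Proof.
  intros Ha HS. set (X := alpha + 1 / 2).
  assert (F : forall N, sum_n (fun k => g (alpha + 1 + INR k)) N =
    E (X + INR (N + 1)) - E X + 2 * half_line_int (gH X) - 2 * half_line_int (gH (X + INR (N + 1)))).
  { induction N as [|N IH].
    - rewrite sum_O. simpl. pose proof (hurwitz_step (alpha + 1) ltac:(lra)) as St.
      replace (alpha + 1 + 1/2) with (X + 1) in St by (unfold X; ring).
      replace (alpha + 1 - 1/2) with X in St by (unfold X; field).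
      rewrite Rplus_0_r. lra.
    - rewrite sum_Sn, IH.
      match goal with |- plus ?a ?b = _ => change (plus a b) with (a + b) end.
      rewrite !plus_INR, (S_INR N). change (INR 1) with 1.
      pose proof (pos_INR N).
      pose proof (hurwitz_step (alpha + 1 + (INR N + 1)) ltac:(lra)) as St.
      replace (alpha + 1 + (INR N + 1) + 1/2) with (X + (INR N + 1 + 1)) in St by (unfold X; field).
      replace (alpha + 1 + (INR N + 1) - 1/2) with (X + (INR N + 1)) in St by (unfold X; field).
      lra. }
  assert (X0 : 0 < X) by (unfold X; lra).
  assert (L : is_lim_seq (sum_n (fun k => g (alpha + 1 + INR k))) (0 - E X + 2 * half_line_int (gH X) - 2 * 0)).
  { apply is_lim_seq_ext with (fun N => E (X + INR (N + 1)) - E X + 2 * half_line_int (gH X) - 2 * half_line_int (gH (X + INR (N + 1)))).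
    { intros N. symmetry. apply F. }
    apply is_lim_seq_minus'; [apply is_lim_seq_plus'; [apply is_lim_seq_minus'|]|].
    - unfold E. replace 0 with (- / x * 0) by ring.
      apply is_lim_seq_ext with (fun N => - / x * exp (- x * ln (X + INR (N + 1)))).
      + intros N. field. lra.
      + apply (is_lim_seq_scal_l _ (- / x) 0).
        apply (is_lim_seq_incr_n (fun N => exp (- x * ln (X + INR N))) 1).
        apply lim_exp_ln; lra.
    - apply is_lim_seq_const.
    - apply is_lim_seq_const.
    - apply (is_lim_seq_scal_l _ 2 0). apply is_lim_seq_abs_0.
      apply is_lim_seq_le_le with (fun _ => 0) (fun N => exp (- (1 + x) * ln (X + INR (N + 1)))).
      + intros N. split; [apply Rabs_pos|]. apply gH_lim. pose proof (pos_INR (N + 1)). lra.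
      + apply is_lim_seq_const.
      + apply (is_lim_seq_incr_n (fun N => exp (- (1 + x) * ln (X + INR N))) 1).
        apply lim_exp_ln; lra. }
  assert (L' : is_lim_seq (sum_n (fun k => g (alpha + 1 + INR k))) S) by exact HS.
  pose proof (is_lim_seq_unique _ _ L) as U1. pose proof (is_lim_seq_unique _ _ L') as U2.
  rewrite U1 in U2. injection U2. intros U. rewrite <- U. unfold E. field. lra.
Qed.
End HurwitzSum.

(** * An integral formula for the Stieltjes constants *)

Lemma half_line_int_lin (g1 g2 : R -> R) c C1 C2 :
  (forall y, 0 <= y -> continuous g1 y) -> (forall y, 0 <= y -> continuous g2 y) ->
  (forall y, 0 <= y -> Rabs (g1 y) <= C1 * exp (- y)) ->
  (forall y, 0 <= y -> Rabs (g2 y) <= C2 * exp (- y)) ->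
  half_line_int (fun y => g1 y + c * g2 y) = half_line_int g1 + c * half_line_int g2.
Proof.
  intros K1 K2 B1 B2.
  destruct (half_line_int_lim g1 C1 K1 B1) as [L1 _]. destruct (half_line_int_lim g2 C2 K2 B2) as [L2 _].
  unfold half_line_int at 1.
  rewrite (is_lim_seq_unique _ (half_line_int g1 + c * half_line_int g2)); [reflexivity|].
  apply is_lim_seq_ext with (fun j => RInt g1 0 (INR j) + c * RInt g2 0 (INR j)).
  - intros j. pose proof (pos_INR j).
    assert (E1 : ex_RInt g1 0 (INR j)) by (apply ex_RInt_cont; [lra|intros; apply K1; lra]).
    assert (E2 : ex_RInt g2 0 (INR j)) by (apply ex_RInt_cont; [lra|intros; apply K2; lra]).
    symmetry.
    pose proof (RInt_plus (V := R_CompleteNormedModule) g1 (fun y => scal c (g2 y)) 0 (INR j) E1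
      (ex_RInt_scal (V := R_NormedModule) g2 0 (INR j) c E2)) as P.
    pose proof (RInt_scal (V := R_CompleteNormedModule) g2 0 (INR j) c E2) as S.
    change (RInt (fun y => g1 y + c * g2 y) 0 (INR j) =
      RInt g1 0 (INR j) + RInt (fun y => c * g2 y) 0 (INR j)) in P.
    change (RInt (fun y => c * g2 y) 0 (INR j) = c * RInt g2 0 (INR j)) in S.
    rewrite S in P. exact P.
  - apply is_lim_seq_plus'; [exact L1|]. apply (is_lim_seq_scal_l _ c (half_line_int g2)), L2.
Qed.

(** The integral in the formula for gamma_n. Its generating series in n is the edge
    integral of z^(-1-x). *)
Definition log_moment (X : R) (n : nat) : R :=
  half_line_int (fun y => Im (Clog (RtoC X + Ci * RtoC y) ^ n * / (RtoC X + Ci * RtoC y))%C * fermi y).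

Lemma line_inv X y : 1 / 2 <= X -> Cmod (/ (RtoC X + Ci * RtoC y))%C <= 2.
Proof.
  intros HX. rewrite Cmod_inv by (apply Cmod_sqr_pos; rewrite line_Re; lra).
  replace 2 with (/ (1/2)) by field. apply Rinv_le_contravar; [lra|].
  apply Rle_trans with (1 := HX). rewrite <- (line_Re X y) at 1. apply Re_le_Cmod.
Qed.

(** On the line Re z = X the exponential of |Log z| grows at most linearly in y, hence
    is dominated by e^y. *)
Lemma exp_line_log X y : 1 / 2 <= X <= 3 / 2 -> 0 <= y ->
  exp (Cmod (Clog (RtoC X + Ci * RtoC y))) <= 2 * exp 2 * exp y.
Proof.
  intros HX Hy. set (z := (RtoC X + Ci * RtoC y)%C).
  assert (Hz1 : 1 / 2 <= Cmod z).
  { apply Rle_trans with (Re z); [unfold z; rewrite line_Re; lra|apply Re_le_Cmod]. }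
  assert (Hz2 : Cmod z <= 3 / 2 + y).
  { unfold z. eapply Rle_trans; [apply Cmod_triangle|].
    rewrite Cmod_mult, Cmod_Ci, !Cmod_R, !Rabs_pos_eq by lra. lra. }
  eapply Rle_trans; [apply exp_le, Cmod_Clog_le|]. rewrite exp_plus.
  assert (B1 : exp (PI / 2) <= exp 2) by (apply exp_le; pose proof PI_4; lra).
  pose proof (exp_ineq1_le y).
  assert (B2 : exp (Rabs (ln (Cmod z))) <= 2 * exp y).
  { unfold Rabs. destruct (Rcase_abs (ln (Cmod z))).
    - rewrite exp_Ropp, exp_ln by lra.
      apply Rle_trans with 2; [|lra]. replace 2 with (/ (1/2)) by field.
      apply Rinv_le_contravar; lra.
    - rewrite exp_ln by lra. lra. }
  pose proof (exp_pos (PI / 2)). pose proof (exp_pos (Rabs (ln (Cmod z)))). nra.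
Qed.

Lemma fermi_exp2 y : 0 <= y -> exp y * fermi y <= exp (- y).
Proof.
  intros Hy. apply Rle_trans with (exp y * exp (- (2 * PI * y))).
  - apply Rmult_le_compat_l; [left; apply exp_pos|apply fermi_le].
  - rewrite <- exp_plus. apply exp_le. pose proof PI2_3_2. nra.
Qed.

Lemma Im_remainder_step (iz A B wm : C) (a b k : R) :
  Im (iz * (A - (B + RtoC a * wm * RtoC b)))%C * k =
  Im (iz * (A - B))%C * k + - (a * b) * (Im (wm * iz)%C * k).
Proof. destruct iz, A, B, wm. simpl. ring. Qed.

Section Series.
Variables (X x : R).
Hypothesis HX : 1 / 2 <= X <= 3 / 2.
Hypothesis Hx : 0 < x <= 1 / 10.

Let z (y : R) : C := (RtoC X + Ci * RtoC y)%C.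
Let gn (n : nat) (y : R) : R := Im (Clog (z y) ^ n * / z y)%C * fermi y.
Let D (M : nat) (y : R) : R :=
  Im (/ z y * (Cexp (RtoC (- x) * Clog (z y)) - exp_partial_sum M (RtoC (- x) * Clog (z y))))%C * fermi y.

Lemma z_cont y : ccont z y.
Proof. exact (cderive_cont _ _ _ (cderive_vline _ _)). Qed.

Lemma z_Re y : Re (z y) = X.
Proof. apply line_Re. Qed.

Lemma zlog_cont y : ccont (fun y => Clog (z y)) y.
Proof. apply ccont_log; [apply z_cont|rewrite z_Re; lra]. Qed.

Lemma zinv_cont y : ccont (fun y => / z y)%C y.
Proof. apply ccont_inv; [apply z_cont|]. apply Cmod_sqr_pos. rewrite z_Re; lra. Qed.

Lemma ccont_exp_partial_sum M w (f : R -> C) : ccont f w -> ccont (fun y => exp_partial_sum M (f y)) w.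
Proof.
  intros H. induction M as [|M IH]; simpl; [apply ccont_const|].
  apply ccont_plus; [exact IH|]. apply ccont_mult; [now apply ccont_pow|apply ccont_const].
Qed.

Lemma Im_kap_cont (f : R -> C) y : ccont f y -> continuous (fun y => Im (f y) * fermi y) y.
Proof.
  intros H. apply (continuous_mult (fun y => Im (f y)) fermi); [exact (proj2 H)|apply fermi_cont].
Qed.

Lemma gn_cont n y : continuous (gn n) y.
Proof.
  apply (Im_kap_cont (fun y => Clog (z y) ^ n * / z y)%C).
  apply ccont_mult; [apply ccont_pow, zlog_cont|apply zinv_cont].
Qed.

Lemma D_cont M y : continuous (D M) y.
Proof.
  apply (Im_kap_cont (fun y => / z y * (Cexp (RtoC (- x) * Clog (z y)) - exp_partial_sum M (RtoC (- x) * Clog (z y))))%C).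
  assert (K : ccont (fun y => RtoC (- x) * Clog (z y))%C y)
    by (apply ccont_mult; [apply ccont_const|apply zlog_cont]).
  apply ccont_mult; [apply zinv_cont|]. apply ccont_minus; [now apply ccont_exp|now apply ccont_exp_partial_sum].
Qed.

Lemma Im_kap_bound (w : C) y B : 0 <= y -> 0 <= B -> Cmod w <= B * exp y ->
  Rabs (Im w * fermi y) <= B * exp (- y).
Proof.
  intros Hy HB Hw. pose proof (fermi_pos y). rewrite Rabs_mult, (Rabs_pos_eq (fermi y)) by lra.
  apply Rle_trans with (B * (exp y * fermi y)).
  - rewrite <- Rmult_assoc. apply Rmult_le_compat_r; [lra|].
    eapply Rle_trans; [apply Im_le_Cmod|exact Hw].
  - apply Rmult_le_compat_l; [exact HB|now apply fermi_exp2].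
Qed.

Lemma gn_bound n y : 0 <= y -> Rabs (gn n y) <= INR (fact n) * (4 * exp 2) * exp (- y).
Proof.
  intros Hy. pose proof (INR_fact_pos n) as Pf. pose proof (exp_pos 2).
  apply Im_kap_bound; [exact Hy|nra|].
  rewrite Cmod_mult, Cmod_pow.
  pose proof (pow_fact_le_exp (Cmod (Clog (z y))) n (Cmod_ge_0 _)) as P.
  pose proof (exp_line_log X y HX Hy) as Q. fold (z y) in Q.
  assert (P' : Cmod (Clog (z y)) ^ n <= INR (fact n) * (2 * exp 2 * exp y)).
  { apply Rle_trans with (INR (fact n) * (Cmod (Clog (z y)) ^ n / INR (fact n))).
    - right. field. lra.
    - apply Rmult_le_compat_l; lra. }
  pose proof (line_inv X y (proj1 HX)) as I2. fold (z y) in I2.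
  replace (INR (fact n) * (4 * exp 2) * exp y) with ((INR (fact n) * (2 * exp 2 * exp y)) * 2) by ring.
  apply Rmult_le_compat; auto using Cmod_ge_0. apply pow_le, Cmod_ge_0.
Qed.

(** As x <= 1/10, the M-th remainder is at most 2^(-M) e^(3 x |Log z|), and e^(3 x |Log
    z|) <= e^(|Log z|) is dominated by e^y while the Fermi factor is at most e^(-2 y). *)
Lemma D_bound M y : 0 <= y -> Rabs (D M y) <= (/ 2 ^ M * (4 * exp 2)) * exp (- y).
Proof.
  intros Hy. pose proof (exp_pos 2).
  assert (P2 : 0 < / 2 ^ M) by (apply Rinv_0_lt_compat, pow_lt; lra).
  apply Im_kap_bound; [exact Hy|nra|].
  rewrite Cmod_mult. pose proof (line_inv X y (proj1 HX)) as I2. fold (z y) in I2.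
  pose proof (exp_line_log X y HX Hy) as Q. fold (z y) in Q.
  set (L := Clog (z y)) in *.
  assert (R : Cmod (Cexp (RtoC (- x) * L) - exp_partial_sum M (RtoC (- x) * L))%C <= / 2 ^ M * (2 * exp 2 * exp y)).
  { eapply Rle_trans; [apply Cexp_remainder|].
    rewrite Cmod_mult, Cmod_R, Rabs_Ropp, Rabs_pos_eq by lra.
    set (l := Cmod L) in *. assert (Pl : 0 <= l) by apply Cmod_ge_0.
    pose proof (pow_fact_le_exp (2 * (x * l)) M ltac:(nra)) as P.
    rewrite Rpow_mult_distr in P.
    pose proof (INR_fact_pos M) as Pf.
    assert (P' : (x * l) ^ M / INR (fact M) <= / 2 ^ M * exp (2 * (x * l))).
    { replace ((x * l) ^ M / INR (fact M)) with (/ 2 ^ M * (2 ^ M * (x * l) ^ M / INR (fact M))).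
      - apply Rmult_le_compat_l; lra.
      - field. split; [lra|]. apply pow_nonzero. lra. }
    apply Rle_trans with (/ 2 ^ M * exp (2 * (x * l)) * exp (x * l)).
    - apply Rmult_le_compat_r; [left; apply exp_pos|exact P'].
    - rewrite Rmult_assoc. apply Rmult_le_compat_l; [lra|].
      rewrite <- exp_plus. eapply Rle_trans; [|exact Q]. apply exp_le. nra. }
  replace (/ 2 ^ M * (4 * exp 2) * exp y) with (2 * (/ 2 ^ M * (2 * exp 2 * exp y))) by ring.
  apply Rmult_le_compat; auto using Cmod_ge_0.
Qed.

(** Removing one more term of the exponential series removes one more log_moment. *)
Lemma D_half_line_int M : half_line_int (D M) = half_line_int (D 0) - match M with O => 0 | S m => sum_n (fun k => (- x) ^ k / INR (fact k) * log_moment X k) m end.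
Proof.
  assert (St : forall m, half_line_int (D (S m)) = half_line_int (D m) - (- x) ^ m / INR (fact m) * log_moment X m).
  { intros m. transitivity (half_line_int (fun y => D m y + - ((- x) ^ m / INR (fact m)) * gn m y)).
    - f_equal. apply functional_extensionality. intros y.
      unfold D, gn. set (w := Clog (z y)). set (iz := (/ z y)%C).
      change (exp_partial_sum (S m) (RtoC (- x) * w))%C with
        (exp_partial_sum m (RtoC (- x) * w) + (RtoC (- x) * w) ^ m * RtoC (/ INR (fact m)))%C.
      rewrite Cpow_mult_l, <- RtoC_pow. apply Im_remainder_step.
    - rewrite (half_line_int_lin (D m) (gn m) _ (/ 2 ^ m * (4 * exp 2)) (INR (fact m) * (4 * exp 2))).
      + change (half_line_int (gn m)) with (log_moment X m). ring.
      + intros; apply D_cont.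
      + intros; apply gn_cont.
      + intros; now apply D_bound.
      + intros; now apply gn_bound. }
  induction M as [|M IH]; [ring|]. rewrite St, IH. destruct M as [|M].
  - rewrite sum_O. ring.
  - rewrite sum_Sn. match goal with |- _ = _ - plus ?a ?b => change (plus a b) with (a + b) end. ring.
Qed.

(** Expanding z^(-x) = e^(-x Log z) under the integral sign; the remainders of the
    exponential series are bounded uniformly, with geometric decay. *)
Lemma log_moment_series : is_series (fun k => (- x) ^ k / INR (fact k) * log_moment X k)
  (half_line_int (fun y => Im (power_fun x (RtoC X + Ci * RtoC y)%C) * fermi y)).
Proof.
  assert (E : half_line_int (fun y => Im (power_fun x (RtoC X + Ci * RtoC y)%C) * fermi y) = half_line_int (D 0)).
  { f_equal. apply functional_extensionality. intros y.
    unfold D. fold (z y). simpl exp_partial_sum. f_equal. f_equal. unfold power_fun.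
    replace (RtoC (- (1 + x)) * Clog (z y))%C with (- Clog (z y) + RtoC (- x) * Clog (z y))%C
      by (rewrite !RtoC_opp, RtoC_plus; ring).
    rewrite Cexp_plus, Cexp_opp, Cexp_Clog by (rewrite z_Re; lra). ring. }
  rewrite E.
  assert (L : is_lim_seq (sum_n (fun k => (- x) ^ k / INR (fact k) * log_moment X k)) (half_line_int (D 0))); [|exact L].
  apply is_lim_seq_ext with (fun m => half_line_int (D 0) - half_line_int (D (S m))).
  { intros m. rewrite (D_half_line_int (S m)). ring. }
  replace (Finite (half_line_int (D 0))) with (Finite (half_line_int (D 0) - 0)) by (f_equal; ring).
  apply is_lim_seq_minus'; [apply is_lim_seq_const|].
  apply is_lim_seq_abs_0. apply is_lim_seq_le_le with (fun _ => 0) (fun m => (4 * exp 2) * (/ 2) ^ (S m)).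
  - intros m. split; [apply Rabs_pos|].
    replace ((4 * exp 2) * (/ 2) ^ (S m)) with (/ 2 ^ (S m) * (4 * exp 2)) by (rewrite pow_inv; ring).
    apply half_line_int_lim; intros y Hy; [apply D_cont|now apply D_bound].
  - apply is_lim_seq_const.
  - replace 0 with ((4 * exp 2) * 0) by ring. apply (is_lim_seq_scal_l _ (4 * exp 2) 0).
    apply (is_lim_seq_incr_1 (fun m => (/ 2) ^ m)). apply is_lim_seq_geom. rewrite Rabs_pos_eq; lra.
Qed.
End Series.

Lemma is_series_Re (a : nat -> C) (l : C) :
  is_series (K := C_AbsRing) (V := C_NormedModule) a l -> is_series (fun k => Re (a k)) (Re l).
Proof.
  intros H P [e He]. unfold is_series in H.
  assert (Q : locally (T := C_NormedModule) l (fun z : C => P (Re z))).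
  { exists e. intros y Hy. apply He. exact (proj1 Hy). }
  specialize (H _ Q). unfold filtermap in *. eapply filter_imp; [|exact H].
  intros n Hn.
  assert (E : forall n, sum_n (fun k => Re (a k)) n = Re (sum_n (G := C_AbelianGroup) a n)).
  { clear. induction n as [|n IH].
    - now rewrite !sum_O. - rewrite !sum_Sn, IH. reflexivity. }
  rewrite E. exact Hn.
Qed.

Lemma exp_series u : is_series (fun k => u ^ k / INR (fact k)) (exp u).
Proof.
  eapply is_series_ext; [|exact (is_exp_Reals u)].
  intros n. unfold scal; simpl; unfold mult; simpl. rewrite pow_n_pow. field. apply INR_fact_neq_0.
Qed.

Lemma is_series_R_ext (a b : nat -> R) (l l' : R) :
  (forall n, a n = b n) -> l = l' -> is_series a l -> is_series b l'.
Proof. intros H <- K. exact (is_series_ext a b l H K). Qed.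

Lemma is_series_R_lin (a b : nat -> R) (l m c : R) :
  is_series a l -> is_series b m -> is_series (fun k => a k + c * b k) (l + c * m).
Proof.
  intros H K. exact (is_series_plus _ _ _ _ H (is_series_scal_l (K := R_AbsRing) c b m K)).
Qed.

Lemma is_series_tail (a : nat -> R) (l : R) : is_series a l -> is_series (fun k => a (S k)) (l - a O).
Proof.
  intros H. apply (is_series_incr_1 a).
  refine (eq_ind_r (fun m => is_series a m) H _).
  change (l - a O + a O = l). ring.
Qed.

(** Both sides of hurwitz_sum are power series in x: the Laurent series of zeta minus
    the pole, the exponential series of alpha^(-x) and X^(-x), and log_moment_series.
    The pole 1/x cancels against the leading term of X^(-x)/x, and coefficients are
    compared. *)
Lemma stieltjes_formula alpha gamma n : 0 < alpha <= 1 -> is_stieltjes alpha gamma ->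
  gamma n = ln alpha ^ n / alpha - ln (alpha + 1 / 2) ^ (S n) / INR (S n)
            + 2 * log_moment (alpha + 1 / 2) n.
Proof.
  intros Ha [zeta [[Hz _] [r [Hr Hp]]]]. set (X := alpha + 1 / 2).
  set (b := fun m => ln alpha ^ m / alpha - ln X ^ (S m) / INR (S m) + 2 * log_moment X m).
  set (r' := Rmin r (1/10)). assert (Hr' : 0 < r') by (apply Rmin_glb_lt; lra).
  assert (Z : forall m, (fun m => (-1) ^ m / INR (fact m) * (gamma m - b m)) m = 0).
  { apply (series_zero_coef _ r' Hr'). intros x [Hx0 Hx1].
    assert (Hxr : x < r) by (apply Rlt_le_trans with (1 := Hx1), Rmin_l).
    assert (Hx : 0 < x <= 1/10) by (split; [exact Hx0|left; apply Rlt_le_trans with (1 := Hx1), Rmin_r]).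
    assert (Es : (RtoC (1 + x) - 1)%C = RtoC x) by (rewrite RtoC_plus; ring).
    assert (Sz : is_series (fun k => exp (- (1 + x) * ln (INR k + alpha))) (Re (zeta (RtoC (1 + x))))).
    { refine (is_series_R_ext _ _ _ _ _ eq_refl (is_series_Re _ _ (Hz (RtoC (1 + x)) _))).
      - intros k. rewrite <- RtoC_opp, <- RtoC_mult, Cexp_RtoC. reflexivity.
      - simpl. lra. }
    assert (S1 : Re (zeta (RtoC (1 + x))) - exp (- (1 + x) * ln alpha) =
       exp (- x * ln X) / x + 2 * half_line_int (fun y => Im (power_fun x (RtoC X + Ci * RtoC y)%C) * fermi y)).
    { apply (hurwitz_sum x); [lra|lra|].
      refine (is_series_R_ext _ _ _ _ _ _ (is_series_tail _ _ Sz)).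
      - intros k. rewrite S_INR. do 3 f_equal. ring.
      - simpl INR. now rewrite Rplus_0_l. }
    assert (Sg : is_series (fun m => (-1) ^ m / INR (fact m) * gamma m * x ^ m)
        (Re (zeta (RtoC (1 + x))) - 1 / x)).
    { assert (Hs : 0 < Cmod (RtoC (1 + x) - 1)%C < r) by (rewrite Es, Cmod_R, Rabs_pos_eq; lra).
      pose proof (Hp _ Hs) as P. rewrite Es in P.
      refine (is_series_R_ext _ _ _ _ _ _ (is_series_Re _ _ P)).
      - intros m. assert (Ep : pow_n (K := C_AbsRing) (RtoC x) m = RtoC (x ^ m)).
        { clear. induction m as [|m IH]; [reflexivity|]. simpl pow_n. rewrite IH.
          change (mult (RtoC x) (RtoC (x ^ m))) with (RtoC x * RtoC (x ^ m))%C.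
          now rewrite <- RtoC_mult. }
        rewrite Ep.
        change (Re (RtoC (x ^ m) * RtoC ((-1) ^ m / INR (fact m) * gamma m))%C =
          (-1) ^ m / INR (fact m) * gamma m * x ^ m). rewrite <- RtoC_mult. simpl. ring.
      - unfold Cdiv. rewrite <- RtoC_inv by lra. simpl. unfold Re. field. lra. }
    pose proof (exp_series (- x * ln alpha)) as SA.
    pose proof (is_series_tail _ _ (exp_series (- x * ln X))) as SB.
    pose proof (log_moment_series X x ltac:(unfold X; lra) Hx) as SC.
    pose proof (is_series_R_lin _ _ _ _ (- / alpha) Sg SA) as T1.
    pose proof (is_series_R_lin _ _ _ _ (- / x) T1 SB) as T2.
    pose proof (is_series_R_lin _ _ _ _ (- 2) T2 SC) as T3.
    refine (is_series_R_ext _ _ _ _ _ _ T3).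
    - intros m. cbv beta. unfold b. rewrite fact_simpl, mult_INR.
      rewrite !Rpow_mult_distr.
      replace ((- x) ^ m) with ((-1) ^ m * x ^ m) by (rewrite <- Rpow_mult_distr; f_equal; ring).
      replace ((- x) ^ (S m)) with (- x * ((-1) ^ m * x ^ m))
        by (rewrite <- Rpow_mult_distr; simpl; f_equal; f_equal; ring).
      pose proof (INR_fact_pos m). pose proof (lt_0_INR (S m) ltac:(lia)).
      field. lra.
    - replace (Re (zeta (RtoC (1 + x)))) with (exp (- (1 + x) * ln alpha) + (exp (- x * ln X) / x + 2 * half_line_int (fun y => Im (power_fun x (RtoC X + Ci * RtoC y)%C) * fermi y))) by lra.
      replace (- (1 + x) * ln alpha) with (- x * ln alpha + - ln alpha) by ring.
      rewrite exp_plus, (exp_Ropp (ln alpha)), exp_ln by lra.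
      simpl (_ ^ 0 / _). field. lra. }
  specialize (Z n). simpl in Z.
  assert (N : (-1) ^ n / INR (fact n) <> 0).
  { apply Rmult_integral_contrapositive. split; [apply pow_nonzero; lra|].
    apply Rinv_neq_0_compat, INR_fact_neq_0. }
  apply Rmult_integral in Z. destruct Z as [Z|Z]; [contradiction|]. unfold b in Z. lra.
Qed.

(** * Deformation of the contour to the Lambert spiral *)

(** The first harmonic of the integrand, continued to the right half-plane. *)
Definition log_wave (n : nat) (z : C) : C := (Clog z ^ n * / z * Cexp (2 * PI * Ci * z))%C.
Definition log_wave' (n : nat) (z : C) : C :=
  ((RtoC (INR n) * Clog z ^ (pred n) * / z * / z + Clog z ^ n * (- 1 / (z * z))) * Cexp (2 * PI * Ci * z)
   + Clog z ^ n * / z * (2 * PI * Ci * Cexp (2 * PI * Ci * z)))%C.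

Lemma log_wave_hol n z : 0 < Re z -> hol (log_wave n) (log_wave' n) z /\ ccont2 (log_wave' n) z /\ ccont2 (log_wave n) z.
Proof.
  intros H. assert (Hz : z <> RtoC 0) by now apply Cmod_sqr_pos.
  pose proof (ccont2_Clog z H) as C1. pose proof (ccont2_inv z Hz) as C2.
  assert (C3 : ccont2 (fun w => Cexp (2 * PI * Ci * w)%C) z).
  { apply ccont_exp, ccont_mult; [apply ccont_const|apply ccont_coords]. }
  unfold ccont2 in *.
  assert (C4 : forall m, ccont (U := prod_UniformSpace R_UniformSpace R_UniformSpace)
     (fun w => Clog w ^ m)%C z) by (intros m; apply ccont_pow; exact C1).
  split; [|split].
  - eapply hol_ext; [reflexivity| |apply hol_mult; [apply hol_mult;
      [apply hol_pow, hol_log, H|apply hol_inv; [apply hol_id|exact Hz]]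
      |apply hol_exp, hol_mult; [apply hol_const|apply hol_id]]].
    cbv beta. unfold log_wave'. field. exact Hz.
  - apply ccont_plus.
    + apply ccont_mult; [|exact C3]. apply ccont_plus.
      * apply ccont_mult; [|exact C2]. apply ccont_mult; [|exact C2].
        apply ccont_mult; [apply ccont_const|exact (C4 (pred n))].
      * apply ccont_mult; [exact (C4 n)|]. apply ccont_mult; [apply ccont_const|].
        apply ccont_inv; [apply ccont_mult; apply ccont_coords|].
        exact (Cmult_neq_0 z z Hz Hz).
    + apply ccont_mult; [apply ccont_mult; [exact (C4 n)|exact C2]|].
      apply ccont_mult; [apply ccont_const|exact C3].
  - apply ccont_mult; [|exact C3]. apply ccont_mult; [exact (C4 n)|exact C2].
Qed.

Lemma Re_2PICi z : Re (2 * PI * Ci * z)%C = - (2 * PI * Im z).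
Proof. destruct z; simpl. ring. Qed.

Lemma log_wave_mod n z : 0 < Re z ->
  Cmod (log_wave n z) = Cmod (Clog z) ^ n * / Cmod z * exp (- (2 * PI * Im z)).
Proof.
  intros H. unfold log_wave. rewrite !Cmod_mult, Cmod_pow, Cmod_Cexp, Re_2PICi.
  rewrite Cmod_inv by now apply Cmod_sqr_pos. reflexivity.
Qed.

(** The integral of log_wave along the vertical segment from w to w + iY. *)
Definition ray_int (n : nat) (w : C) (Y : R) : C := CInt (fun y => Ci * log_wave n (w + Ci * RtoC y))%C 0 Y.

Lemma vline_Re w y : Re (w + Ci * RtoC y)%C = Re w.
Proof. destruct w; simpl. ring. Qed.
Lemma vline_Im w y : Im (w + Ci * RtoC y)%C = Im w + y.
Proof. destruct w; simpl. ring. Qed.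

(** The factor e^(-2 pi Im z) beats the power of the logarithm, which is dominated by
    e^y through pow_fact_le_exp; the constant depends on the base only through the
    bounds c and K. *)
Lemma log_wave_top n c K w Y : 0 < c <= 1 -> 1 <= K -> c <= Re w -> Cmod w <= K -> - K <= Im w -> 0 <= Y ->
  Cmod (log_wave n (w + Ci * RtoC Y)%C) <=
    INR (fact n) * exp 2 * (K + / c) * / c * exp (2 * PI * K) * exp (- Y).
Proof.
  intros Hc HK H1 H2 H3 HY. set (z := (w + Ci * RtoC Y)%C).
  assert (Hz : c <= Cmod z).
  { apply Rle_trans with (1 := H1). rewrite <- (vline_Re w Y). apply Re_le_Cmod. }
  assert (Hz2 : Cmod z <= K + Y).
  { unfold z. eapply Rle_trans; [apply Cmod_triangle|].
    rewrite Cmod_mult, Cmod_Ci, Cmod_R, Rabs_pos_eq by lra. lra. }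
  rewrite log_wave_mod by (unfold z; rewrite vline_Re; lra).
  assert (Ic : 1 <= / c) by (rewrite <- Rinv_1; apply Rinv_le_contravar; lra).
  pose proof (INR_fact_pos n) as Pf. pose proof (exp_pos 2) as E2. pose proof (exp_pos Y) as EY.
  pose proof (exp_ineq1_le Y) as EY1.
  assert (L : exp (Cmod (Clog z)) <= exp 2 * ((K + / c) * exp Y)).
  { eapply Rle_trans; [apply exp_le, Cmod_Clog_le|]. rewrite Rplus_comm, exp_plus.
    apply Rmult_le_compat; try (left; apply exp_pos).
    - apply exp_le. pose proof PI_4. lra.
    - unfold Rabs. destruct (Rcase_abs (ln (Cmod z))).
      + rewrite exp_Ropp, exp_ln by lra.
        assert (/ Cmod z <= / c) by (apply Rinv_le_contravar; lra). nra.
      + rewrite exp_ln by lra. nra. }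
  assert (P : Cmod (Clog z) ^ n <= INR (fact n) * (exp 2 * ((K + / c) * exp Y))).
  { pose proof (pow_fact_le_exp (Cmod (Clog z)) n (Cmod_ge_0 _)) as P.
    apply Rle_trans with (INR (fact n) * (Cmod (Clog z) ^ n / INR (fact n))).
    - right. field. lra.
    - apply Rmult_le_compat_l; lra. }
  assert (I : / Cmod z <= / c) by (apply Rinv_le_contravar; lra).
  assert (Q : exp (- (2 * PI * Im z)) <= exp (2 * PI * K) * (exp (- Y) * exp (- Y))).
  { rewrite <- !exp_plus. apply exp_le. unfold z. rewrite vline_Im. pose proof PI2_3_2. nra. }
  replace (INR (fact n) * exp 2 * (K + / c) * / c * exp (2 * PI * K) * exp (- Y)) with
    ((INR (fact n) * (exp 2 * ((K + / c) * exp Y))) * / c * (exp (2 * PI * K) * (exp (- Y) * exp (- Y)))).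
  - apply Rmult_le_compat; [|left; apply exp_pos| |exact Q].
    + apply Rmult_le_pos; [apply pow_le, Cmod_ge_0|]. left. apply Rinv_0_lt_compat. lra.
    + apply Rmult_le_compat; [apply pow_le, Cmod_ge_0| |exact P|exact I].
      left. apply Rinv_0_lt_compat. lra.
  - rewrite exp_Ropp. field. split; lra.
Qed.

Lemma ray_int_cont n w y : 0 < Re w -> ccont (fun y => Ci * log_wave n (w + Ci * RtoC y))%C y.
Proof.
  intros H. apply ccont_mult; [apply ccont_const|].
  apply (ccont_comp (log_wave n) (fun y : R => (w + Ci * RtoC y)%C)).
  - exact (proj2 (proj2 (log_wave_hol n _ ltac:(rewrite vline_Re; exact H)))).
  - exact (cderive_cont _ _ _ (cderive_vline _ _)).
Qed.

Lemma Im_mult_RtoC (t : C) (r : R) : Im (t * RtoC r)%C = Im t * r.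
Proof. destruct t; simpl. ring. Qed.
Lemma Re_mult_RtoC (t : C) (r : R) : Re (t * RtoC r)%C = Re t * r.
Proof. destruct t; simpl. ring. Qed.

Lemma PI_neq0_C : RtoC PI <> RtoC 0.
Proof. intros K. apply RtoC_inj in K. pose proof PI_RGT_0. lra. Qed.

Section Spiral.
Variables (n : nat) (t : C) (delta : R).
Hypothesis Hv : 0 < Im t < PI / 2.
Hypothesis Hd : 0 < delta.
Hypothesis Hd2 : Im t * (1 + delta) < PI / 2.
Hypothesis Hw : (t * Cexp t = INR n * Ci / (2 * PI))%C.
Hypothesis Ht : t <> RtoC 0.

(** Log (spiral s) = t (1 + s), so the spiral starts at 1 for s = -1 and meets the
    saddle point e^t at s = 0. *)
Definition spiral (s : R) : C := Cexp (t * RtoC (1 + s))%C.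
(** The integrand along the spiral, normalised to be 1 at the saddle point s = 0. *)
Definition spiral_kernel (s : R) : C :=
  (RtoC ((1 + s) ^ n) * Cexp (- (RtoC (INR n) / t) * (Cexp (t * RtoC s) - 1)))%C.

Lemma spiral_der s : cderive spiral s (t * spiral s)%C.
Proof.
  apply cderive_exp. eapply cderive_eq.
  - apply cderive_cmult. apply cderive_RtoC with (l := 1). auto_derive; [exact I|ring].
  - ring.
Qed.

Lemma spiral_arg s : Im (t * RtoC (1 + s))%C = Im t * (1 + s).
Proof. apply Im_mult_RtoC. Qed.

Lemma spiral_Re_pos s : -2 <= s -> Im t * (1 + s) < PI / 2 -> 0 < Re (spiral s).
Proof.
  intros H1 H2. unfold spiral, Cexp. cbn [Re fst]. rewrite spiral_arg.
  apply Rmult_lt_0_compat; [apply exp_pos|]. apply cos_gt_0; nra.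
Qed.

(** The saddle point equation gives 2 pi i e^(t(1+s)) = - (n/t) e^(ts); the exponent is
    split into its value -n/t at s = 0 and the rest. *)
Lemma spiral_integrand s : -2 <= s -> Im t * (1 + s) < PI / 2 ->
  (log_wave n (spiral s) * (t * spiral s) = t ^ (S n) * Cexp (- (RtoC (INR n) / t)) * spiral_kernel s)%C.
Proof.
  intros H1 H2. pose proof PI_neq0_C as HP. pose proof PI_RGT_0.
  unfold log_wave, spiral_kernel. set (z := spiral s). assert (Hz : z <> RtoC 0) by apply Cexp_neq0.
  assert (EL : Clog z = (t * RtoC (1 + s))%C).
  { apply Clog_Cexp. rewrite spiral_arg. apply Rabs_def1; nra. }
  assert (E2 : (2 * PI * Ci * z = - (RtoC (INR n) / t) + - (RtoC (INR n) / t) * (Cexp (t * RtoC s) - 1))%C).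
  { assert (Ez : z = (Cexp t * Cexp (t * RtoC s))%C).
    { unfold z, spiral. rewrite <- Cexp_plus. f_equal. rewrite RtoC_plus. ring. }
    assert (Et : Cexp t = (RtoC (INR n) * Ci / (2 * PI) / t)%C).
    { rewrite <- Hw. field. exact Ht. }
    rewrite Ez, Et.
    replace (2 * PI * Ci * (INR n * Ci / (2 * PI) / t * Cexp (t * s)))%C
      with ((Ci * Ci) * (RtoC (INR n) / t) * Cexp (t * s))%C by (field; split; assumption).
    replace (Ci * Ci)%C with (- (1))%C by (apply Ceq; simpl; ring). ring. }
  rewrite E2, Cexp_plus, EL, Cpow_mult_l, <- RtoC_pow.
  rewrite Cpow_S. field. exact Hz.
Qed.

Lemma spiral_m1 : spiral (-1) = RtoC 1.
Proof.
  unfold spiral. replace (1 + -1) with 0 by ring. rewrite Cmult_0_r. apply Cexp_0.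
Qed.

Lemma spiral_kernel_cont s : ccont spiral_kernel s.
Proof.
  unfold spiral_kernel. apply ccont_mult.
  - apply ccont_RtoC. apply (ex_derive_continuous (V := R_NormedModule)). auto_derive. exact I.
  - apply ccont_exp, ccont_mult; [apply ccont_const|]. apply ccont_minus; [|apply ccont_const].
    apply ccont_exp, ccont_mult; [apply ccont_const|].
    apply ccont_RtoC, continuous_id.
Qed.

Definition spiral_int : C := (t ^ (S n) * Cexp (- (RtoC (INR n) / t)) * CInt spiral_kernel (-1) delta)%C.

Lemma arg_ok s : s <= delta -> Im t * (1 + s) < PI / 2.
Proof. intros H. nra. Qed.

Let b0 : R := PI / 2 / Im t - 1.

Lemma b0_gt : delta < b0.
Proof.
  unfold b0. apply Rmult_lt_reg_r with (Im t); [lra|].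
  replace ((PI / 2 / Im t - 1) * Im t) with (PI / 2 - Im t) by (field; lra). lra.
Qed.

Lemma b0_ok s : s < b0 -> Im t * (1 + s) < PI / 2.
Proof.
  intros H. unfold b0 in H. apply Rmult_lt_compat_l with (r := Im t) in H; [|lra].
  replace (Im t * (PI / 2 / Im t - 1)) with (PI / 2 - Im t) in H by (field; lra). lra.
Qed.

(** The ray from 1 becomes the spiral followed by the ray from its end point, up to the
    edge at height Y. *)
Lemma sweep_spiral Y : 0 <= Y ->
  ray_int n 1 Y = (spiral_int + ray_int n (spiral delta) Y
    - CInt (fun s => log_wave n (spiral s + Ci * RtoC Y) * (t * spiral s)) (-1) delta)%C.
Proof.
  intros HY. pose proof b0_gt as B.
  pose proof (sweep (log_wave n) (log_wave' n) spiral (fun s => t * spiral s)%C (-2) (-1) delta b0 0 Y 1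
    ltac:(lra) ltac:(lra) B HY ltac:(lra)) as S.
  specialize (S (fun s _ => spiral_der s)).
  assert (Cc : forall s, ccont (fun s => t * spiral s)%C s).
  { intros s. apply ccont_mult; [apply ccont_const|]. exact (cderive_cont _ _ _ (spiral_der s)). }
  specialize (S (fun s _ => Cc s)).
  assert (Hh : forall s y, -2 < s < b0 -> 0 - 1 < y ->
    hol (log_wave n) (log_wave' n) (spiral s + Ci * RtoC y)%C /\ ccont2 (log_wave' n) (spiral s + Ci * RtoC y)%C
    /\ ccont2 (log_wave n) (spiral s + Ci * RtoC y)%C).
  { intros s y Hs _. apply log_wave_hol. rewrite vline_Re. apply spiral_Re_pos; [lra|apply b0_ok; lra]. }
  specialize (S Hh).
  fold (ray_int n (spiral delta) Y) in S. fold (ray_int n (spiral (-1)) Y) in S.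
  rewrite spiral_m1 in S.
  assert (Cf : forall y s, -1 <= s <= delta -> ccont (fun s => log_wave n (spiral s + Ci * RtoC y) * (t * spiral s))%C s).
  { intros y s Hs. apply ccont_mult; [|apply Cc].
    apply (ccont_comp (log_wave n) (fun s : R => (spiral s + Ci * RtoC y)%C)).
    - refine (proj2 (proj2 (log_wave_hol n _ _))). rewrite vline_Re. apply spiral_Re_pos; [lra|apply arg_ok; lra].
    - apply ccont_plus; [exact (cderive_cont _ _ _ (spiral_der s))|apply ccont_const]. }
  assert (E : CInt (fun s => (log_wave n (spiral s + Ci * RtoC Y) - log_wave n (spiral s + Ci * RtoC 0)) * (t * spiral s))%C (-1) delta
    = (CInt (fun s => log_wave n (spiral s + Ci * RtoC Y) * (t * spiral s)) (-1) delta - spiral_int)%C).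
  { transitivity (CInt (fun s => log_wave n (spiral s + Ci * RtoC Y) * (t * spiral s)
      + - (1) * (log_wave n (spiral s + Ci * RtoC 0) * (t * spiral s)))%C (-1) delta).
    - apply CInt_ext; [lra|]. intros s Hs. ring.
    - rewrite CInt_plus; [|lra|apply Cf|intros s Hs; apply ccont_mult; [apply ccont_const|now apply Cf]].
      rewrite CInt_cmult; [|lra|apply Cf].
      rewrite (CInt_ext (fun s => log_wave n (spiral s + Ci * RtoC 0) * (t * spiral s))%C
        (fun s => (t ^ (Datatypes.S n) * Cexp (- (RtoC (INR n) / t))) * spiral_kernel s)%C).
      + rewrite CInt_cmult; [|lra|intros; apply spiral_kernel_cont]. unfold spiral_int. ring.
      + lra.
      + intros s Hs. replace (spiral s + Ci * RtoC 0)%C with (spiral s) by ring.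
        apply spiral_integrand; [lra|apply arg_ok; lra]. }
  rewrite E in S.
  transitivity (ray_int n (spiral delta) Y - (ray_int n (spiral delta) Y - ray_int n 1 Y))%C; [ring|].
  rewrite S. ring.
Qed.

End Spiral.

Section Segment.
Variables (n : nat) (alpha : R).
Let X := alpha + 1 / 2.
Hypothesis Ha : 0 < alpha <= 1.

(** The ray from X is first moved to the ray from 1, where the spiral starts; the
    segment between them lies near 1, where |Log z| <= 1. *)
Lemma sweep_segment Y : 0 <= Y ->
  ray_int n (RtoC X) Y = (ray_int n 1 Y
    + CInt (fun s => log_wave n (RtoC (1 + s * (X - 1)) + Ci * RtoC Y) * RtoC (X - 1)) 0 1
    - CInt (fun s => log_wave n (RtoC (1 + s * (X - 1))) * RtoC (X - 1)) 0 1)%C.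
Proof.
  intros HY.
  assert (HX : 1 / 2 < X <= 3 / 2) by (unfold X; lra).
  assert (Dz : forall s, cderive (fun s => RtoC (1 + s * (X - 1))) s (RtoC (X - 1))).
  { intros s. apply cderive_RtoC. auto_derive; [exact I|ring]. }
  assert (Pz : forall s, - (1/2) < s < 3 / 2 -> 0 < 1 + s * (X - 1)) by (intros s Hs; nra).
  assert (S : (ray_int n (RtoC (1 + 1 * (X - 1))) Y - ray_int n (RtoC (1 + 0 * (X - 1))) Y =
    CInt (fun s => (log_wave n (RtoC (1 + s * (X - 1)) + Ci * RtoC Y) - log_wave n (RtoC (1 + s * (X - 1)) + Ci * RtoC 0)) * RtoC (X - 1)) 0 1)%C).
  { apply (sweep (log_wave n) (log_wave' n) (fun s => RtoC (1 + s * (X - 1))) (fun _ => RtoC (X - 1)) (-(1/2)) 0 1 (3/2) 0 Y 1);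
      try lra.
    - intros s _. apply Dz.
    - intros s _. apply ccont_const.
    - intros s y Hs _. apply log_wave_hol. rewrite line_Re. now apply Pz. }
  replace (1 + 1 * (X - 1)) with X in S by ring. replace (1 + 0 * (X - 1)) with 1 in S by ring.
  assert (Cf : forall y s, 0 <= s <= 1 -> ccont (fun s => log_wave n (RtoC (1 + s * (X - 1)) + Ci * RtoC y) * RtoC (X - 1))%C s).
  { intros y s Hs. apply ccont_mult; [|apply ccont_const].
    apply (ccont_comp (log_wave n) (fun s : R => (RtoC (1 + s * (X - 1)) + Ci * RtoC y)%C)).
    - refine (proj2 (proj2 (log_wave_hol n _ _))). rewrite line_Re. apply Pz. lra.
    - apply ccont_plus; [exact (cderive_cont _ _ _ (Dz s))|apply ccont_const]. }
  assert (E : CInt (fun s => (log_wave n (RtoC (1 + s * (X - 1)) + Ci * RtoC Y) - log_wave n (RtoC (1 + s * (X - 1)) + Ci * RtoC 0)) * RtoC (X - 1))%C 0 1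
    = (CInt (fun s => log_wave n (RtoC (1 + s * (X - 1)) + Ci * RtoC Y) * RtoC (X - 1)) 0 1
       - CInt (fun s => log_wave n (RtoC (1 + s * (X - 1))) * RtoC (X - 1)) 0 1)%C).
  { transitivity (CInt (fun s => log_wave n (RtoC (1 + s * (X - 1)) + Ci * RtoC Y) * RtoC (X - 1)
      + - (1) * (log_wave n (RtoC (1 + s * (X - 1)) + Ci * RtoC 0) * RtoC (X - 1)))%C 0 1).
    - apply CInt_ext; [lra|]. intros s Hs. ring.
    - rewrite CInt_plus; [|lra|apply Cf|intros s Hs; apply ccont_mult; [apply ccont_const|now apply Cf]].
      rewrite CInt_cmult; [|lra|apply Cf].
      rewrite (CInt_ext (fun s => log_wave n (RtoC (1 + s * (X - 1)) + Ci * RtoC 0) * RtoC (X - 1))%C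
        (fun s => log_wave n (RtoC (1 + s * (X - 1))) * RtoC (X - 1))%C).
      + ring.
      + lra.
      + intros s Hs. do 2 f_equal. ring. }
  rewrite E in S.
  transitivity (ray_int n 1 Y + (ray_int n (RtoC X) Y - ray_int n 1 Y))%C; [ring|].
  rewrite S. ring.
Qed.
End Segment.

(** * Comparison of the integral formula with the spiral integral *)

Lemma limit_bound (a : nat -> R) (l s B K : R) :
  is_lim_seq a l -> (forall j, Rabs (a j - s) <= B + K * exp (- INR j)) -> Rabs (l - s) <= B.
Proof.
  intros L H.
  assert (L1 : is_lim_seq (fun j => Rabs (a j - s)) (Rabs (l - s))).
  { apply (is_lim_seq_abs (fun j => a j - s) (l - s)).
    apply is_lim_seq_minus'; [exact L|apply is_lim_seq_const]. }
  assert (L2 : is_lim_seq (fun j => B + K * exp (- INR j)) (B + K * 0)).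
  { apply is_lim_seq_plus'; [apply is_lim_seq_const|]. apply (is_lim_seq_scal_l _ K 0).
    apply (is_lim_comp_seq exp (fun j => - INR j) m_infty 0 is_lim_exp_m).
    - now exists O. - apply is_lim_seq_opp with (l := p_infty). apply is_lim_seq_INR. }
  pose proof (is_lim_seq_le _ _ _ _ H L1 L2) as Q. simpl in Q. lra.
Qed.

(** On the line Re z = alpha + 1/2 the oscillating factor e^(2 pi i z) is a constant
    phase times e^(-2 pi y). *)
Lemma log_wave_on_line (alpha : R) n y : 0 < alpha ->
  let X := alpha + 1 / 2 in let z := (RtoC X + Ci * RtoC y)%C in
  Re (Cexp (- (2 * PI) * Ci * RtoC alpha) * (Ci * log_wave n z))%C =
  Im (Clog z ^ n * / z)%C * exp (- (2 * PI * y)).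
Proof.
  intros Ha X z. unfold log_wave.
  assert (E : (Cexp (- (2 * PI) * Ci * RtoC alpha) * Cexp (2 * PI * Ci * z))%C = RtoC (- exp (- (2 * PI * y)))).
  { rewrite <- Cexp_plus.
    replace (- (2 * PI) * Ci * RtoC alpha + 2 * PI * Ci * z)%C with (- (2 * PI * y), PI).
    - unfold Cexp. cbn [Re Im fst snd]. rewrite cos_PI, sin_PI. apply Ceq; simpl; ring.
    - unfold z, X. apply Ceq; simpl; field. }
  replace (Cexp (- (2 * PI) * Ci * RtoC alpha) * (Ci * (Clog z ^ n * / z * Cexp (2 * PI * Ci * z))))%C
    with (Ci * (Clog z ^ n * / z) * (Cexp (- (2 * PI) * Ci * RtoC alpha) * Cexp (2 * PI * Ci * z)))%C by ring.
  rewrite E. set (w := (Clog z ^ n * / z)%C). destruct w. simpl. ring.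
Qed.

Lemma Cmod_Cexp_i (x : R) : Cmod (Cexp (- (2 * PI) * Ci * RtoC x)) = 1.
Proof.
  rewrite Cmod_Cexp. rewrite <- exp_0. f_equal. simpl. ring.
Qed.

Lemma exp_ge1 a : 0 <= a -> 1 <= exp a.
Proof. intros H. pose proof (exp_ineq1_le a). lra. Qed.

Lemma logpow_cont_gen n X (HX : 1 / 2 <= X <= 3 / 2) y :
  continuous (fun y => Cmod (Clog (RtoC X + Ci * RtoC y)) ^ n * exp (- (4 * PI * y))) y.
Proof.
  apply (continuous_mult (fun y => Cmod (Clog (RtoC X + Ci * RtoC y)) ^ n) (fun y => exp (- (4 * PI * y)))).
  - apply (continuous_Rcomp (fun y => Cmod (Clog (RtoC X + Ci * RtoC y))) (fun s => s ^ n)); [|auto_derive; exact I].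
    destruct (zlog_cont X HX y) as [A B].
    assert (S : continuous (fun y => Re (Clog (RtoC X + Ci * RtoC y)) ^ 2 + Im (Clog (RtoC X + Ci * RtoC y)) ^ 2) y).
    { apply @continuous_plus; [apply (continuous_Rcomp _ (fun s => s ^ 2) _ A)
       |apply (continuous_Rcomp _ (fun s => s ^ 2) _ B)]; auto_derive; exact I. }
    exact (continuous_comp _ sqrt y S (continuous_sqrt _)).
  - apply (ex_derive_continuous (V := R_NormedModule)). auto_derive. exact I.
Qed.

Section ContourBound.
Variables (n : nat) (t : C) (alpha delta B1 B2 : R).
Let X := alpha + 1 / 2.
Hypothesis Ha : 0 < alpha <= 1.
Hypothesis Hu : 0 <= Re t.
Hypothesis Hv : 0 < Im t < PI / 2.
Hypothesis Hd : 0 < delta.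
Hypothesis Hd2 : Im t * (1 + delta) < PI / 2.
Hypothesis Hw : (t * Cexp t = INR n * Ci / (2 * PI))%C.
Hypothesis Ht : t <> RtoC 0.
Hypothesis HB1 : forall Y, 0 <= Y -> Cmod (ray_int n (spiral t delta) Y) <= B1.
Hypothesis HB2 : forall Y, 0 <= Y ->
  RInt (fun y => Cmod (Clog (RtoC X + Ci * RtoC y)) ^ n * exp (- (4 * PI * y))) 0 Y <= B2.

Let z (y : R) : C := (RtoC X + Ci * RtoC y)%C.
Let g (y : R) : R := Im (Clog (z y) ^ n * / z y)%C * fermi y.
Let E : C := Cexp (- (2 * PI) * Ci * RtoC alpha)%C.

Lemma X_range : 1 / 2 <= X <= 3 / 2.
Proof. unfold X. lra. Qed.

(** The Fermi factor differs from e^(-2 pi y) by at most e^(-4 pi y), and |1/z| <= 2 on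
    the line. *)
Lemma kernel_error Y : 0 <= Y ->
  Rabs (RInt g 0 Y - Re (E * ray_int n (RtoC X) Y)%C) <= 2 * B2.
Proof.
  intros HY. unfold ray_int.
  assert (Cv : forall y, 0 <= y <= Y -> ccont (fun y => Ci * log_wave n (RtoC X + Ci * RtoC y))%C y).
  { intros y _. apply ray_int_cont. simpl. pose proof X_range. lra. }
  rewrite <- CInt_cmult by assumption.
  change (Re (CInt (fun y => (E * (Ci * log_wave n (RtoC X + Ci * RtoC y)))%C) 0 Y)) with
    (RInt (fun y => Re (E * (Ci * log_wave n (RtoC X + Ci * RtoC y)))%C) 0 Y).
  assert (E1 : ex_RInt g 0 Y) by (apply ex_RInt_cont; [exact HY|]; intros; apply (gn_cont X X_range)).
  assert (E2 : ex_RInt (fun y => Re (E * (Ci * log_wave n (RtoC X + Ci * RtoC y)))%C) 0 Y).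
  { apply (ccont_ex_Re (fun y => (E * (Ci * log_wave n (RtoC X + Ci * RtoC y)))%C)); [exact HY|].
    intros y Hy. apply ccont_mult; [apply ccont_const|now apply Cv]. }
  pose proof (RInt_minus (V := R_CompleteNormedModule) _ _ 0 Y E1 E2) as M.
  change (RInt (fun y => g y - Re (E * (Ci * log_wave n (RtoC X + Ci * RtoC y)))%C) 0 Y =
    RInt g 0 Y - RInt (fun y => Re (E * (Ci * log_wave n (RtoC X + Ci * RtoC y)))%C) 0 Y) in M.
  rewrite <- M.
  assert (E3 : ex_RInt (fun y => Cmod (Clog (z y)) ^ n * exp (- (4 * PI * y))) 0 Y).
  { apply ex_RInt_cont; [exact HY|]. intros y _. exact (logpow_cont_gen n X X_range y). }
  apply Rle_trans with (RInt (fun y => 2 * (Cmod (Clog (z y)) ^ n * exp (- (4 * PI * y)))) 0 Y).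
  - apply (norm_RInt_le (V := R_NormedModule)
      (fun y => g y - Re (E * (Ci * log_wave n (RtoC X + Ci * RtoC y)))%C)
      (fun y => 2 * (Cmod (Clog (z y)) ^ n * exp (- (4 * PI * y)))) 0 Y).
    + exact HY.
    + intros y Hy. unfold E, X. rewrite (log_wave_on_line alpha n y (proj1 Ha)). fold X. fold (z y). unfold g.
      set (w := (Clog (z y) ^ n * / z y)%C).
      assert (Hw' : Cmod w <= 2 * Cmod (Clog (z y)) ^ n).
      { unfold w. rewrite Cmod_mult, Cmod_pow.
        pose proof (line_inv X y (proj1 X_range)) as I2. fold (z y) in I2.
        pose proof (pow_le _ n (Cmod_ge_0 (Clog (z y)))). nra. }
      change (Rabs (Im w * fermi y - Im w * exp (- (2 * PI * y))) <= 2 * (Cmod (Clog (z y)) ^ n * exp (- (4 * PI * y)))).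
      rewrite <- Rmult_minus_distr_l, Rabs_mult, <- Rmult_assoc.
      apply Rmult_le_compat; try apply Rabs_pos.
      * eapply Rle_trans; [apply Im_le_Cmod|exact Hw'].
      * pose proof (fermi_le y). pose proof (fermi_ge y). pose proof (exp_pos (- (4 * PI * y))).
        apply Rabs_le. lra.
    + apply (RInt_correct (V := R_CompleteNormedModule)).
      exact (ex_RInt_minus (V := R_NormedModule) _ _ 0 Y E1 E2).
    + apply (RInt_correct (V := R_CompleteNormedModule)).
      exact (ex_RInt_scal (V := R_NormedModule) _ 0 Y 2 E3).
  - pose proof (RInt_scal (V := R_CompleteNormedModule) _ 0 Y 2 E3) as S.
    change (RInt (fun y => 2 * (Cmod (Clog (z y)) ^ n * exp (- (4 * PI * y)))) 0 Y =
      2 * RInt (fun y => Cmod (Clog (z y)) ^ n * exp (- (4 * PI * y))) 0 Y) in S.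
    rewrite S. apply Rmult_le_compat_l; [lra|]. exact (HB2 Y HY).
Qed.

Lemma ln_half_abs s : 1 / 2 <= s <= 3 / 2 -> Rabs (ln s) <= 1.
Proof.
  intros Hs. apply Rabs_le. split.
  - apply Rle_trans with (ln (1 / 2)); [|apply ln_le_mono; lra].
    replace (1 / 2) with (/ 2) by field. rewrite ln_Rinv by lra. pose proof ln_lt_2.
    assert (ln 2 <= 1); [|lra]. rewrite <- (ln_exp 1). apply ln_le_mono; [lra|].
    pose proof (exp_ineq1_le 1). lra.
  - rewrite <- (ln_exp 1). apply ln_le_mono; [lra|]. pose proof (exp_ineq1_le 1). lra.
Qed.

Lemma seg_cont y s : 0 <= s <= 1 ->
  ccont (fun s => log_wave n (RtoC (1 + s * (X - 1)) + Ci * RtoC y) * RtoC (X - 1))%C s.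
Proof.
  intros Hs. pose proof X_range. apply ccont_mult; [|apply ccont_const].
  apply (ccont_comp (log_wave n) (fun s : R => (RtoC (1 + s * (X - 1)) + Ci * RtoC y)%C)).
  - refine (proj2 (proj2 (log_wave_hol n _ _))). rewrite line_Re. nra.
  - apply ccont_plus; [|apply ccont_const]. apply ccont_RtoC.
    apply (ex_derive_continuous (V := R_NormedModule)). auto_derive. exact I.
Qed.

Lemma seg_bound :
  Cmod (CInt (fun s => log_wave n (RtoC (1 + s * (X - 1))) * RtoC (X - 1))%C 0 1) <= 1.
Proof.
  pose proof X_range as XR. apply Rle_trans with (1 * (1 - 0)); [|lra].
  apply CInt_norm_const; [lra| |].
  - intros s Hs. eapply ccont_ext; [|exact (seg_cont 0 s Hs)].
    intros y. now rewrite Cmult_0_r, Cplus_0_r.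
  - intros s Hs. rewrite Cmod_mult, Cmod_R.
    assert (R0 : 1 / 2 <= 1 + s * (X - 1) <= 3 / 2) by nra.
    rewrite log_wave_mod by (simpl; lra). rewrite Clog_RtoC by lra. rewrite !Cmod_R.
    replace (Im (RtoC (1 + s * (X - 1)))) with 0 by reflexivity.
    rewrite Rmult_0_r, Ropp_0, exp_0, (Rabs_pos_eq (1 + s * (X - 1))) by lra.
    assert (P1 : Rabs (ln (1 + s * (X - 1))) ^ n <= 1).
    { apply Rle_trans with (1 ^ n); [|rewrite pow1; lra].
      apply pow_incr. split; [apply Rabs_pos|now apply ln_half_abs]. }
    assert (P2 : / (1 + s * (X - 1)) <= 2).
    { replace 2 with (/ (1/2)) by field. apply Rinv_le_contravar; lra. }
    assert (P3 : Rabs (X - 1) <= 1 / 2) by (apply Rabs_le; lra).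
    pose proof (pow_le _ n (Rabs_pos (ln (1 + s * (X - 1))))).
    assert (0 < / (1 + s * (X - 1))) by (apply Rinv_0_lt_compat; lra).
    pose proof (Rabs_pos (X - 1)).
    assert (Rabs (ln (1 + s * (X - 1))) ^ n * / (1 + s * (X - 1)) <= 1 * 2) by (apply Rmult_le_compat; lra).
    assert (0 <= Rabs (ln (1 + s * (X - 1))) ^ n * / (1 + s * (X - 1))) by nra.
    nra.
Qed.

Lemma seg_top : exists K, forall Y, 0 <= Y ->
  Cmod (CInt (fun s => log_wave n (RtoC (1 + s * (X - 1)) + Ci * RtoC Y) * RtoC (X - 1))%C 0 1) <= K * exp (- Y).
Proof.
  pose proof X_range as XR.
  exists (INR (fact n) * exp 2 * (2 + / (1/2)) * / (1/2) * exp (2 * PI * 2) * 1).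
  intros Y HY.
  match goal with |- _ <= ?b => apply Rle_trans with (b * (1 - 0)); [|lra] end.
  apply CInt_norm_const; [lra|apply seg_cont|].
  intros s Hs. rewrite Cmod_mult, Cmod_R.
  assert (R0 : 1 / 2 <= 1 + s * (X - 1) <= 3 / 2) by nra.
  set (K := INR (fact n) * exp 2 * (2 + / (1/2)) * / (1/2) * exp (2 * PI * 2)).
  replace (K * 1 * exp (- Y)) with (K * exp (- Y) * 1) by ring.
  apply Rmult_le_compat; [apply Cmod_ge_0|apply Rabs_pos| |apply Rabs_le; lra].
  apply (log_wave_top n (1/2) 2); simpl; try lra. rewrite Cmod_R, Rabs_pos_eq; lra.
Qed.

Lemma spiral_top : exists K, forall Y, 0 <= Y ->
  Cmod (CInt (fun s => log_wave n (spiral t s + Ci * RtoC Y) * (t * spiral t s))%C (-1) delta) <= K * exp (- Y).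
Proof.
  set (c := cos (Im t * (1 + delta))).
  assert (Hc : 0 < c <= 1).
  { split; [apply cos_gt_0; nra|apply COS_bound]. }
  set (R := exp (Re t * (1 + delta))).
  assert (HR : 1 <= R) by (apply exp_ge1; nra).
  set (K := INR (fact n) * exp 2 * (R + / c) * / c * exp (2 * PI * R)).
  exists (K * (Cmod t * R) * (delta - -1)). intros Y HY.
  replace (K * (Cmod t * R) * (delta - -1) * exp (- Y)) with
    ((K * exp (- Y)) * (Cmod t * R) * (delta - -1)) by ring.
  assert (Hm : forall s, -1 <= s <= delta -> Cmod (spiral t s) <= R).
  { intros s Hs. unfold spiral. rewrite Cmod_Cexp. apply exp_le.
    rewrite Re_mult_RtoC. nra. }
  assert (Hr : forall s, -1 <= s <= delta -> c <= Re (spiral t s)).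
  { intros s Hs. unfold spiral, Cexp. cbn [Re fst].
    rewrite spiral_arg.
    rewrite Re_mult_RtoC.
    assert (1 <= exp (Re t * (1 + s))) by (apply exp_ge1; nra).
    assert (c <= cos (Im t * (1 + s))).
    { apply cos_decr_1; nra. }
    nra. }
  apply CInt_norm_const; [lra| |].
  - intros s Hs. apply ccont_mult.
    + apply (ccont_comp (log_wave n) (fun s : Rdefinitions.R => (spiral t s + Ci * RtoC Y)%C)).
      * refine (proj2 (proj2 (log_wave_hol n _ _))). rewrite vline_Re. specialize (Hr s Hs). lra.
      * apply ccont_plus; [exact (cderive_cont _ _ _ (spiral_der t s))|apply ccont_const].
    + apply ccont_mult; [apply ccont_const|exact (cderive_cont _ _ _ (spiral_der t s))].
  - intros s Hs. rewrite !Cmod_mult.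
    apply Rmult_le_compat; [apply Cmod_ge_0|apply Rmult_le_pos; apply Cmod_ge_0| |].
    + apply log_wave_top; auto.
      pose proof (Im_le_Cmod (spiral t s)) as IM. apply Rabs_le_between in IM.
      specialize (Hm s Hs). lra.
    + apply Rmult_le_compat_l; [apply Cmod_ge_0|auto].
Qed.

(** The first harmonic is carried to the spiral; what remains is the ray from the end of
    the spiral (B1), the second harmonic (B2), the bounded segment, and the edges at
    height Y, which vanish as Y grows. *)
Lemma contour_bound :
  Rabs (2 * log_moment X n - 2 * Re (E * spiral_int n t delta)%C) <= 2 * B1 + 4 * B2 + 2.
Proof.
  destruct seg_top as [K1 HK1]. destruct spiral_top as [K2 HK2].
  pose proof X_range as XR.
  assert (Lg : is_lim_seq (fun j => RInt g 0 (INR j)) (log_moment X n)).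
  { apply (half_line_int_lim g (INR (fact n) * (4 * exp 2))).
    - intros y _. apply (gn_cont X XR).
    - intros y Hy. apply (gn_bound X XR n y Hy). }
  apply (limit_bound (fun j => 2 * RInt g 0 (INR j)) _ _ _ (2 * (K1 + K2))).
  { apply (is_lim_seq_scal_l _ 2 (log_moment X n)), Lg. }
  intros j. set (Y := INR j). assert (HY : 0 <= Y) by apply pos_INR.
  pose proof (kernel_error Y HY) as KE.
  pose proof (sweep_segment n alpha Ha Y HY) as S1. fold X in S1.
  pose proof (sweep_spiral n t delta Hv Hd Hd2 Hw Ht Y HY) as S2.
  rewrite S2 in S1. clear S2.
  specialize (HK1 Y HY). specialize (HK2 Y HY). specialize (HB1 Y HY). pose proof seg_bound as SB.
  set (a1 := CInt _ (-1) delta) in *. set (a2 := CInt _ 0 1) in S1, HK1. set (a3 := CInt _ 0 1) in S1, SB.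
  set (V := ray_int n (spiral t delta) Y) in *. set (S := spiral_int n t delta) in *.
  assert (D : Rabs (Re (E * ray_int n (RtoC X) Y)%C - Re (E * S)%C) <= B1 + 1 + (K1 + K2) * exp (- Y)).
  { change (Rabs (Re (E * ray_int n (RtoC X) Y - E * S)%C) <= B1 + 1 + (K1 + K2) * exp (- Y)).
    eapply Rle_trans; [apply re_le_Cmod|]. rewrite S1.
    replace (E * (S + V - a1 + a2 - a3) - E * S)%C with (E * (V + (- a1 + (a2 + - a3))))%C by ring.
    rewrite Cmod_mult. unfold E. rewrite Cmod_Cexp_i, Rmult_1_l.
    pose proof (Cmod_triangle V (- a1 + (a2 + - a3))%C).
    pose proof (Cmod_triangle (- a1) (a2 + - a3)%C).
    pose proof (Cmod_triangle a2 (- a3)%C). rewrite !Cmod_opp in *. lra. }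
  apply Rabs_le_between in KE. apply Rabs_le_between in D. apply Rabs_le. lra.
Qed.
End ContourBound.

(** * Decay away from the saddle point *)

Lemma exp_mult_nat n x : exp (INR n * x) = exp x ^ n.
Proof.
  induction n as [|n IH].
  - simpl. rewrite Rmult_0_l. apply exp_0.
  - rewrite S_INR, Rmult_plus_distr_r, exp_plus, IH, Rmult_1_l. simpl. ring.
Qed.

Lemma pow_le_exp n a x : 0 <= a -> a <= exp x -> a ^ n <= exp (INR n * x).
Proof. intros H1 H2. rewrite exp_mult_nat. now apply pow_incr. Qed.

(** The tangent line of the exponential, written for powers: l / T <= e^((l-T)/T). *)
Lemma pow_tangent n l T : 0 <= l -> 0 < T -> l ^ n <= T ^ n * exp (INR n * ((l - T) / T)).
Proof.
  intros Hl HT. rewrite exp_mult_nat, <- Rpow_mult_distr. apply pow_incr. split; [exact Hl|].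
  apply Rle_trans with (T * (1 + (l - T) / T)).
  - right. field. lra.
  - apply Rmult_le_compat_l; [lra|apply exp_ineq1_le].
Qed.

Section Saddle.
Variables (n : nat) (t : C).
Hypothesis Hu : 8 <= Re t.
Hypothesis Hv : 0 < Im t < PI / 2.
Hypothesis Hw : (t * Cexp t = INR n * Ci / (2 * PI))%C.

Let u := Re t.
Let v := Im t.

Lemma saddle_T_ge : Re t <= Cmod t.
Proof. apply Re_le_Cmod. Qed.

Lemma saddle_neq0 : t <> RtoC 0.
Proof. intros K. rewrite K in Hu. simpl in Hu. lra. Qed.

Lemma saddle_mod : Cmod t * exp (Re t) = INR n / (2 * PI).
Proof.
  pose proof PI_RGT_0. pose proof (pos_INR n).
  pose proof (f_equal Cmod Hw) as E. rewrite Cmod_mult, Cmod_Cexp in E. rewrite E.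
  rewrite Cmod_div.
  - rewrite !Cmod_mult, Cmod_Ci, !Cmod_R, !Rabs_pos_eq by lra. field. lra.
  - rewrite <- RtoC_mult. intros K. apply RtoC_inj in K. lra.
Qed.

(** The modulus of the integrand at the saddle point, up to the factor t. *)
Definition saddle_mag : R := Cmod (t ^ n * Cexp (- (RtoC (INR n) / t)))%C.

Lemma saddle_Re_inv : 0 <= Re (/ t)%C <= / Cmod t.
Proof.
  split.
  - destruct t as [a b]; simpl in *. apply Rmult_le_pos; [lra|].
    left. apply Rinv_0_lt_compat. nra.
  - rewrite <- Cmod_inv by apply saddle_neq0. apply Re_le_Cmod.
Qed.

Lemma Re_n_div : Re (RtoC (INR n) / t)%C = INR n * Re (/ t)%C.
Proof. unfold Cdiv. destruct (/ t)%C. simpl. ring. Qed.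

Lemma saddle_mag_ge : Cmod t ^ n * exp (- (INR n / Cmod t)) <= saddle_mag.
Proof.
  unfold saddle_mag. rewrite Cmod_mult, Cmod_pow, Cmod_Cexp.
  apply Rmult_le_compat_l; [apply pow_le, Cmod_ge_0|]. apply exp_le.
  change (Re (- (RtoC (INR n) / t))%C) with (- Re (RtoC (INR n) / t)%C).
  rewrite Re_n_div. apply Ropp_le_contravar. unfold Rdiv.
  apply Rmult_le_compat_l; [apply pos_INR|]. apply saddle_Re_inv.
Qed.

Let m (s : R) : R := Re ((Cexp (t * RtoC s) - 1) / t)%C.

Lemma m_der s : is_derive m s (exp (u * s) * cos (v * s)).
Proof.
  assert (D : cderive (fun s => (Cexp (t * RtoC s) - 1) / t)%C s (Cexp (t * RtoC s))).
  { unfold Cdiv. eapply cderive_eq.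
    - apply cderive_mult; [|apply cderive_const]. apply cderive_minus; [|apply cderive_const].
      apply cderive_exp. apply cderive_cmult. apply cderive_RtoC with (l := 1).
      apply (is_derive_id (K := R_AbsRing)).
    - cbv beta. field. apply saddle_neq0. }
  destruct D as [D _]. refine (is_derive_eq _ _ _ _ D _).
  unfold Cexp. cbn [Re fst]. rewrite Re_mult_RtoC, Im_mult_RtoC. reflexivity.
Qed.

Lemma m_0 : m 0 = 0.
Proof.
  unfold m. rewrite Cmult_0_r, Cexp_0.
  replace ((1 - 1) / t)%C with (RtoC 0) by (field; apply saddle_neq0). reflexivity.
Qed.

(** Bounding 1 + s by e^s replaces the modulus by the exponential of a real function
    that vanishes at 0. *)
Lemma spiral_kernel_mod s : -1 <= s -> Cmod (spiral_kernel n t s) <= exp (INR n * (s - m s)).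
Proof.
  intros Hs. unfold spiral_kernel. rewrite Cmod_mult, Cmod_R, Cmod_Cexp.
  rewrite Rabs_pos_eq by (apply pow_le; lra).
  replace (Re (- (RtoC (INR n) / t) * (Cexp (t * RtoC s) - 1))%C) with (- (INR n * m s)).
  - replace (INR n * (s - m s)) with (INR n * s + - (INR n * m s)) by ring. rewrite exp_plus.
    apply Rmult_le_compat_r; [left; apply exp_pos|]. apply pow_le_exp; [lra|]. apply exp_ineq1_le.
  - unfold m. replace (- (RtoC (INR n) / t) * (Cexp (t * RtoC s) - 1))%C with
      (RtoC (- INR n) * ((Cexp (t * RtoC s) - 1) / t))%C
      by (rewrite RtoC_opp; field; apply saddle_neq0).
    set (w := ((Cexp (t * RtoC s) - 1) / t)%C). destruct w. simpl. ring.
Qed.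

Variable delta : R.
Hypothesis Hd : 0 < delta <= 1 / 8.
Hypothesis Hud : Re t * delta <= 1.

Lemma exp_opp_le x : 0 <= x <= 1 -> exp (- x) <= 1 - x / 2.
Proof.
  intros H. rewrite exp_Ropp. pose proof (exp_ineq1_le x).
  apply Rle_trans with (/ (1 + x)); [apply Rinv_le_contravar; lra|].
  apply Rmult_le_reg_l with (1 + x); [lra|]. rewrite Rinv_r by lra. nra.
Qed.

(** The derivative of s - m s is 1 - e^(us) cos (vs). For s < 0 it is nonnegative, so
    the maximum over the interval is at -delta; and between -delta and 0 it is at least
    - u s / 2, by e^(-x) <= 1 - x/2 on the unit interval. *)
Lemma dexp_left s : -1 <= s <= - delta -> s - m s <= - u * delta ^ 2 / 4.
Proof.
  intros Hs.
  assert (A1 : s - m s <= - delta - m (- delta)).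
  { apply (incr_of_derive (fun s => s - m s) (fun s => 1 - exp (u * s) * cos (v * s))); [lra| |].
    - intros x _. apply (is_derive_minus (V := R_NormedModule) (fun s => s) m);
        [apply (is_derive_id (K := R_AbsRing))|apply m_der].
    - intros x Hx. pose proof (exp_pos (u * x)). pose proof (COS_bound (v * x)).
      assert (exp (u * x) <= 1) by (rewrite <- exp_0; apply exp_le; unfold u; nra). nra. }
  assert (A2 : - delta - m (- delta) + u * (- delta) ^ 2 / 4 <= 0 - m 0 + u * 0 ^ 2 / 4).
  { apply (incr_of_derive (fun s => s - m s + u * s ^ 2 / 4)
      (fun s => 1 - exp (u * s) * cos (v * s) + u * s / 2)); [lra| |].
    - intros x _. apply (is_derive_plus (V := R_NormedModule) (fun s => s - m s) (fun s => u * s ^ 2 / 4)).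
      + apply (is_derive_minus (V := R_NormedModule) (fun s => s) m);
        [apply (is_derive_id (K := R_AbsRing))|apply m_der].
      + auto_derive; [exact I|field].
    - intros x Hx. pose proof (exp_pos (u * x)). pose proof (COS_bound (v * x)).
      pose proof (exp_opp_le (- (u * x))) as Q. rewrite Ropp_involutive in Q.
      assert (0 <= - (u * x) <= 1) by (unfold u in *; nra). specialize (Q H1). nra. }
  rewrite m_0 in A2. nra.
Qed.

Lemma cos_ge_quad x : 0 <= x -> 1 - x ^ 2 / 2 <= cos x.
Proof.
  intros Hx.
  assert (S : forall y, 0 <= y -> sin y <= y).
  { intros y Hy. assert (0 - sin 0 <= y - sin y).
    { apply (incr_of_derive (fun y => y - sin y) (fun y => 1 - cos y)); [exact Hy| |].
      - intros z _. auto_derive; [exact I|ring].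
      - intros z _. pose proof (COS_bound z). lra. }
    rewrite sin_0 in H. lra. }
  assert (cos 0 + 0 ^ 2 / 2 <= cos x + x ^ 2 / 2).
  { apply (incr_of_derive (fun y => cos y + y ^ 2 / 2) (fun y => y - sin y)); [exact Hx| |].
    - intros z _. auto_derive; [exact I|field].
    - intros z Hz. pose proof (S z (proj1 Hz)). lra. }
  rewrite cos_0 in H. lra.
Qed.

(** Here cos (vs) < 1 works against the growth of e^(us), but u >= 8 leaves room: e^(us)
    cos (vs) >= (1 + us) (1 - 2 s^2) >= 1 + us/2. *)
Lemma dexp_right : delta - m delta <= - u * delta ^ 2 / 4.
Proof.
  assert (A : - (0 - m 0 + u * 0 ^ 2 / 4) <= - (delta - m delta + u * delta ^ 2 / 4)).
  { apply (incr_of_derive (fun s => - (s - m s + u * s ^ 2 / 4))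
      (fun s => - (1 - exp (u * s) * cos (v * s) + u * s / 2))); [lra| |].
    - intros x _. apply (is_derive_opp (V := R_NormedModule) (fun s => s - m s + u * s ^ 2 / 4)).
      apply (is_derive_plus (V := R_NormedModule) (fun s => s - m s) (fun s => u * s ^ 2 / 4)).
      + apply (is_derive_minus (V := R_NormedModule) (fun s => s) m);
        [apply (is_derive_id (K := R_AbsRing))|apply m_der].
      + auto_derive; [exact I|field].
    - intros x Hx. pose proof (exp_ineq1_le (u * x)) as E1.
      pose proof PI_4.
      assert (Hvx : 0 <= v * x) by (unfold v; nra).
      pose proof (cos_ge_quad (v * x) Hvx) as E2.
      assert (E3 : 1 - 2 * x ^ 2 <= cos (v * x)).
      { assert (v ^ 2 <= 4) by (unfold v; nra). assert (0 <= x ^ 2) by nra. nra. }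
      assert (E4 : 0 <= 1 - 2 * x ^ 2) by nra.
      assert (E5 : (1 + u * x) * (1 - 2 * x ^ 2) <= exp (u * x) * cos (v * x)).
      { apply Rmult_le_compat; try lra. unfold u; nra. }
      assert (U8 : 8 <= u) by exact Hu.
      assert (x ^ 2 <= 1 / 64) by nra.
      assert (0 <= x * (u / 2 - 2 * x - 2 * u * x ^ 2)); [|nra].
      apply Rmult_le_pos; [lra|]. nra. }
  rewrite m_0 in A. lra.
Qed.

Let tail := exp (- (INR n * u * delta ^ 2 / 4)).

Lemma spiral_kernel_left s : -1 <= s <= - delta -> Cmod (spiral_kernel n t s) <= tail.
Proof.
  intros Hs. eapply Rle_trans; [apply spiral_kernel_mod; lra|]. apply exp_le.
  pose proof (dexp_left s Hs). pose proof (pos_INR n). nra.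
Qed.

Lemma spiral_kernel_right : Cmod (spiral_kernel n t delta) <= tail.
Proof.
  eapply Rle_trans; [apply spiral_kernel_mod; lra|]. apply exp_le.
  pose proof dexp_right. pose proof (pos_INR n). nra.
Qed.

Hypothesis Hd2 : Im t * (1 + delta) < PI / 2.

(** Going up from the end point w of the spiral, |Log z| grows by at most y / |w|, so
    its n-th power gains at most n y / (|w| |Log w|), which by the saddle point equation
    is at most 2 pi y / (1 + delta): it loses against e^(-2 pi y) by the factor
    e^(-delta y). *)
Lemma ray_bound Y : 0 <= Y -> Cmod (ray_int n (spiral t delta) Y) <= saddle_mag * tail / delta.
Proof.
  intros HY. pose proof PI_RGT_0 as P0. pose proof PI2_3_2 as P3.
  assert (Tpos : 8 <= Cmod t) by (pose proof saddle_T_ge; lra).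
  set (w := spiral t delta).
  assert (Rw : 0 < Re w) by (apply (spiral_Re_pos t Hv); lra).
  assert (Iw : 0 <= Im w).
  { unfold w, spiral, Cexp. cbn [Im snd]. rewrite Im_mult_RtoC.
    apply Rmult_le_pos; [left; apply exp_pos|]. apply sin_ge_0; nra. }
  assert (Mw : Cmod w = exp (Re t * (1 + delta))) by (unfold w, spiral; now rewrite Cmod_Cexp, Re_mult_RtoC).
  assert (Lw : Clog w = (t * RtoC (1 + delta))%C).
  { unfold w, spiral. apply Clog_Cexp. rewrite Im_mult_RtoC. apply Rabs_def1; nra. }
  assert (W1 : 1 <= Cmod w) by (rewrite Mw; apply exp_ge1; nra).
  assert (ML : Cmod (Clog w) = Cmod t * (1 + delta)) by (rewrite Lw, Cmod_mult, Cmod_R, Rabs_pos_eq; lra).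
  assert (F0 : Cmod (log_wave n w) <= saddle_mag * tail).
  { pose proof (spiral_integrand n t delta Hv ltac:(lra) Hd2 Hw saddle_neq0 delta ltac:(lra) Hd2) as SI.
    fold w in SI. apply (f_equal Cmod) in SI.
    rewrite Cpow_S in SI.
    replace (t * t ^ n * Cexp (- (INR n / t)) * spiral_kernel n t delta)%C with
      (t * ((t ^ n * Cexp (- (INR n / t))) * spiral_kernel n t delta))%C in SI by ring.
    rewrite !(Cmod_mult t), (Cmod_mult _ (spiral_kernel n t delta)), (Cmod_mult (log_wave n w)), (Cmod_mult t) in SI.
    fold saddle_mag in SI.
    assert (SI' : Cmod (log_wave n w) * Cmod w = saddle_mag * Cmod (spiral_kernel n t delta)).
    { apply Rmult_eq_reg_l with (Cmod t); [|lra]. lra. }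
    pose proof spiral_kernel_right as K. pose proof (Cmod_ge_0 (log_wave n w)).
    assert (0 <= saddle_mag) by apply Cmod_ge_0.
    apply Rle_trans with (Cmod (log_wave n w) * Cmod w); [nra|]. rewrite SI'. nra. }
  assert (Dec : forall y, 0 <= y -> Cmod (Ci * log_wave n (w + Ci * RtoC y))%C <= saddle_mag * tail * exp (- (delta * y))).
  { intros y Hy. rewrite Cmod_mult, Cmod_Ci, Rmult_1_l.
    assert (Mz : forall r, 0 <= r <= 1 -> Cmod w <= Cmod (w + Ci * RtoC (r * y))%C).
    { intros r Hr. apply Rsqr_incr_0_var; [|apply Cmod_ge_0].
      rewrite !Rsqr_pow2, !Cmod2_alt, vline_Re, vline_Im. assert (0 <= r * y) by nra. nra. }
    assert (ML' : Cmod (Clog (w + Ci * RtoC y)%C) <= Cmod (Clog w) + y / Cmod w).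
    { replace (Clog (w + Ci * RtoC y)%C) with (Clog w + (Clog (w + Ci * RtoC y)%C - Clog w))%C by ring.
      eapply Rle_trans; [apply Cmod_triangle|]. apply Rplus_le_compat_l.
      replace (y / Cmod w) with (/ Cmod w * Cmod (w + Ci * RtoC y - w)%C).
      - apply (hol_mvt Clog (fun z => / z)%C). intros r Hr.
        replace (w + RtoC r * (w + Ci * RtoC y - w))%C with (w + Ci * RtoC (r * y))%C
          by (rewrite RtoC_mult; ring).
        assert (Rp : 0 < Re (w + Ci * RtoC (r * y))%C) by (rewrite vline_Re; exact Rw).
        split; [now apply hol_log|]. split; [apply ccont2_inv; now apply Cmod_sqr_pos|].
        rewrite Cmod_inv by now apply Cmod_sqr_pos. apply Rinv_le_contravar; [lra|now apply Mz].
      - replace (w + Ci * RtoC y - w)%C with (Ci * RtoC y)%C by ring.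
        rewrite Cmod_mult, Cmod_Ci, Cmod_R, Rabs_pos_eq by lra. field. lra. }
    rewrite log_wave_mod by (rewrite vline_Re; exact Rw). rewrite vline_Im.
    rewrite log_wave_mod in F0 by exact Rw.
    assert (PT : Cmod (Clog (w + Ci * RtoC y)%C) ^ n <= Cmod (Clog w) ^ n * exp (INR n * (y / Cmod w / Cmod (Clog w)))).
    { eapply Rle_trans; [apply (pow_tangent n _ (Cmod (Clog w))); [apply Cmod_ge_0|rewrite ML; nra]|].
      apply Rmult_le_compat_l; [apply pow_le, Cmod_ge_0|]. apply exp_le.
      apply Rmult_le_compat_l; [apply pos_INR|]. unfold Rdiv at 1 2.
      apply Rmult_le_compat_r; [left; apply Rinv_0_lt_compat; rewrite ML; nra|lra]. }
    assert (IM : / Cmod (w + Ci * RtoC y)%C <= / Cmod w).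
    { apply Rinv_le_contravar; [lra|]. specialize (Mz 1 ltac:(lra)). now rewrite Rmult_1_l in Mz. }
    assert (EX : INR n * (y / Cmod w / Cmod (Clog w)) - 2 * PI * y <= - (delta * y)).
    { assert (NE : INR n = 2 * PI * (Cmod t * exp (Re t))) by (rewrite saddle_mod; field; lra).
      assert (MW : exp (Re t) <= Cmod w) by (rewrite Mw; apply exp_le; nra).
      pose proof (exp_pos (Re t)).
      assert (Q : INR n * (y / Cmod w / Cmod (Clog w)) <= 2 * PI * y / (1 + delta)).
      { rewrite NE, ML.
        replace (2 * PI * (Cmod t * exp (Re t)) * (y / Cmod w / (Cmod t * (1 + delta)))) with
          ((2 * PI * y / (1 + delta)) * (exp (Re t) / Cmod w)) by (field; lra).
        assert (exp (Re t) / Cmod w <= 1).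
        { apply Rmult_le_reg_r with (Cmod w); [lra|]. unfold Rdiv. rewrite Rmult_assoc, Rinv_l by lra. lra. }
        assert (0 <= 2 * PI * y / (1 + delta)).
        { apply Rmult_le_pos; [nra|]. left. apply Rinv_0_lt_compat. lra. }
        nra. }
      assert (Q2 : 2 * PI * y / (1 + delta) <= 2 * PI * y - delta * y); [|lra].
      apply Rmult_le_reg_r with (1 + delta); [lra|]. unfold Rdiv. rewrite Rmult_assoc, Rinv_l by lra.
      assert (0 <= delta * y * (2 * PI - 1 - delta)); [|lra].
      apply Rmult_le_pos; [nra|lra]. }
    pose proof (pow_le _ n (Cmod_ge_0 (Clog w))) as PL.
    assert (IW : 0 < / Cmod w) by (apply Rinv_0_lt_compat; lra).
    assert (0 < / Cmod (w + Ci * RtoC y)%C).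
    { apply Rinv_0_lt_compat. specialize (Mz 1 ltac:(lra)). rewrite Rmult_1_l in Mz. lra. }
    apply Rle_trans with ((Cmod (Clog w) ^ n * exp (INR n * (y / Cmod w / Cmod (Clog w)))) * / Cmod w * exp (- (2 * PI * (Im w + y)))).
    - apply Rmult_le_compat_r; [left; apply exp_pos|].
      apply Rmult_le_compat; try lra. apply pow_le, Cmod_ge_0.
    - apply Rle_trans with ((Cmod (Clog w) ^ n * / Cmod w * exp (- (2 * PI * Im w))) * exp (- (delta * y))).
      + replace (- (2 * PI * (Im w + y))) with (- (2 * PI * Im w) + - (2 * PI * y)) by ring.
        rewrite exp_plus.
        replace (Cmod (Clog w) ^ n * exp (INR n * (y / Cmod w / Cmod (Clog w))) * / Cmod w *
          (exp (- (2 * PI * Im w)) * exp (- (2 * PI * y)))) with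
         ((Cmod (Clog w) ^ n * / Cmod w * exp (- (2 * PI * Im w))) *
           (exp (INR n * (y / Cmod w / Cmod (Clog w))) * exp (- (2 * PI * y)))) by ring.
        apply Rmult_le_compat_l.
        * apply Rmult_le_pos; [nra|left; apply exp_pos].
        * rewrite <- exp_plus. apply exp_le. lra.
      + apply Rmult_le_compat_r; [left; apply exp_pos|exact F0]. }
  assert (MT : 0 <= saddle_mag * tail).
  { apply Rmult_le_pos; [apply Cmod_ge_0|left; apply exp_pos]. }
  pose proof (RInt_exp_opp delta 0 Y ltac:(lra)) as IE.
  pose proof (is_RInt_scal (V := R_NormedModule) _ _ _ (saddle_mag * tail) _ IE) as IE2.
  unfold ray_int. eapply Rle_trans.
  - apply (CInt_norm _ (fun y => saddle_mag * tail * exp (- (delta * y)))); [exact HY| | |].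
    + intros y _. now apply ray_int_cont.
    + intros y Hy. apply Dec. lra.
    + eexists. exact IE2.
  - pose proof (is_RInt_unique _ _ _ _ IE2) as IU.
    change (RInt (fun y => saddle_mag * tail * exp (- (delta * y))) 0 Y =
      saddle_mag * tail * ((exp (- (delta * 0)) - exp (- (delta * Y))) / delta)) in IU.
    rewrite IU. change (saddle_mag * tail * ((exp (- (delta * 0)) - exp (- (delta * Y))) / delta) <= saddle_mag * tail / delta).
    unfold Rdiv. rewrite <- Rmult_assoc. apply Rmult_le_compat_r; [left; apply Rinv_0_lt_compat; lra|].
    rewrite Rmult_0_r, Ropp_0, exp_0. pose proof (exp_pos (- (delta * Y))). nra.
Qed.

Lemma left_tail_bound : Cmod (CInt (spiral_kernel n t) (-1) (- delta)) <= tail.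
Proof.
  eapply Rle_trans; [apply (CInt_norm_const _ tail); [lra| |]|].
  - intros s _. apply spiral_kernel_cont.
  - intros s Hs. now apply spiral_kernel_left.
  - assert (0 < tail) by apply exp_pos. nra.
Qed.
End Saddle.

(** * The second harmonic *)

Lemma ln_le_sub1 x : 0 < x -> ln x <= x - 1.
Proof.
  intros H. pose proof (exp_ineq1_le (ln x)) as E. rewrite exp_ln in E by exact H. lra.
Qed.

Lemma Clog_line_small X y : 1 / 2 <= X <= 3 / 2 -> 0 <= y <= exp 64 ->
  Cmod (Clog (RtoC X + Ci * RtoC y)) <= 70.
Proof.
  intros HX Hy. set (z := (RtoC X + Ci * RtoC y)%C).
  assert (Hz1 : 1 / 2 <= Cmod z).
  { apply Rle_trans with (Re z); [unfold z; rewrite line_Re; lra|apply Re_le_Cmod]. }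
  assert (Hz2 : Cmod z <= 3 / 2 + y).
  { unfold z. eapply Rle_trans; [apply Cmod_triangle|].
    rewrite Cmod_mult, Cmod_Ci, !Cmod_R, !Rabs_pos_eq by lra. lra. }
  eapply Rle_trans; [apply Cmod_Clog_le|]. pose proof PI_4.
  assert (Rabs (ln (Cmod z)) <= 65); [|lra].
  apply Rabs_le. split.
  - assert (ln (/ 2) <= ln (Cmod z)) by (apply ln_le_mono; lra).
    rewrite ln_Rinv in H0 by lra. pose proof (ln_le_sub1 2 ltac:(lra)). lra.
  - rewrite <- (ln_exp 65). apply ln_le_mono; [lra|].
    replace 65 with (1 + 64) by ring. rewrite exp_plus.
    pose proof (exp_ineq1_le 64). pose proof (exp_ineq1_le 1). nra.
Qed.

Lemma Clog_line_large X y : 1 / 2 <= X <= 3 / 2 -> exp 64 <= y ->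
  Cmod (Clog (RtoC X + Ci * RtoC y)) <= ln y + 1 / 16.
Proof.
  intros HX Hy. set (z := (RtoC X + Ci * RtoC y)%C).
  pose proof (exp_ineq1_le 64) as E64.
  assert (Hz1 : y <= Cmod z).
  { refine (Rle_trans _ _ _ _ (Im_le_Cmod z)). unfold z.
    replace (Im (RtoC X + Ci * RtoC y)%C) with y by (simpl; ring). apply Rle_abs. }
  assert (Hz2 : Cmod z <= y + 3 / 2).
  { unfold z. eapply Rle_trans; [apply Cmod_triangle|].
    rewrite Cmod_mult, Cmod_Ci, !Cmod_R, !Rabs_pos_eq by lra. lra. }
  set (a := ln (Cmod z)).
  assert (A1 : 64 <= a) by (unfold a; rewrite <- (ln_exp 64); apply ln_le_mono; lra).
  assert (A2 : a <= ln y + 1 / 32).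
  { assert (ln (Cmod z / y) <= Cmod z / y - 1).
    { apply ln_le_sub1. apply Rdiv_lt_0_compat; lra. }
    unfold Rdiv in H at 1. rewrite ln_mult in H by (try apply Rinv_0_lt_compat; lra).
    rewrite ln_Rinv in H by lra. fold a in H.
    assert (Cmod z / y - 1 <= (3/2) / y).
    { apply Rmult_le_reg_r with y; [lra|]. replace ((Cmod z / y - 1) * y) with (Cmod z - y) by (field; lra).
      replace (3/2 / y * y) with (3/2) by (field; lra). lra. }
    assert (3/2 / y <= 1/32).
    { apply Rmult_le_reg_r with y; [lra|]. replace (3/2 / y * y) with (3/2) by (field; lra). lra. }
    lra. }
  apply Rle_trans with (a + 2 / a).
  - assert (P : 0 < 2 / a) by (apply Rdiv_lt_0_compat; lra).
    apply Rsqr_incr_0_var; [|lra]. rewrite !Rsqr_pow2, Cmod2_alt. unfold Clog. cbn [Re Im fst snd].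
    fold a. pose proof (atan_abs (Im z / Re z)) as AB. apply Rabs_le_between in AB. pose proof PI_4.
    set (b := atan _) in *. assert (b ^ 2 <= 4) by nra.
    replace ((a + 2 / a) ^ 2) with (a ^ 2 + 4 + (2 / a) ^ 2) by (field; lra). nra.
  - assert (2 / a <= 1 / 32); [|lra].
    apply Rmult_le_reg_r with a; [lra|]. replace (2 / a * a) with 2 by (field; lra). lra.
Qed.

Lemma exp_5_16 : exp (5 / 16) <= 11 / 6.
Proof.
  replace (5 / 16) with (- (- (5 / 16))) by ring. rewrite exp_Ropp.
  pose proof (exp_ineq1_le (- (5 / 16))).
  apply Rle_trans with (/ (11 / 16)); [apply Rinv_le_contravar; lra|]. lra.
Qed.

Section Second.
Variables (n : nat) (T u X : R).
Hypothesis Hn : (1 <= n)%nat.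
Hypothesis HT : 72 <= T.
Hypothesis HuT : u <= T.
Hypothesis HX : 1 / 2 <= X <= 3 / 2.
Hypothesis Hs : T * exp u = INR n / (2 * PI).

(** By the tangent inequality it suffices to bound (n/T) (L - T) - 4 pi y, with L the
    modulus of the logarithm. For y <= e^64, L <= 70 is below T. Beyond, L <= ln y +
    1/16; with y = r e^u and n/T = 2 pi e^u the bound becomes an inequality between ln r
    and r, which holds with room because the second harmonic doubles the decay rate. *)
Lemma second_pointwise y : 0 <= y ->
  Cmod (Clog (RtoC X + Ci * RtoC y)) ^ n * exp (- (4 * PI * y)) <=
  T ^ n * exp (- (5 / 4 * (INR n / T))) * exp (- y).
Proof.
  intros Hy. set (L := Cmod _). assert (L0 : 0 <= L) by apply Cmod_ge_0.
  pose proof PI_RGT_0 as P0. pose proof PI2_3_2 as P3. pose proof (exp_pos u) as Eu.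
  assert (N1 : 1 <= INR n) by (apply le_INR in Hn; exact Hn).
  set (q := INR n / T) in *. assert (q0 : 0 < q) by (apply Rdiv_lt_0_compat; lra).
  eapply Rle_trans; [apply Rmult_le_compat_r; [left; apply exp_pos|apply (pow_tangent n L T L0); lra]|].
  rewrite !Rmult_assoc. apply Rmult_le_compat_l; [apply pow_le; lra|].
  rewrite <- !exp_plus. apply exp_le.
  replace (INR n * ((L - T) / T)) with (q * (L - T)) by (unfold q; field; lra).
  destruct (Rle_lt_dec y (exp 64)) as [C|C].
  - assert (L <= 70) by (apply Clog_line_small; [exact HX|lra]).
    assert (q * (L - T) <= q * (- (5/4))) by (apply Rmult_le_compat_l; lra).
    assert (y <= 4 * PI * y) by nra. lra.
  - assert (HL : L <= ln y + 1 / 16) by (apply Clog_line_large; [exact HX|lra]).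
    set (r := y / exp u). assert (r0 : 0 < r).
    { apply Rdiv_lt_0_compat; [|exact Eu]. pose proof (exp_pos 64). lra. }
    assert (Ey : y = r * exp u) by (unfold r; field; lra).
    assert (Ly : ln y = ln r + u) by (rewrite Ey, ln_mult, ln_exp; [reflexivity|exact r0|exact Eu]).
    assert (Eq : q = 2 * PI * exp u).
    { unfold q. apply Rmult_eq_reg_l with T; [|lra].
      replace (T * (INR n / T)) with (INR n) by (field; lra).
      transitivity (2 * PI * (T * exp u)); [rewrite Hs; field; lra|ring]. }
    assert (Lr : ln r <= 11 / 6 * r - 1 - 5 / 16).
    { pose proof (ln_le_sub1 (exp (5/16) * r)) as Q. pose proof exp_5_16. pose proof (exp_pos (5/16)).
      rewrite ln_mult, ln_exp in Q by lra. specialize (Q ltac:(nra)). nra. }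
    assert (B1 : q * (L - T) <= q * (11 / 6 * r - 5/4)) by (apply Rmult_le_compat_l; lra).
    assert (B2 : 4 * PI * y = 2 * q * r) by (rewrite Ey, Eq; ring).
    assert (B3 : y <= 1 / 6 * (q * r)).
    { replace (q * r) with (2 * PI * y) by (rewrite Eq, Ey; ring). nra. }
    lra.
Qed.

(** Compared with the size T^n e^(-n/T) of the main term this gains e^(-n/(4T)). *)
Lemma second_harmonic_bound Y : 0 <= Y ->
  RInt (fun y => Cmod (Clog (RtoC X + Ci * RtoC y)) ^ n * exp (- (4 * PI * y))) 0 Y <=
  T ^ n * exp (- (5 / 4 * (INR n / T))).
Proof.
  intros HY. set (K := T ^ n * exp (- (5 / 4 * (INR n / T)))).
  assert (K0 : 0 <= K) by (apply Rmult_le_pos; [apply pow_le; lra|left; apply exp_pos]).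
  eapply Rle_trans; [apply Rle_abs|].
  eapply Rle_trans; [apply (RInt_exp_bound _ K 0 Y HY)|].
  - intros y _. apply (logpow_cont_gen n X HX).
  - intros y Hy. rewrite Rabs_pos_eq.
    + apply second_pointwise. lra.
    + apply Rmult_le_pos; [apply pow_le, Cmod_ge_0|left; apply exp_pos].
  - rewrite Ropp_0, exp_0. pose proof (exp_pos (- Y)). nra.
Qed.
End Second.

(** * Gaussian integrals with complex parameter *)

Definition gauss (c : C) (s : R) : C := Cexp (- c * RtoC (s ^ 2 / 2))%C.

Lemma gauss_der c s : cderive (gauss c) s (- c * RtoC s * gauss c s)%C.
Proof.
  eapply cderive_eq.
  - apply cderive_exp. apply cderive_cmult. apply cderive_RtoC with (l := s). auto_derive; [exact I|field].
  - unfold gauss. ring.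
Qed.

Lemma gauss_cont c s : ccont (gauss c) s.
Proof. exact (cderive_cont _ _ _ (gauss_der c s)). Qed.

Lemma gauss_mod c s : Cmod (gauss c s) = exp (- (Re c * s ^ 2 / 2)).
Proof.
  unfold gauss. rewrite Cmod_Cexp, Re_mult_RtoC. f_equal. simpl. unfold Re. field.
Qed.

Lemma CInt_comp_lin (f : R -> C) k a b : a <= b -> 0 <= k -> (forall s, ccont f s) ->
  (RtoC k * CInt (fun r => f (k * r)%R) a b)%C = CInt f (k * a) (k * b).
Proof.
  intros Hab Hk Cf.
  assert (Cf' : forall r, ccont (fun r => f (k * r)) r).
  { intros r. assert (K : continuous (fun r : R => k * r) r).
    { apply (ex_derive_continuous (V := R_NormedModule)). auto_derive. exact I. }
    split.
    - exact (continuous_comp (fun r : R => k * r) (fun s => Re (f s)) r K (proj1 (Cf (k * r)))).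
    - exact (continuous_comp (fun r : R => k * r) (fun s => Im (f s)) r K (proj2 (Cf (k * r)))). }
  rewrite <- CInt_cmult by auto.
  assert (Hle : k * a + 0 <= k * b + 0) by nra.
  assert (ER : ex_RInt (fun s => Re (f s)) (k * a + 0) (k * b + 0)) by (apply ccont_ex_Re; auto).
  assert (EI : ex_RInt (fun s => Im (f s)) (k * a + 0) (k * b + 0)) by (apply ccont_ex_Im; auto).
  pose proof (RInt_comp_lin (V := R_CompleteNormedModule) (fun s => Re (f s)) k 0 a b ER) as R1.
  pose proof (RInt_comp_lin (V := R_CompleteNormedModule) (fun s => Im (f s)) k 0 a b EI) as R2.
  rewrite !Rplus_0_r in R1, R2.
  apply Ceq.
  - refine (eq_trans _ R1). apply RInt_ext. intros x _. rewrite Rplus_0_r.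
    change (k * Re (f (k * x)) - 0 * Im (f (k * x)) = k * Re (f (k * x))). ring.
  - refine (eq_trans _ R2). apply RInt_ext. intros x _. rewrite Rplus_0_r.
    change (k * Im (f (k * x)) + 0 * Re (f (k * x)) = k * Im (f (k * x))). ring.
Qed.

Section Gauss.
Variable c : C.

Let S (x : R) : C := (RtoC x * CInt (fun r => gauss c (x * r)) (-1) 1)%C.
Let H (x : R) : C := CInt (fun r => RtoC (/ (1 + r ^ 2)) * (gauss c x * gauss c (x * r)))%C (-1) 1.

Lemma gauss_scale_der r x : cderive (fun x => gauss c (x * r)) x (- c * RtoC (x * r ^ 2) * gauss c (x * r))%C.
Proof.
  eapply cderive_eq.
  - apply cderive_exp. apply cderive_cmult. apply cderive_RtoC with (l := x * r ^ 2). auto_derive; [exact I|field].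
  - unfold gauss. ring.
Qed.

Lemma ccont2_gauss_scale (p : R * R) : ccont (U := prod_UniformSpace R_UniformSpace R_UniformSpace)
  (fun p => gauss c (fst p * snd p)) p.
Proof.
  apply ccont_exp, ccont_mult; [apply ccont_const|]. apply ccont_RtoC.
  apply (continuous_Rcomp (fun p : R * R => fst p * snd p) (fun s => s ^ 2 / 2)); [|auto_derive; exact I].
  apply (continuous_mult (fun p : R * R => fst p) (fun p : R * R => snd p));
    [apply continuous_fst|apply continuous_snd].
Qed.

Lemma gauss_scale_cont x r : ccont (fun r => gauss c (x * r)) r.
Proof.
  apply ccont_exp, ccont_mult; [apply ccont_const|]. apply ccont_RtoC.
  apply (ex_derive_continuous (V := R_NormedModule)). auto_derive. exact I.
Qed.

Lemma inv1r2_cont r : continuous (fun r : R => / (1 + r ^ 2)) r.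
Proof. apply (ex_derive_continuous (V := R_NormedModule)). auto_derive. nra. Qed.

Lemma S_der x : cderive S x (2 * gauss c x)%C.
Proof.
  assert (D : cderive (fun x => CInt (fun r => gauss c (x * r)) (-1) 1) x
     (CInt (fun r => - c * RtoC (x * r ^ 2) * gauss c (x * r))%C (-1) 1)).
  { apply (CInt_param (fun x r => gauss c (x * r)) (fun x r => - c * RtoC (x * r ^ 2) * gauss c (x * r))%C
      (x - 1) (x + 1)); try lra.
    - intros s y _ _. apply gauss_scale_der.
    - exists 1. split; [lra|]. intros y _ s _. apply gauss_scale_der.
    - intros y _. apply ccont_mult; [apply ccont_mult; [apply ccont_const|]|apply ccont2_gauss_scale].
      apply ccont_RtoC.
      apply (continuous_mult (fun p : R * R => fst p) (fun p : R * R => snd p ^ 2)); [apply continuous_fst|].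
      apply (continuous_Rcomp (fun p : R * R => snd p) (fun s => s ^ 2)); [apply continuous_snd|auto_derive; exact I].
    - intros s y _ _. apply gauss_scale_cont. }
  eapply cderive_eq.
  - apply cderive_mult; [apply cderive_RtoC with (l := 1); apply (is_derive_id (K := R_AbsRing))|exact D].
  - cbv beta.
    assert (C1 : forall r, ccont (fun r => - c * RtoC (x * r ^ 2) * gauss c (x * r))%C r).
    { intros r. apply ccont_mult; [apply ccont_mult; [apply ccont_const|]|apply gauss_scale_cont].
      apply ccont_RtoC. apply (ex_derive_continuous (V := R_NormedModule)). auto_derive. exact I. }
    rewrite <- (CInt_cmult (RtoC x)) by (auto; lra). rewrite <- (CInt_cmult (RtoC 1)) by (intros; try lra; apply gauss_scale_cont).
    rewrite <- CInt_plus; [|lra|intros; apply ccont_mult; [apply ccont_const|apply gauss_scale_cont]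
       |intros; apply ccont_mult; [apply ccont_const|apply C1]].
    rewrite (CInt_FTC (fun r => RtoC r * gauss c (x * r))%C).
    + rewrite Rmult_1_r. replace (x * -1) with (- x) by ring.
      assert (E : gauss c (- x) = gauss c x) by (unfold gauss; replace ((- x) ^ 2) with (x ^ 2) by ring; reflexivity).
      rewrite E. ring.
    + lra.
    + intros r _. eapply cderive_eq.
      * apply cderive_mult; [apply cderive_RtoC with (l := 1); apply (is_derive_id (K := R_AbsRing))|].
        apply cderive_exp. apply cderive_cmult. apply cderive_RtoC with (l := x ^ 2 * r). auto_derive; [exact I|field].
      * cbv beta. fold (gauss c (x * r)). rewrite !RtoC_mult, !RtoC_pow. ring.
    + intros r _. apply ccont_plus; apply ccont_mult; try apply ccont_const; [apply gauss_scale_cont|apply C1].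
Qed.

Lemma H_der x : cderive H x (- c * gauss c x * S x)%C.
Proof.
  assert (D1 : forall s y, cderive (fun x => RtoC (/ (1 + y ^ 2)) * (gauss c x * gauss c (x * y)))%C s
     (- c * RtoC s * (gauss c s * gauss c (s * y)))%C).
  { intros s y. eapply cderive_eq.
    - apply cderive_cmult. apply cderive_mult; [apply gauss_der|apply gauss_scale_der].
    - cbv beta. replace (RtoC (s * y ^ 2)) with (RtoC s * (RtoC (1 + y ^ 2) - 1))%C
        by (rewrite RtoC_mult, RtoC_plus; ring).
      rewrite RtoC_inv by nra. field. intros K. apply RtoC_inj in K. nra. }
  assert (D : cderive H x (CInt (fun r => - c * RtoC x * (gauss c x * gauss c (x * r)))%C (-1) 1)).
  { apply (CInt_param (fun x r => RtoC (/ (1 + r ^ 2)) * (gauss c x * gauss c (x * r)))%C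
      (fun x r => - c * RtoC x * (gauss c x * gauss c (x * r)))%C (x - 1) (x + 1)); try lra.
    - intros s y _ _. apply D1.
    - exists 1. split; [lra|]. intros y _ s _. apply D1.
    - intros y _. apply ccont_mult.
      + apply ccont_mult; [apply ccont_const|]. apply ccont_RtoC, continuous_fst.
      + apply ccont_mult; [|apply ccont2_gauss_scale].
        apply ccont_exp, ccont_mult; [apply ccont_const|]. apply ccont_RtoC.
        apply (continuous_Rcomp (fun p : R * R => fst p) (fun s => s ^ 2 / 2)); [apply continuous_fst|auto_derive; exact I].
    - intros s y _ _. apply ccont_mult; [apply ccont_RtoC, inv1r2_cont|].
      apply ccont_mult; [apply ccont_const|apply gauss_scale_cont]. }
  eapply cderive_eq; [exact D|]. unfold S.
  transitivity (CInt (fun r => (- c * RtoC x * gauss c x) * gauss c (x * r))%C (-1) 1).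
  - apply CInt_ext; [lra|]. intros; ring.
  - rewrite CInt_cmult by (intros; try lra; apply gauss_scale_cont). ring.
Qed.

Lemma H_0 : H 0 = RtoC (PI / 2).
Proof.
  unfold H. rewrite (CInt_FTC (fun r => RtoC (atan r))).
  - rewrite atan_1. replace (-1) with (- (1)) by ring. rewrite atan_opp, atan_1, <- RtoC_minus. f_equal. field.
  - lra.
  - intros r _. eapply cderive_eq; [apply cderive_RtoC with (l := / (1 + r ^ 2))|].
    + auto_derive; [exact I|]. field. nra.
    + assert (E : forall y, y = 0 -> gauss c y = 1).
      { intros y ->. unfold gauss. replace (0 ^ 2 / 2) with 0 by field. rewrite Cmult_0_r. apply Cexp_0. }
      rewrite !E by ring. ring.
  - intros r _. apply ccont_mult; [apply ccont_RtoC, inv1r2_cont|].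
    apply ccont_mult; [apply ccont_const|apply gauss_scale_cont].
Qed.

(** The classical evaluation of the Gaussian integral without double integrals: the left
    side has derivative 0 in x and equals 4 H 0 = 2 pi at x = 0. *)
Lemma gauss_identity x : 0 <= x -> (c * (S x * S x) + 4 * H x = 2 * PI)%C.
Proof.
  intros Hx.
  assert (E : (CInt (fun _ => RtoC 0) 0 x = (c * (S x * S x) + 4 * H x) - (c * (S 0 * S 0) + 4 * H 0))%C).
  { apply (CInt_FTC (fun x => c * (S x * S x) + 4 * H x)%C); [exact Hx| |].
    - intros y _. eapply cderive_eq.
      + apply cderive_plus; [apply cderive_cmult; apply cderive_mult; apply S_der|apply cderive_cmult, H_der].
      + ring.
    - intros; apply ccont_const. }
  rewrite (CInt_FTC (fun _ => RtoC 0)) in E;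
    [|exact Hx|intros; apply cderive_const|intros; apply ccont_const].
  replace (S 0) with (RtoC 0) in E by (unfold S; ring).
  rewrite H_0 in E.
  transitivity (4 * RtoC (PI / 2))%C.
  - transitivity ((c * (S x * S x) + 4 * H x - (c * (0 * 0) + 4 * RtoC (PI / 2))) + 4 * RtoC (PI / 2))%C; [ring|].
    rewrite <- E. ring.
  - rewrite RtoC_div by lra. field.
Qed.

(** H is exponentially small, so the square of the integral is 2 pi / c up to an
    exponentially small error. *)
Lemma H_bound x : 0 <= Re c -> Cmod (H x) <= 2 * exp (- (Re c * x ^ 2 / 2)).
Proof.
  intros Hc. set (e := exp _).
  replace (2 * e) with (e * (1 - -1)) by ring.
  apply CInt_norm_const; [lra| |].
  - intros r _. apply ccont_mult; [apply ccont_RtoC, inv1r2_cont|].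
    apply ccont_mult; [apply ccont_const|apply gauss_scale_cont].
  - intros r _. rewrite !Cmod_mult, !gauss_mod, Cmod_R. fold e.
    assert (0 < e) by apply exp_pos.
    assert (I1 : 0 < / (1 + r ^ 2) <= 1).
    { split; [apply Rinv_0_lt_compat; nra|]. rewrite <- Rinv_1. apply Rinv_le_contravar; nra. }
    rewrite Rabs_pos_eq by lra.
    assert (I2 : exp (- (Re c * (x * r) ^ 2 / 2)) <= 1).
    { rewrite <- exp_0. apply exp_le. assert (0 <= (x * r) ^ 2) by apply pow2_ge_0. nra. }
    pose proof (exp_pos (- (Re c * (x * r) ^ 2 / 2))).
    assert (e * exp (- (Re c * (x * r) ^ 2 / 2)) <= e) by nra. nra.
Qed.

Lemma gauss_square x : 0 <= x -> 0 <= Re c ->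
  Cmod (c * (CInt (gauss c) (- x) x * CInt (gauss c) (- x) x) - 2 * PI)%C
    <= 8 * exp (- (Re c * x ^ 2 / 2)).
Proof.
  intros Hx Hc.
  assert (E : CInt (gauss c) (- x) x = S x).
  { unfold S. rewrite (CInt_comp_lin (gauss c) x (-1) 1) by (try lra; apply gauss_cont).
    f_equal; ring. }
  rewrite E, <- (gauss_identity x Hx).
  replace (c * (S x * S x) - (c * (S x * S x) + 4 * H x))%C with (- (4 * H x))%C by ring.
  rewrite Cmod_opp, Cmod_mult, Cmod_R, Rabs_pos_eq by lra.
  pose proof (H_bound x Hc). lra.
Qed.
End Gauss.

Lemma Csqrt_spec z : 0 <= Im z ->
  (Csqrt z * Csqrt z)%C = z /\ 0 <= Im (Csqrt z) /\ (0 <= Re z -> Im (Csqrt z) <= Re (Csqrt z)).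
Proof.
  intros Hi. unfold Csqrt. destruct (Rle_dec 0 (Im z)) as [_|]; [|contradiction].
  set (M := Cmod z). set (R := Re z).
  assert (HM : M ^ 2 = R ^ 2 + Im z ^ 2) by apply Cmod2_alt.
  assert (H1 : Rabs R <= M) by apply re_le_Cmod. apply Rabs_le_between in H1.
  set (p := sqrt ((M + R) / 2)). set (q := sqrt ((M - R) / 2)).
  assert (Hp : p * p = (M + R) / 2) by (apply sqrt_sqrt; lra).
  assert (Hq : q * q = (M - R) / 2) by (apply sqrt_sqrt; lra).
  assert (P0 : 0 <= p) by apply sqrt_pos. assert (Q0 : 0 <= q) by apply sqrt_pos.
  assert (Hpq : p * q = Im z / 2).
  { apply Rsqr_inj; [nra|lra|]. unfold Rsqr.
    replace (p * q * (p * q)) with ((p * p) * (q * q)) by ring. rewrite Hp, Hq. nra. }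
  split; [|split].
  - apply Ceq; cbn [Re Im fst snd Cmult]; fold R; lra.
  - exact Q0.
  - intros HR. cbn [Re Im fst snd]. apply Rsqr_incr_0_var; [|exact P0]. unfold Rsqr. lra.
Qed.

Lemma cos_ge_lin x : 0 <= x -> 1 - x <= cos x.
Proof.
  intros Hx.
  assert (H : cos 0 + 0 <= cos x + x).
  { apply (incr_of_derive (fun y => cos y + y) (fun y => 1 - sin y)); [exact Hx| |].
    - intros z _. auto_derive; [exact I|ring].
    - intros z _. pose proof (SIN_bound z). lra. }
  rewrite cos_0 in H. lra.
Qed.

Lemma sin_abs_le x : 0 <= x -> Rabs (sin x) <= x.
Proof.
  intros Hx.
  assert (H : 0 - sin 0 <= x - sin x).
  { apply (incr_of_derive (fun y => y - sin y) (fun y => 1 - cos y)); [exact Hx| |].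
    - intros z _. auto_derive; [exact I|ring].
    - intros z _. pose proof (COS_bound z). lra. }
  assert (H' : 0 + sin 0 <= x + sin x).
  { apply (incr_of_derive (fun y => y + sin y) (fun y => 1 + cos y)); [exact Hx| |].
    - intros z _. auto_derive; [exact I|ring].
    - intros z _. pose proof (COS_bound z). lra. }
  rewrite sin_0 in *. apply Rabs_le. lra.
Qed.

(** Decides the sign of the square root. As 0 <= V <= P, cos - sin and cos + sin of V
    s^2 / 2 are at least 1 - V s^2, and the integral of e^(-P s^2/2) (1 - V s^2) is
    nonnegative because s e^(-P s^2/2) is an explicit primitive for the case V = P. *)
Lemma gauss_cone c d : 0 <= d -> 0 < Re c -> 0 <= Im c <= Re c ->
  Rabs (Im (CInt (gauss c) (- d) d)) <= Re (CInt (gauss c) (- d) d).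
Proof.
  intros Hd HP HV. set (P := Re c) in *. set (V := Im c) in *.
  set (e := fun s : R => exp (- (P * s ^ 2 / 2))).
  assert (ER : ex_RInt (fun s => Re (gauss c s)) (- d) d) by (apply ccont_ex_Re; [lra|intros; apply gauss_cont]).
  assert (EI : ex_RInt (fun s => Im (gauss c s)) (- d) d) by (apply ccont_ex_Im; [lra|intros; apply gauss_cont]).
  assert (Val : forall s, Re (gauss c s) = e s * cos (V * s ^ 2 / 2) /\ Im (gauss c s) = - (e s * sin (V * s ^ 2 / 2))).
  { intros s. unfold gauss, Cexp. cbn [Re Im fst snd]. rewrite Re_mult_RtoC, Im_mult_RtoC.
    replace (Re (- c)%C * (s ^ 2 / 2)) with (- (P * s ^ 2 / 2)) by (unfold P; simpl; unfold Re; field).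
    replace (Im (- c)%C * (s ^ 2 / 2)) with (- (V * s ^ 2 / 2)) by (unfold V; simpl; unfold Im; field).
    rewrite cos_neg, sin_neg. fold (e s). split; ring. }
  assert (Low : is_RInt (fun s => e s * (1 - V * s ^ 2)) (- d) d
    ((1 - V / P) * RInt e (- d) d + V / P * (2 * d * e d))).
  { assert (Ie : ex_RInt e (- d) d).
    { apply ex_RInt_cont; [lra|]. intros y _. apply (ex_derive_continuous (V := R_NormedModule)). unfold e. auto_derive. exact I. }
    assert (I2 : is_RInt (fun s => e s - P * s ^ 2 * e s) (- d) d (2 * d * e d)).
    { replace (2 * d * e d) with (minus ((fun s => s * e s) d) ((fun s => s * e s) (- d))).
      - apply (is_RInt_derive (fun s => s * e s) (fun s => e s - P * s ^ 2 * e s)).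
        + intros s _. unfold e. auto_derive; [exact I|].
          replace (s * (s * 1)) with (s ^ 2) by ring. unfold Rdiv. field.
        + intros s _. apply (ex_derive_continuous (V := R_NormedModule)). unfold e. auto_derive. exact I.
      - unfold minus, plus, opp; simpl. unfold e. replace ((- d) ^ 2) with (d ^ 2) by ring. ring. }
    pose proof (is_RInt_scal (V := R_NormedModule) e _ _ (1 - V / P) _ (RInt_correct (V := R_CompleteNormedModule) e _ _ Ie)) as J1.
    pose proof (is_RInt_scal (V := R_NormedModule) _ _ _ (V / P) _ I2) as J2.
    refine (is_RInt_ext _ _ _ _ _ _ (is_RInt_plus (V := R_NormedModule) _ _ _ _ _ _ J1 J2)).
    intros s _. change ((1 - V / P) * e s + V / P * (e s - P * s ^ 2 * e s) = e s * (1 - V * s ^ 2)). field. lra. }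
  assert (Pos : 0 <= (1 - V / P) * RInt e (- d) d + V / P * (2 * d * e d)).
  { assert (0 <= RInt e (- d) d).
    { apply RInt_ge_0; [lra| |].
      - apply ex_RInt_cont; [lra|]. intros y _. apply (ex_derive_continuous (V := R_NormedModule)). unfold e. auto_derive. exact I.
      - intros; left; apply exp_pos. }
    assert (V / P <= 1).
    { apply Rmult_le_reg_r with P; [exact HP|]. unfold Rdiv. rewrite Rmult_assoc, Rinv_l by lra. lra. }
    assert (0 <= V / P) by (apply Rmult_le_pos; [lra|left; now apply Rinv_0_lt_compat]).
    assert (0 < e d) by apply exp_pos.
    apply Rplus_le_le_0_compat; [apply Rmult_le_pos; lra|]. apply Rmult_le_pos; [lra|]. nra. }
  assert (Key : forall sg, sg = 1 \/ sg = -1 ->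
     0 <= RInt (fun s => Re (gauss c s)) (- d) d + sg * RInt (fun s => Im (gauss c s)) (- d) d).
  { intros sg Hsg.
    pose proof (is_RInt_scal (V := R_NormedModule) _ _ _ sg _ (RInt_correct (V := R_CompleteNormedModule) _ _ _ EI)) as J2.
    pose proof (is_RInt_plus (V := R_NormedModule) _ _ _ _ _ _ (RInt_correct (V := R_CompleteNormedModule) _ _ _ ER) J2) as J3.
    apply Rle_trans with (1 := Pos).
    refine (is_RInt_le _ _ (- d) d _ _ ltac:(lra) Low J3 _).
    intros s _. change (e s * (1 - V * s ^ 2) <= Re (gauss c s) + sg * Im (gauss c s)).
    destruct (Val s) as [-> ->]. assert (0 < e s) by apply exp_pos.
    assert (X0 : 0 <= V * s ^ 2 / 2) by (pose proof (pow2_ge_0 s); nra).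
    pose proof (cos_ge_lin _ X0). pose proof (sin_abs_le _ X0) as SA. apply Rabs_le_between in SA.
    replace (e s * cos (V * s ^ 2 / 2) + sg * - (e s * sin (V * s ^ 2 / 2))) with
      (e s * (cos (V * s ^ 2 / 2) - sg * sin (V * s ^ 2 / 2))) by ring.
    apply Rmult_le_compat_l; [lra|]. destruct Hsg as [-> | ->]; lra. }
  change (Rabs (RInt (fun s => Im (gauss c s)) (- d) d) <= RInt (fun s => Re (gauss c s)) (- d) d).
  pose proof (Key 1 (or_introl eq_refl)). pose proof (Key (-1) (or_intror eq_refl)).
  apply Rabs_le. lra.
Qed.

(** The normalised integral r satisfies r^2 = 1 up to an exponentially small error, and
    Re r >= 0 because both the integral and the root lie in the cone |Im| <= Re; hence
    |r + 1| >= 1 and r is close to 1. *)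
Lemma gauss_integral (N d : R) (t : C) : 0 < N -> 0 <= d -> 0 <= Im t <= 1 + Re t -> 0 < 1 + Re t ->
  Cmod (CInt (gauss (RtoC N * (1 + t))) (- d) d * RtoC (sqrt N) * Csqrt (1 + t) / RtoC (sqrt (2 * PI)) - 1)%C
    <= 2 * exp (- (N * (1 + Re t) * d ^ 2 / 2)).
Proof.
  intros HN Hd Hi Hr. pose proof PI_RGT_0. pose proof PI2_3_2 as P3.
  set (c := (RtoC N * (1 + t))%C). set (S := CInt (gauss c) (- d) d). set (q := Csqrt (1 + t)%C).
  assert (Rc : Re c = N * (1 + Re t)) by (unfold c; destruct t; simpl; ring).
  assert (Ic : Im c = N * Im t) by (unfold c; destruct t; simpl; ring).
  assert (I1 : Im (1 + t)%C = Im t) by (destruct t; simpl; ring).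
  assert (R1 : Re (1 + t)%C = 1 + Re t) by (destruct t; simpl; ring).
  destruct (Csqrt_spec (1 + t)%C) as [Q1 [Q2 Q3]]; [rewrite I1; lra|]. fold q in Q1, Q2, Q3.
  specialize (Q3 ltac:(rewrite R1; lra)).
  pose proof (gauss_square c d Hd ltac:(rewrite Rc; nra)) as GS. fold S in GS. rewrite Rc in GS.
  pose proof (gauss_cone c d Hd ltac:(rewrite Rc; nra) ltac:(rewrite Rc, Ic; nra)) as GC. fold S in GC.
  set (e := exp _) in *. set (k := sqrt N). set (w := sqrt (2 * PI)).
  assert (Hk : k * k = N) by (apply sqrt_sqrt; lra).
  assert (Hw : w * w = 2 * PI) by (apply sqrt_sqrt; lra).
  assert (k0 : 0 < k) by (apply sqrt_lt_R0; lra). assert (w0 : 0 < w) by (apply sqrt_lt_R0; lra).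
  assert (wC : RtoC w <> 0) by (intros K; apply RtoC_inj in K; lra).
  set (r := (S * RtoC k * q / RtoC w)%C).
  assert (Er : (r * r - 1)%C = (RtoC (/ (2 * PI)) * (c * (S * S) - 2 * PI))%C).
  { assert (E : (r * r)%C = (RtoC (/ (2 * PI)) * (c * (S * S)))%C).
    { unfold r, c. rewrite <- Q1, <- Hk, RtoC_inv, <- Hw, !RtoC_mult by lra. field. exact wC. }
    rewrite E. rewrite RtoC_inv, RtoC_mult by lra. field. apply PI_neq0_C. }
  assert (Br : Cmod (r * r - 1)%C <= 2 * e).
  { rewrite Er, Cmod_mult, Cmod_R, Rabs_pos_eq by (left; apply Rinv_0_lt_compat; lra).
    assert (e0 : 0 < e) by apply exp_pos.
    apply Rle_trans with (/ (2 * PI) * (8 * e)).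
    - apply Rmult_le_compat_l; [left; apply Rinv_0_lt_compat; lra|exact GS].
    - apply Rmult_le_reg_l with (2 * PI); [lra|]. rewrite <- Rmult_assoc, Rinv_r by lra. nra. }
  assert (Rr : 0 <= Re r).
  { assert (E : Re r = (Re S * Re q - Im S * Im q) * (k / w)).
    { unfold r, Cdiv. rewrite <- RtoC_inv by lra. destruct S as [s1 s2], q as [q1 q2]. simpl. field. lra. }
    rewrite E. apply Rmult_le_pos; [|apply Rmult_le_pos; [lra|left; now apply Rinv_0_lt_compat]].
    apply Rabs_le_between in GC. nra. }
  assert (Rp : 1 <= Cmod (r + 1)%C).
  { apply Rle_trans with (Re (r + 1)%C); [change (1 <= Re r + 1); lra|apply Re_le_Cmod]. }
  assert (Goal : Cmod (r - 1)%C <= 2 * e); [|exact Goal].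
  clearbody r. replace (r * r - 1)%C with ((r - 1) * (r + 1))%C in Br by ring. rewrite Cmod_mult in Br.
  apply Rle_trans with (2 := Br). rewrite <- (Rmult_1_r (Cmod (r - 1)%C)) at 1.
  apply Rmult_le_compat_l; [apply Cmod_ge_0|exact Rp].
Qed.

(** * Moments of the Gaussian *)

Section Moments.
Variables (c : C) (d : R).
Hypothesis Hc : 1 <= Cmod c.
Hypothesis Hd : 0 < d <= 1.

Definition gauss_moment (k : nat) : C := CInt (fun s => RtoC (s ^ k) * gauss c s)%C (- d) d.
Let e := exp (- (Re c * d ^ 2 / 2)).

Lemma powgauss_cont k s : ccont (fun s => RtoC (s ^ k) * gauss c s)%C s.
Proof.
  apply ccont_mult; [|apply gauss_cont]. apply ccont_RtoC.
  apply (ex_derive_continuous (V := R_NormedModule)). auto_derive. exact I.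
Qed.

Lemma c_neq0 : c <> RtoC 0.
Proof. intros K. rewrite K, Cmod_0 in Hc. lra. Qed.

Lemma gauss_even : gauss c (- d) = gauss c d.
Proof. unfold gauss. now replace ((- d) ^ 2) with (d ^ 2) by ring. Qed.

(** Integration by parts, with the boundary terms at -d and d. *)
Lemma gauss_moment_rec k : (c * gauss_moment (S (S k)))%C =
  (RtoC (INR (S k)) * gauss_moment k - (RtoC (d ^ S k) - RtoC ((- d) ^ S k)) * gauss c d)%C.
Proof.
  assert (E : CInt (fun s => RtoC (INR (S k)) * (RtoC (s ^ k) * gauss c s)
      + - c * (RtoC (s ^ S (S k)) * gauss c s))%C (- d) d =
    (RtoC (d ^ S k) * gauss c d - RtoC ((- d) ^ S k) * gauss c (- d))%C).
  { apply (CInt_FTC (fun s => RtoC (s ^ S k) * gauss c s)%C); [lra| |].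
    - intros s _. eapply cderive_eq.
      + apply cderive_mult; [apply cderive_RtoC with (l := INR (S k) * s ^ k)|apply gauss_der].
        auto_derive; [exact I|]. change (1 * (INR (S k) * s ^ k) = INR (S k) * s ^ k). ring.
      + cbv beta. rewrite !RtoC_mult, !RtoC_pow. simpl. ring.
    - intros s _. apply ccont_plus; (apply ccont_mult; [apply ccont_const|apply powgauss_cont]). }
  rewrite (CInt_plus (fun s => RtoC (INR (S k)) * (RtoC (s ^ k) * gauss c s))%C
    (fun s => - c * (RtoC (s ^ S (S k)) * gauss c s))%C) in E;
    [|lra|intros s _; apply ccont_mult; [apply ccont_const|apply powgauss_cont]
     |intros s _; apply ccont_mult; [apply ccont_const|apply powgauss_cont]].
  rewrite (CInt_cmult (RtoC (INR (S k))) (fun s => RtoC (s ^ k) * gauss c s)%C) in E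
    by (intros; try lra; apply powgauss_cont).
  rewrite (CInt_cmult (- c)%C (fun s => RtoC (s ^ S (S k)) * gauss c s)%C) in E
    by (intros; try lra; apply powgauss_cont).
  rewrite gauss_even in E.
  change ((RtoC (INR (S k)) * gauss_moment k + - c * gauss_moment (S (S k)))%C =
    (RtoC (d ^ S k) * gauss c d - RtoC ((- d) ^ S k) * gauss c d)%C) in E.
  transitivity (RtoC (INR (S k)) * gauss_moment k - (RtoC (INR (S k)) * gauss_moment k + - c * gauss_moment (S (S k))))%C; [ring|].
  rewrite E. ring.
Qed.

Lemma gauss_moment_1 : gauss_moment 1 = RtoC 0.
Proof.
  assert (E : CInt (fun s => - c * (RtoC (s ^ 1) * gauss c s))%C (- d) d = (gauss c d - gauss c (- d))%C).
  { apply (CInt_FTC (gauss c)); [lra| |].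
    - intros s _. eapply cderive_eq; [apply gauss_der|]. rewrite pow_1. ring.
    - intros s _. apply ccont_mult; [apply ccont_const|apply powgauss_cont]. }
  rewrite (CInt_cmult (- c)%C (fun s => RtoC (s ^ 1) * gauss c s)%C) in E
    by (intros; try lra; apply powgauss_cont).
  rewrite gauss_even in E. change ((- c * gauss_moment 1)%C = (gauss c d - gauss c d)%C) in E.
  replace (gauss_moment 1) with (/ - c * (- c * gauss_moment 1))%C by (field; apply c_neq0).
  rewrite E. ring.
Qed.

Lemma gauss_moment_odd_step k : Nat.Odd k -> gauss_moment k = RtoC 0 -> gauss_moment (S (S k)) = RtoC 0.
Proof.
  intros Hk H0. pose proof (gauss_moment_rec k) as E. rewrite H0 in E.
  assert (Ek : (- d) ^ S k = d ^ S k).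
  { destruct Hk as [j ->]. replace (S (2 * j + 1)) with (2 * (S j))%nat by lia.
    rewrite !pow_mult. f_equal. ring. }
  rewrite Ek in E.
  replace (gauss_moment (S (S k))) with (/ c * (c * gauss_moment (S (S k))))%C by (field; apply c_neq0).
  rewrite E. ring.
Qed.

(** Dividing by c does no harm as |c| >= 1, and the boundary terms are at most 2 e as d
    <= 1. *)
Lemma gauss_moment_even_step k (b : C) K :
  Cmod (gauss_moment k - b)%C <= K * e ->
  Cmod (gauss_moment (S (S k)) - RtoC (INR (S k)) * b / c)%C <= (INR (S k) * K + 2) * e.
Proof.
  intros H.
  replace (gauss_moment (S (S k)) - RtoC (INR (S k)) * b / c)%C with
    (/ c * (c * gauss_moment (S (S k)) - RtoC (INR (S k)) * b))%C by (field; apply c_neq0).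
  rewrite gauss_moment_rec.
  replace (RtoC (INR (S k)) * gauss_moment k - (RtoC (d ^ S k) - RtoC ((- d) ^ S k)) * gauss c d - RtoC (INR (S k)) * b)%C with
    (RtoC (INR (S k)) * (gauss_moment k - b) + - ((RtoC (d ^ S k) + - RtoC ((- d) ^ S k)) * gauss c d))%C by ring.
  rewrite Cmod_mult, Cmod_inv by apply c_neq0.
  assert (I1 : 0 < / Cmod c <= 1).
  { split; [apply Rinv_0_lt_compat; lra|]. rewrite <- Rinv_1. apply Rinv_le_contravar; lra. }
  assert (Pw : forall s, Rabs s <= 1 -> Rabs (s ^ S k) <= 1).
  { intros s Hs. rewrite <- RPow_abs. apply Rle_trans with (1 ^ S k); [|rewrite pow1; lra].
    apply pow_incr. split; [apply Rabs_pos|exact Hs]. }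
  assert (B : Cmod (RtoC (INR (S k)) * (gauss_moment k - b) + - ((RtoC (d ^ S k) + - RtoC ((- d) ^ S k)) * gauss c d))%C
     <= INR (S k) * (K * e) + 2 * e).
  { eapply Rle_trans; [apply Cmod_triangle|]. apply Rplus_le_compat.
    - rewrite Cmod_mult, Cmod_R, Rabs_pos_eq by apply pos_INR. apply Rmult_le_compat_l; [apply pos_INR|exact H].
    - rewrite Cmod_opp, Cmod_mult, gauss_mod. fold e. apply Rmult_le_compat_r; [left; apply exp_pos|].
      eapply Rle_trans; [apply Cmod_triangle|]. rewrite Cmod_opp, !Cmod_R.
      pose proof (Pw d ltac:(apply Rabs_le; lra)). pose proof (Pw (- d) ltac:(apply Rabs_le; lra)). lra. }
  match goal with |- / _ * ?m <= _ => pose proof (Cmod_ge_0 (RtoC (INR (S k)) * (gauss_moment k - b) + - ((RtoC (d ^ S k) + - RtoC ((- d) ^ S k)) * gauss c d))%C) end.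
  nra.
Qed.

Lemma gauss_moment_odds : gauss_moment 3 = RtoC 0 /\ gauss_moment 5 = RtoC 0 /\ gauss_moment 7 = RtoC 0 /\ gauss_moment 9 = RtoC 0.
Proof.
  assert (M3 : gauss_moment 3 = RtoC 0) by (apply gauss_moment_odd_step; [now exists O|apply gauss_moment_1]).
  assert (M5 : gauss_moment 5 = RtoC 0) by (apply gauss_moment_odd_step; [now exists 1%nat|exact M3]).
  assert (M7 : gauss_moment 7 = RtoC 0) by (apply gauss_moment_odd_step; [now exists 2%nat|exact M5]).
  repeat split; auto. apply gauss_moment_odd_step; [now exists 3%nat|exact M7].
Qed.

Lemma gauss_moment_evens : let b := gauss_moment 0 in
  Cmod (gauss_moment 4 - 3 * b / c ^ 2)%C <= 8 * e /\ Cmod (gauss_moment 6 - 15 * b / c ^ 3)%C <= 42 * e /\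
  Cmod (gauss_moment 8 - 105 * b / c ^ 4)%C <= 296 * e /\ Cmod (gauss_moment 10 - 945 * b / c ^ 5)%C <= 2666 * e /\
  Cmod (gauss_moment 12 - 10395 * b / c ^ 6)%C <= 29328 * e.
Proof.
  intros b. pose proof c_neq0 as C0.
  assert (M0 : Cmod (gauss_moment 0 - b)%C <= 0 * e).
  { replace (gauss_moment 0 - b)%C with (RtoC 0) by (unfold b; ring). rewrite Cmod_0. lra. }
  pose proof (gauss_moment_even_step 0 _ _ M0) as M2. simpl INR in M2.
  pose proof (gauss_moment_even_step 2 _ _ M2) as M4. pose proof (gauss_moment_even_step 4 _ _ M4) as M6.
  pose proof (gauss_moment_even_step 6 _ _ M6) as M8. pose proof (gauss_moment_even_step 8 _ _ M8) as M10.
  pose proof (gauss_moment_even_step 10 _ _ M10) as M12.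
  replace (INR 3) with 3 in * by (simpl; ring). replace (INR 5) with 5 in * by (simpl; ring).
  replace (INR 7) with 7 in * by (simpl; ring). replace (INR 9) with 9 in * by (simpl; ring).
  replace (INR 11) with 11 in * by (simpl; ring).
  split; [|split; [|split; [|split]]].
  - refine (Rle_trans _ _ _ (Req_le _ _ _) (Rle_trans _ _ _ M4 _)); [|right; ring].
    f_equal. field. exact C0.
  - refine (Rle_trans _ _ _ (Req_le _ _ _) (Rle_trans _ _ _ M6 _)); [|right; ring].
    f_equal. field. exact C0.
  - refine (Rle_trans _ _ _ (Req_le _ _ _) (Rle_trans _ _ _ M8 _)); [|right; ring].
    f_equal. field. exact C0.
  - refine (Rle_trans _ _ _ (Req_le _ _ _) (Rle_trans _ _ _ M10 _)); [|right; ring].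
    f_equal. field. exact C0.
  - refine (Rle_trans _ _ _ (Req_le _ _ _) (Rle_trans _ _ _ M12 _)); [|right; ring].
    f_equal. field. exact C0.
Qed.
End Moments.

(** * Truncated expansions *)

Lemma Cmod_add_le x y a b : Cmod x <= a -> Cmod y <= b -> Cmod (x + y)%C <= a + b.
Proof. intros H K. eapply Rle_trans; [apply Cmod_triangle|lra]. Qed.

(** F is a0 + a1 + a2 + a3 + a4 up to order 5, where the term a_k has weight k: each
    bound carries the small parameter g to the power of the weight. The terms are
    themselves numbers, not coefficients, so no division by g is ever needed. *)
Definition jet (g M : R) (F a0 a1 a2 a3 a4 : C) : Prop :=
  Cmod a0 <= M * g ^ 0 /\ Cmod a1 <= M * g ^ 1 /\ Cmod a2 <= M * g ^ 2 /\
  Cmod a3 <= M * g ^ 3 /\ Cmod a4 <= M * g ^ 4 /\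
  Cmod (F - (a0 + a1 + a2 + a3 + a4))%C <= M * g ^ 5.

Section Jets.
Variable g : R.
Hypothesis Hg : 0 <= g <= 1.

(** A product of weight at least k is of order k, since g <= 1. *)
Lemma jet_prod M N a b i j k : 0 <= M -> 0 <= N -> (k <= i + j)%nat ->
  Cmod a <= M * g ^ i -> Cmod b <= N * g ^ j -> Cmod (a * b)%C <= M * N * g ^ k.
Proof.
  intros HM HN Hk Ha Hb. rewrite Cmod_mult.
  apply Rle_trans with (M * g ^ i * (N * g ^ j)).
  - apply Rmult_le_compat; auto using Cmod_ge_0.
  - replace (M * g ^ i * (N * g ^ j)) with (M * N * g ^ (i + j)) by (rewrite pow_add; ring).
    apply Rmult_le_compat_l; [nra|].
    replace (i + j)%nat with (k + (i + j - k))%nat by lia. rewrite pow_add.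
    rewrite <- (Rmult_1_r (g ^ k)) at 2. apply Rmult_le_compat_l; [apply pow_le; lra|].
    rewrite <- (pow1 (i + j - k)). apply pow_incr. exact Hg.
Qed.

(** The remainder of the product consists of 21 products of total weight at least 5,
    whence the constant. *)
Lemma jet_mult M N F G a0 a1 a2 a3 a4 b0 b1 b2 b3 b4 : 0 <= M -> 0 <= N ->
  jet g M F a0 a1 a2 a3 a4 -> jet g N G b0 b1 b2 b3 b4 ->
  jet g (21 * (M * N)) (F * G)%C (a0 * b0) (a0 * b1 + a1 * b0) (a0 * b2 + a1 * b1 + a2 * b0)
    (a0 * b3 + a1 * b2 + a2 * b1 + a3 * b0) (a0 * b4 + a1 * b3 + a2 * b2 + a3 * b1 + a4 * b0).
Proof.
  intros HM HN (A0 & A1 & A2 & A3 & A4 & AR) (B0 & B1 & B2 & B3 & B4 & BR).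
  pose proof (fun a b i j k => jet_prod M N a b i j k HM HN) as P.
  assert (MN : 0 <= M * N) by nra.
  assert (G0 : forall k, 0 <= M * N * g ^ k) by (intros; apply Rmult_le_pos; [exact MN|apply pow_le; lra]).
  split; [|split; [|split; [|split; [|split]]]].
  - pose proof (P a0 b0 0 0 0 ltac:(lia) A0 B0)%nat. pose proof (G0 O). lra.
  - pose proof (Cmod_add_le _ _ _ _ (P a0 b1 0 1 1 ltac:(lia) A0 B1) (P a1 b0 1 0 1 ltac:(lia) A1 B0))%nat.
    pose proof (G0 1%nat). lra.
  - pose proof (Cmod_add_le _ _ _ _ (Cmod_add_le _ _ _ _ (P a0 b2 0 2 2 ltac:(lia) A0 B2)
      (P a1 b1 1 1 2 ltac:(lia) A1 B1)) (P a2 b0 2 0 2 ltac:(lia) A2 B0))%nat.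
    pose proof (G0 2%nat). lra.
  - pose proof (Cmod_add_le _ _ _ _ (Cmod_add_le _ _ _ _ (Cmod_add_le _ _ _ _ (P a0 b3 0 3 3 ltac:(lia) A0 B3)
      (P a1 b2 1 2 3 ltac:(lia) A1 B2)) (P a2 b1 2 1 3 ltac:(lia) A2 B1)) (P a3 b0 3 0 3 ltac:(lia) A3 B0))%nat.
    pose proof (G0 3%nat). lra.
  - pose proof (Cmod_add_le _ _ _ _ (Cmod_add_le _ _ _ _ (Cmod_add_le _ _ _ _ (Cmod_add_le _ _ _ _
      (P a0 b4 0 4 4 ltac:(lia) A0 B4) (P a1 b3 1 3 4 ltac:(lia) A1 B3)) (P a2 b2 2 2 4 ltac:(lia) A2 B2))
      (P a3 b1 3 1 4 ltac:(lia) A3 B1)) (P a4 b0 4 0 4 ltac:(lia) A4 B0))%nat.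
    pose proof (G0 4%nat). lra.
  - set (B := (b0 + b1 + b2 + b3 + b4)%C) in *.
    (* the remainder as a sum of products of total weight at least 5 *)
    pose proof (fun a i (H : Cmod a <= M * g ^ i) (K : (i <= 5)%nat) =>
      P a (G - B)%C i 5%nat 5%nat ltac:(lia) H BR) as PB.
    assert (RB : forall b j, Cmod b <= N * g ^ j -> Cmod ((F - (a0 + a1 + a2 + a3 + a4)) * b)%C <= M * N * g ^ 5)
      by (intros b j H; exact (P _ b 5 j 5 ltac:(lia) AR H)%nat).
    set (r := (F - (a0 + a1 + a2 + a3 + a4))%C) in *. set (s := (G - B)%C) in *.
    assert (E : (F * G - (a0 * b0 + (a0 * b1 + a1 * b0) + (a0 * b2 + a1 * b1 + a2 * b0)
      + (a0 * b3 + a1 * b2 + a2 * b1 + a3 * b0) + (a0 * b4 + a1 * b3 + a2 * b2 + a3 * b1 + a4 * b0)))%C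
      = ((r * s + (r * b0 + (r * b1 + (r * b2 + (r * b3 + r * b4)))))
         + ((a0 * s + (a1 * s + (a2 * s + (a3 * s + a4 * s))))
         + (a1 * b4 + (a2 * b3 + (a3 * b2 + (a4 * b1 + (a2 * b4 + (a3 * b3 + (a4 * b2 + (a3 * b4 + (a4 * b3 + a4 * b4)))))))))))%C).
    { unfold r, s, B. ring. }
    rewrite E. clear E.
    pose proof (P r s 5 5 5 ltac:(lia) AR BR)%nat as C1.
    pose proof (RB b0 _ B0) as C2. pose proof (RB b1 _ B1) as C3. pose proof (RB b2 _ B2) as C4.
    pose proof (RB b3 _ B3) as C5. pose proof (RB b4 _ B4) as C6.
    pose proof (P a0 s 0 5 5 ltac:(lia) A0 BR)%nat as C7. pose proof (P a1 s 1 5 5 ltac:(lia) A1 BR)%nat as C8.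
    pose proof (P a2 s 2 5 5 ltac:(lia) A2 BR)%nat as C9. pose proof (P a3 s 3 5 5 ltac:(lia) A3 BR)%nat as C10.
    pose proof (P a4 s 4 5 5 ltac:(lia) A4 BR)%nat as C11.
    pose proof (P a1 b4 1 4 5 ltac:(lia) A1 B4)%nat as D1. pose proof (P a2 b3 2 3 5 ltac:(lia) A2 B3)%nat as D2.
    pose proof (P a3 b2 3 2 5 ltac:(lia) A3 B2)%nat as D3. pose proof (P a4 b1 4 1 5 ltac:(lia) A4 B1)%nat as D4.
    pose proof (P a2 b4 2 4 5 ltac:(lia) A2 B4)%nat as D5. pose proof (P a3 b3 3 3 5 ltac:(lia) A3 B3)%nat as D6.
    pose proof (P a4 b2 4 2 5 ltac:(lia) A4 B2)%nat as D7. pose proof (P a3 b4 3 4 5 ltac:(lia) A3 B4)%nat as D8.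
    pose proof (P a4 b3 4 3 5 ltac:(lia) A4 B3)%nat as D9. pose proof (P a4 b4 4 4 5 ltac:(lia) A4 B4)%nat as D10.
    eapply Rle_trans.
    + apply Cmod_add_le; [apply (Cmod_add_le _ _ _ _ C1 (Cmod_add_le _ _ _ _ C2 (Cmod_add_le _ _ _ _ C3
        (Cmod_add_le _ _ _ _ C4 (Cmod_add_le _ _ _ _ C5 C6)))))|].
      apply Cmod_add_le; [apply (Cmod_add_le _ _ _ _ C7 (Cmod_add_le _ _ _ _ C8 (Cmod_add_le _ _ _ _ C9
        (Cmod_add_le _ _ _ _ C10 C11))))|].
      apply (Cmod_add_le _ _ _ _ D1 (Cmod_add_le _ _ _ _ D2 (Cmod_add_le _ _ _ _ D3 (Cmod_add_le _ _ _ _ D4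
        (Cmod_add_le _ _ _ _ D5 (Cmod_add_le _ _ _ _ D6 (Cmod_add_le _ _ _ _ D7 (Cmod_add_le _ _ _ _ D8
        (Cmod_add_le _ _ _ _ D9 D10))))))))).
    + lra.
Qed.

Lemma jet_lin M N k F G a0 a1 a2 a3 a4 b0 b1 b2 b3 b4 : 0 <= k ->
  jet g M F a0 a1 a2 a3 a4 -> jet g N G b0 b1 b2 b3 b4 ->
  jet g (M + k * N) (F + RtoC k * G)%C (a0 + RtoC k * b0) (a1 + RtoC k * b1) (a2 + RtoC k * b2)
    (a3 + RtoC k * b3) (a4 + RtoC k * b4).
Proof.
  intros Hk (A0 & A1 & A2 & A3 & A4 & AR) (B0 & B1 & B2 & B3 & B4 & BR).
  assert (S : forall b c, Cmod b <= c -> Cmod (RtoC k * b)%C <= k * c).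
  { intros b c H. rewrite Cmod_mult, Cmod_R, Rabs_pos_eq by exact Hk. now apply Rmult_le_compat_l. }
  split; [|split; [|split; [|split; [|split]]]];
    try (rewrite Rmult_plus_distr_r, Rmult_assoc; apply Cmod_add_le; [assumption|apply S; assumption]).
  replace (F + k * G - (a0 + k * b0 + (a1 + k * b1) + (a2 + k * b2) + (a3 + k * b3) + (a4 + k * b4)))%C
    with ((F - (a0 + a1 + a2 + a3 + a4)) + RtoC k * (G - (b0 + b1 + b2 + b3 + b4)))%C by ring.
  rewrite Rmult_plus_distr_r, Rmult_assoc. apply Cmod_add_le; [assumption|apply S; assumption].
Qed.

Lemma jet_1 : jet g 1 1 1 0 0 0 0.
Proof.
  assert (P : forall k, 0 <= g ^ k) by (intros; apply pow_le; lra).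
  split; [|split; [|split; [|split; [|split]]]]; rewrite ?Cmod_0, ?Cmod_1, ?Rmult_1_l;
    try apply P; try (simpl; lra).
  replace (1 - (1 + 0 + 0 + 0 + 0))%C with (RtoC 0) by ring. rewrite Cmod_0. apply P.
Qed.

Lemma facts_num : INR (fact 0) = 1 /\ INR (fact 1) = 1 /\ INR (fact 2) = 2 /\ INR (fact 3) = 6 /\
  INR (fact 4) = 24 /\ INR (fact 5) = 120 /\ INR (fact 6) = 720.
Proof. rewrite !INR_IZR_INZ. repeat split. Qed.

Lemma exp_partial_sum_5 w : exp_partial_sum 5 w = (1 + RtoC 1 * w + RtoC (/ 2) * (w * w) + RtoC (/ 6) * (w * w * w)
   + RtoC (/ 24) * ((w * w) * (w * w)))%C.
Proof.
  destruct facts_num as (F0 & F1 & F2 & F3 & F4 & _ & _).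
  change (exp_partial_sum 5 w) with (0 + w ^ 0 * RtoC (/ INR (fact 0)) + w ^ 1 * RtoC (/ INR (fact 1))
    + w ^ 2 * RtoC (/ INR (fact 2)) + w ^ 3 * RtoC (/ INR (fact 3)) + w ^ 4 * RtoC (/ INR (fact 4)))%C.
  rewrite F0, F1, F2, F3, F4, Rinv_1. ring.
Qed.
Lemma exp_partial_sum_7 w : exp_partial_sum 7 w = (1 + w + RtoC (/ 2) * w ^ 2 + RtoC (/ 6) * w ^ 3 + RtoC (/ 24) * w ^ 4
   + RtoC (/ 120) * w ^ 5 + RtoC (/ 720) * w ^ 6)%C.
Proof.
  destruct facts_num as (F0 & F1 & F2 & F3 & F4 & F5 & F6).
  change (exp_partial_sum 7 w) with (0 + w ^ 0 * RtoC (/ INR (fact 0)) + w ^ 1 * RtoC (/ INR (fact 1))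
    + w ^ 2 * RtoC (/ INR (fact 2)) + w ^ 3 * RtoC (/ INR (fact 3)) + w ^ 4 * RtoC (/ INR (fact 4))
    + w ^ 5 * RtoC (/ INR (fact 5)) + w ^ 6 * RtoC (/ INR (fact 6)))%C.
  rewrite F0, F1, F2, F3, F4, F5, F6, Rinv_1. ring.
Qed.

(** The jets of E, E^2, E^3 and E^4 are combined with the exponential series; the fifth
    remainder of the series is of order (w g)^5. *)
Lemma jet_exp w E e1 e2 e3 e4 : 0 <= w -> Cmod E <= 5 * w * g -> 5 * w * g <= 1 ->
  jet g w E 0 e1 e2 e3 e4 ->
  Cmod (Cexp E - (1 + e1 + (e2 + e1 * e1 / 2) + (e3 + e1 * e2 + e1 * e1 * e1 / 6)
     + (e4 + e1 * e3 + e2 * e2 / 2 + e1 * e1 * e2 / 2 + e1 * e1 * e1 * e1 / 24)))%C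
   <= 500 * (1 + w) ^ 5 * g ^ 5.
Proof.
  intros Hw HE HE1 J.
  pose proof (jet_mult w w E E 0 e1 e2 e3 e4 0 e1 e2 e3 e4 Hw Hw J J) as J2.
  assert (Hw2 : 0 <= 21 * (w * w)) by nra.
  pose proof (jet_mult _ _ _ _ _ _ _ _ _ _ _ _ _ _ Hw2 Hw J2 J) as J3.
  pose proof (jet_mult _ _ _ _ _ _ _ _ _ _ _ _ _ _ Hw2 Hw2 J2 J2) as J4.
  pose proof (jet_lin _ _ 1 _ _ _ _ _ _ _ _ _ _ _ _ ltac:(lra) jet_1 J) as S1.
  pose proof (jet_lin _ _ (/ 2) _ _ _ _ _ _ _ _ _ _ _ _ ltac:(lra) S1 J2) as S2.
  pose proof (jet_lin _ _ (/ 6) _ _ _ _ _ _ _ _ _ _ _ _ ltac:(lra) S2 J3) as S3.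
  pose proof (jet_lin _ _ (/ 24) _ _ _ _ _ _ _ _ _ _ _ _ ltac:(lra) S3 J4) as S4.
  destruct S4 as (_ & _ & _ & _ & _ & R). clear S1 S2 S3 J2 J3 J4 J.
  rewrite <- exp_partial_sum_5 in R.
  pose proof (Cexp_remainder 5 E) as RE.
  match type of R with Cmod (_ - ?p)%C <= _ => set (p1 := p) in R end.
  match goal with |- Cmod (_ - ?p)%C <= _ => assert (EP : p = p1) end.
  { unfold p1. rewrite !RtoC_inv by lra. field. }
  rewrite EP. clearbody p1.
  replace (Cexp E - p1)%C with ((Cexp E - exp_partial_sum 5 E) + (exp_partial_sum 5 E - p1))%C by ring.
  assert (g5 : 0 <= g ^ 5) by (apply pow_le; lra).
  assert (B1 : Cmod (Cexp E - exp_partial_sum 5 E)%C <= 79 * w ^ 5 * g ^ 5).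
  { eapply Rle_trans; [exact RE|]. destruct facts_num as (_ & _ & _ & _ & _ & F5 & _). rewrite F5.
    assert (X1 : Cmod E ^ 5 <= (5 * w * g) ^ 5) by (apply pow_incr; split; [apply Cmod_ge_0|exact HE]).
    assert (X2 : exp (Cmod E) <= 3).
    { eapply Rle_trans; [apply exp_le; eapply Rle_trans; [exact HE|exact HE1]|]. exact exp_le_3. }
    pose proof (pow_le _ 5 (Cmod_ge_0 E)). pose proof (exp_pos (Cmod E)).
    replace ((5 * w * g) ^ 5) with (3125 * (w ^ 5 * g ^ 5)) in X1 by ring.
    pose proof (pow_le w 5 Hw). assert (0 <= w ^ 5 * g ^ 5) by nra.
    apply Rle_trans with ((3125 * (w ^ 5 * g ^ 5)) / 120 * 3); [|lra].
    apply Rmult_le_compat; lra. }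
  eapply Rle_trans; [apply (Cmod_add_le _ _ _ _ B1 R)|].
  rewrite <- Rmult_plus_distr_r. apply Rmult_le_compat_r; [exact g5|].
  pose proof (pow_le w 2 Hw). pose proof (pow_le w 3 Hw). pose proof (pow_le w 4 Hw). pose proof (pow_le w 5 Hw).
  replace ((1 + w) ^ 5) with (1 + 5 * w + 10 * w ^ 2 + 10 * w ^ 3 + 5 * w ^ 4 + w ^ 5) by ring.
  assert (EQ : 79 * w ^ 5 + (1 + 1 * w + / 2 * (21 * (w * w)) + / 6 * (21 * (21 * (w * w) * w)) +
     / 24 * (21 * (21 * (w * w) * (21 * (w * w))))) = 79 * w ^ 5 + 1 + w + 21 / 2 * w ^ 2 + 147 / 2 * w ^ 3 + 3087 / 8 * w ^ 4) by field.
  rewrite EQ. lra.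
Qed.
End Jets.

(** * The local expansion at the saddle point *)

Lemma ln_taylor s : Rabs s <= 1 / 2 ->
  Rabs (ln (1 + s) - (s - s ^ 2 / 2 + s ^ 3 / 3 - s ^ 4 / 4 + s ^ 5 / 5 - s ^ 6 / 6)) <= 2 / 7 * Rabs s ^ 7.
Proof.
  intros Hs. apply Rabs_le_between in Hs.
  set (f := fun s => ln (1 + s) - (s - s ^ 2 / 2 + s ^ 3 / 3 - s ^ 4 / 4 + s ^ 5 / 5 - s ^ 6 / 6)).
  assert (D : forall x, - (1/2) <= x <= 1/2 -> is_derive f x (x ^ 6 / (1 + x))).
  { intros x Hx. unfold f. auto_derive; [lra|]. field. lra. }
  assert (P : forall x, - (1/2) <= x <= 1/2 -> 0 <= x ^ 6 / (1 + x) <= 2 * x ^ 6).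
  { intros x Hx. assert (0 <= x ^ 6) by (replace (x ^ 6) with ((x ^ 3) ^ 2) by ring; apply pow2_ge_0).
    assert (0 < / (1 + x) <= 2).
    { split; [apply Rinv_0_lt_compat; lra|]. replace 2 with (/ (1/2)) by field. apply Rinv_le_contravar; lra. }
    unfold Rdiv. split; [apply Rmult_le_pos; lra|]. nra. }
  assert (F0 : f 0 = 0) by (unfold f; rewrite Rplus_0_r, ln_1; field).
  assert (M : forall a b, - (1/2) <= a -> a <= b -> b <= 1/2 -> f a <= f b /\ 2 / 7 * a ^ 7 - f a <= 2 / 7 * b ^ 7 - f b).
  { intros a b Ha Hab Hb. split.
    - apply (incr_of_derive f (fun x => x ^ 6 / (1 + x))); [exact Hab| |]; intros x Hx; [apply D|apply P]; lra.
    - apply (incr_of_derive (fun x => 2 / 7 * x ^ 7 - f x) (fun x => 2 * x ^ 6 - x ^ 6 / (1 + x))); [exact Hab| |].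
      + intros x Hx. apply (is_derive_minus (V := R_NormedModule) (fun x => 2 / 7 * x ^ 7) f).
        * auto_derive; [exact I|field].
        * apply D; lra.
      + intros x Hx. pose proof (P x ltac:(lra)). lra. }
  change (Rabs (f s) <= 2 / 7 * Rabs s ^ 7).
  destruct (Rle_lt_dec 0 s) as [C|C].
  - destruct (M 0 s ltac:(lra) C ltac:(lra)) as [M1 M2]. rewrite F0 in M1, M2.
    rewrite (Rabs_pos_eq s) by exact C. rewrite Rabs_pos_eq by exact M1.
    rewrite pow_i in M2 by lia. lra.
  - destruct (M s 0 ltac:(lra) ltac:(lra) ltac:(lra)) as [M1 M2]. rewrite F0 in M1, M2.
    rewrite (Rabs_left s) by exact C. rewrite pow_i in M2 by lia.
    replace ((- s) ^ 7) with (- s ^ 7) by ring. apply Rabs_le. lra.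
Qed.

(** phase_coef3 to phase_coef6 are the Taylor coefficients, divided by n, of n ln (1+s)
    - (n/t) (e^(ts) - 1) at s = 0, without the quadratic term - n (1+t) s^2 / 2. *)
Definition phase_coef3 (t : C) : C := (1 / 3 - t ^ 2 / 6)%C.
Definition phase_coef4 (t : C) : C := (- (1 / 4) - t ^ 3 / 24)%C.
Definition phase_coef5 (t : C) : C := (1 / 5 - t ^ 4 / 120)%C.
Definition phase_coef6 (t : C) : C := (- (1 / 6) - t ^ 5 / 720)%C.

Lemma phase_coef_bound (a b T : R) (w : C) m : 0 <= a -> 0 <= b -> a + b <= 1 -> 1 <= T ->
  Cmod w <= T ^ m * b -> Cmod (RtoC a + w)%C <= T ^ m.
Proof.
  intros Ha Hb Hab HT Hw.
  eapply Rle_trans; [apply (Cmod_add_le _ _ a _ (Req_le _ _ (eq_trans (Cmod_R a) (Rabs_pos_eq a Ha))) Hw)|].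
  pose proof (pow_R1_Rle T m HT). nra.
Qed.

Lemma Re_scale_1p (x : R) (z : C) : Re (RtoC x * (1 + z))%C = x * (1 + Re z).
Proof. destruct z; simpl. ring. Qed.

Section Local.
Variables (n : nat) (t : C).
Hypothesis Hn : (1 <= n)%nat.
Hypothesis Hu : 8 <= Re t.
Hypothesis Hv : 0 < Im t < 2.

Let N := INR n.
Let T := Cmod t.
Let c := (RtoC N * (1 + t))%C.

Lemma N_ge1 : 1 <= N.
Proof. unfold N. apply le_INR in Hn. exact Hn. Qed.

Lemma T_ge8 : 8 <= T.
Proof. unfold T. apply Rle_trans with (1 := Hu), Re_le_Cmod. Qed.

Lemma T_le : T <= Re t + 2.
Proof.
  unfold T. eapply Rle_trans; [apply Cmod_le_sum|]. rewrite !Rabs_pos_eq; lra.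
Qed.

Lemma t_neq0 : t <> RtoC 0.
Proof. intros K. rewrite K in Hu. simpl in Hu. lra. Qed.

Lemma tpow_bound m k : 0 < k -> Cmod (- (t ^ m / RtoC k))%C <= T ^ m * / k.
Proof.
  intros Hk. rewrite Cmod_opp, Cmod_div, Cmod_pow, Cmod_R, Rabs_pos_eq by (try lra; intros K; apply RtoC_inj in K; lra).
  fold T. unfold Rdiv. lra.
Qed.

Lemma phase_coef_bounds : Cmod (phase_coef3 t) <= T ^ 2 /\ Cmod (phase_coef4 t) <= T ^ 3 /\ Cmod (phase_coef5 t) <= T ^ 4 /\ Cmod (phase_coef6 t) <= T ^ 5.
Proof.
  pose proof T_ge8. assert (T1 : 1 <= T) by lra.
  split; [|split; [|split]].
  - unfold phase_coef3. replace (1 / 3 - t ^ 2 / 6)%C with (RtoC (/ 3) + - (t ^ 2 / 6))%C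
      by (rewrite RtoC_inv by lra; field).
    apply (phase_coef_bound _ (/ 6)); try lra. apply tpow_bound; lra.
  - unfold phase_coef4. replace (- (1 / 4) - t ^ 3 / 24)%C with (- (RtoC (/ 4) + - (- (t ^ 3 / 24))))%C
      by (rewrite RtoC_inv by lra; field).
    rewrite Cmod_opp. apply (phase_coef_bound _ (/ 24)); try lra. rewrite Cmod_opp. apply tpow_bound; lra.
  - unfold phase_coef5. replace (1 / 5 - t ^ 4 / 120)%C with (RtoC (/ 5) + - (t ^ 4 / 120))%C
      by (rewrite RtoC_inv by lra; field).
    apply (phase_coef_bound _ (/ 120)); try lra. apply tpow_bound; lra.
  - unfold phase_coef6. replace (- (1 / 6) - t ^ 5 / 720)%C with (- (RtoC (/ 6) + - (- (t ^ 5 / 720))))%C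
      by (rewrite RtoC_inv by lra; field).
    rewrite Cmod_opp. apply (phase_coef_bound _ (/ 720)); try lra. rewrite Cmod_opp. apply tpow_bound; lra.
Qed.

(** The exponent of spiral_kernel without its Gaussian part. *)
Definition phase_excess (s : R) : C :=
  (RtoC N * (RtoC (ln (1 + s)) - (Cexp (t * RtoC s) - 1) / t) + c * RtoC (s ^ 2 / 2))%C.

Lemma spiral_kernel_factor s : -1 < s -> spiral_kernel n t s = (gauss c s * Cexp (phase_excess s))%C.
Proof.
  intros Hs. unfold spiral_kernel, gauss, phase_excess. rewrite <- Cexp_plus.
  replace (RtoC ((1 + s) ^ n)) with (Cexp (RtoC (N * ln (1 + s)))).
  - rewrite <- Cexp_plus. f_equal. rewrite RtoC_mult. unfold N. field. apply t_neq0.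
  - rewrite Cexp_RtoC. unfold N. rewrite exp_mult_nat, exp_ln by lra. reflexivity.
Qed.

Definition phase_term3 (s : R) : C := (RtoC N * phase_coef3 t * RtoC (s ^ 3))%C.
Definition phase_term4 (s : R) : C := (RtoC N * phase_coef4 t * RtoC (s ^ 4))%C.
Definition phase_term5 (s : R) : C := (RtoC N * phase_coef5 t * RtoC (s ^ 5))%C.
Definition phase_term6 (s : R) : C := (RtoC N * phase_coef6 t * RtoC (s ^ 6))%C.

Lemma phase_term_bound (p : C) k s : Cmod p <= T ^ (S k) ->
  Cmod (RtoC N * p * RtoC (s ^ (S (S k))))%C <= (N * T * s ^ 2) * (T * Rabs s) ^ k.
Proof.
  intros Hp. rewrite !Cmod_mult, !Cmod_R, Rabs_pos_eq by (unfold N; apply pos_INR).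
  rewrite <- RPow_abs.
  replace (N * T * s ^ 2 * (T * Rabs s) ^ k) with (N * T ^ (S k) * Rabs s ^ (S (S k))).
  - apply Rmult_le_compat_r; [apply pow_le, Rabs_pos|]. apply Rmult_le_compat_l; [unfold N; apply pos_INR|exact Hp].
  - rewrite Rpow_mult_distr. replace (s ^ 2) with (Rabs s ^ 2) by (rewrite pow2_abs; reflexivity). simpl. ring.
Qed.

(** The natural small parameter is T |s|, and N T s^2 is the size of the Gaussian
    exponent. *)
Lemma phase_excess_jet s : Rabs s <= 1 / 2 -> T * Rabs s <= 1 ->
  jet (T * Rabs s) (N * T * s ^ 2) (phase_excess s) 0 (phase_term3 s) (phase_term4 s) (phase_term5 s) (phase_term6 s).
Proof.
  intros Hs HT. pose proof phase_coef_bounds as (B3 & B4 & B5 & B6). pose proof N_ge1 as N1. pose proof T_ge8 as T8.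
  pose proof (Rabs_pos s) as Rs. pose proof (pow2_ge_0 s) as S2.
  assert (W0 : 0 <= N * T * s ^ 2) by (apply Rmult_le_pos; [nra|exact S2]).
  split; [|split; [|split; [|split; [|split]]]].
  - rewrite Cmod_0. simpl. nra.
  - apply phase_term_bound, B3.
  - apply phase_term_bound, B4.
  - apply phase_term_bound, B5.
  - apply phase_term_bound, B6.
  - set (r1 := ln (1 + s) - (s - s ^ 2 / 2 + s ^ 3 / 3 - s ^ 4 / 4 + s ^ 5 / 5 - s ^ 6 / 6)).
    set (r2 := (Cexp (t * RtoC s) - exp_partial_sum 7 (t * RtoC s))%C).
    assert (E : (phase_excess s - (0 + phase_term3 s + phase_term4 s + phase_term5 s + phase_term6 s))%C = (RtoC N * (RtoC r1 + - (r2 / t)))%C).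
    { unfold r1, r2. rewrite exp_partial_sum_7. unfold phase_excess, phase_term3, phase_term4, phase_term5, phase_term6, phase_coef3, phase_coef4, phase_coef5, phase_coef6, c.
      repeat (rewrite RtoC_minus || rewrite RtoC_plus || rewrite RtoC_pow
        || (rewrite RtoC_div by lra) || (rewrite RtoC_inv by lra)).
      field. apply t_neq0. }
    rewrite E, Cmod_mult, Cmod_R, (Rabs_pos_eq N) by lra.
    assert (X1 : Cmod (RtoC r1) <= 2 / 7 * Rabs s ^ 7) by (rewrite Cmod_R; apply ln_taylor, Hs).
    assert (X2 : Cmod (- (r2 / t))%C <= / 2 * (T ^ 6 * Rabs s ^ 7)).
    { rewrite Cmod_opp, Cmod_div by apply t_neq0. fold T.
      pose proof (Cexp_remainder 7 (t * RtoC s)%C) as R. fold r2 in R.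
      rewrite Cmod_mult, Cmod_R in R. fold T in R.
      assert (X3 : exp (T * Rabs s) <= 3) by (eapply Rle_trans; [apply exp_le, HT|apply exp_le_3]).
      assert (F7 : INR (fact 7) = 5040) by (rewrite INR_IZR_INZ; reflexivity). rewrite F7 in R.
      rewrite Rpow_mult_distr in R.
      assert (P7 : 0 <= T ^ 7 * Rabs s ^ 7) by (apply Rmult_le_pos; apply pow_le; lra).
      pose proof (exp_pos (T * Rabs s)).
      assert (R' : Cmod r2 <= / 2 * (T ^ 6 * Rabs s ^ 7) * T).
      { eapply Rle_trans; [exact R|].
        apply Rle_trans with (T ^ 7 * Rabs s ^ 7 / 5040 * 3).
        - apply Rmult_le_compat_l; lra.
        - replace (/ 2 * (T ^ 6 * Rabs s ^ 7) * T) with (/ 2 * (T ^ 7 * Rabs s ^ 7)) by ring. lra. }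
      unfold Rdiv. apply Rmult_le_reg_r with T; [lra|]. rewrite Rmult_assoc, Rinv_l by lra. lra. }
    pose proof (Cmod_add_le _ _ _ _ X1 X2) as X.
    replace (N * T * s ^ 2 * (T * Rabs s) ^ 5) with (N * (T ^ 6 * Rabs s ^ 7)).
    + apply Rmult_le_compat_l; [lra|]. apply Rle_trans with (1 := X).
      assert (1 <= T ^ 6) by (apply pow_R1_Rle; lra). pose proof (pow_le _ 7 Rs). nra.
    + rewrite Rpow_mult_distr. replace (s ^ 2) with (Rabs s ^ 2) by (rewrite pow2_abs; reflexivity). ring.
Qed.

(** The part of weight at most 4 of exp (phase_excess). *)
Definition main_poly (s : R) : C :=
  (1 + phase_term3 s + (phase_term4 s + phase_term3 s * phase_term3 s / 2) + (phase_term5 s + phase_term3 s * phase_term4 s + phase_term3 s * phase_term3 s * phase_term3 s / 6)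
   + (phase_term6 s + phase_term3 s * phase_term5 s + phase_term4 s * phase_term4 s / 2 + phase_term3 s * phase_term3 s * phase_term4 s / 2 + phase_term3 s * phase_term3 s * phase_term3 s * phase_term3 s / 24))%C.

(** A polynomial in the Gaussian exponent is absorbed by a quarter of the exponential. *)
Lemma poly_exp_bound w : 0 <= w -> (1 + w) ^ 7 * exp (- (w / 4)) <= 4 ^ 7 * 5040 * 2.
Proof.
  intros Hw. pose proof (pow_fact_le_exp ((1 + w) / 4) 7 ltac:(lra)) as P.
  assert (F7 : INR (fact 7) = 5040) by (rewrite INR_IZR_INZ; reflexivity). rewrite F7 in P.
  replace ((1 + w) / 4) with (1 / 4 + w / 4) in P at 2 by field. rewrite exp_plus in P.
  assert (E4 : exp (1 / 4) <= 2).
  { replace (1/4) with (- (- (1/4))) by ring. rewrite exp_Ropp. pose proof (exp_ineq1_le (- (1/4))).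
    apply Rle_trans with (/ (1/2)); [apply Rinv_le_contravar; lra|lra]. }
  pose proof (exp_pos (w / 4)) as EW.
  rewrite exp_Ropp. apply Rmult_le_reg_r with (exp (w / 4)); [exact EW|].
  rewrite Rmult_assoc, Rinv_l, Rmult_1_r by lra.
  replace ((1 + w) ^ 7) with (4 ^ 7 * 5040 * (((1 + w) / 4) ^ 7 / 5040)) by field.
  apply Rle_trans with (4 ^ 7 * 5040 * (2 * exp (w / 4))); [|right; ring].
  apply Rmult_le_compat_l; [lra|].
  eapply Rle_trans; [exact P|]. apply Rmult_le_compat_r; lra.
Qed.

Definition local_const : R := 500 * (4 ^ 7 * 5040 * 2).

Variable delta : R.
Hypothesis Hd : 0 < delta <= 1 / 8.
Hypothesis HTd : T * delta <= 1.
Hypothesis Hsm : 5 * N * T ^ 2 * delta ^ 3 <= 1.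

(** The jet error is (1+w)^5 g^5 with g^2 = (T/N) w. Two factors g^2 become (T/N)^2 w^2,
    the fifth is at most T delta, and the powers of w are absorbed by the Gaussian. *)
Lemma local_pointwise s : - delta <= s <= delta ->
  Cmod (spiral_kernel n t s - gauss c s * main_poly s)%C <= local_const * ((T / N) ^ 2 * (T * delta)).
Proof.
  intros Hs. pose proof N_ge1 as N1. pose proof T_ge8 as T8. pose proof T_le as TL.
  assert (Rs : Rabs s <= delta) by (apply Rabs_le; lra). pose proof (Rabs_pos s) as R0.
  set (g := T * Rabs s). set (w := N * T * s ^ 2).
  assert (g0 : 0 <= g <= 1) by (unfold g; nra).
  assert (w0 : 0 <= w) by (unfold w; apply Rmult_le_pos; [nra|apply pow2_ge_0]).
  assert (Es2 : s ^ 2 = Rabs s ^ 2) by (rewrite pow2_abs; reflexivity).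
  assert (wg : 5 * w * g <= 1).
  { unfold w, g. rewrite Es2.
    replace (5 * (N * T * Rabs s ^ 2) * (T * Rabs s)) with (5 * N * T ^ 2 * Rabs s ^ 3) by ring.
    apply Rle_trans with (2 := Hsm). apply Rmult_le_compat_l; [nra|]. apply pow_incr. lra. }
  pose proof (phase_excess_jet s ltac:(lra) ltac:(fold g; lra)) as J. fold g w in J.
  assert (HE : Cmod (phase_excess s) <= 5 * w * g).
  { destruct J as (_ & J1 & J2 & J3 & J4 & J5).
    replace (phase_excess s) with ((phase_excess s - (0 + phase_term3 s + phase_term4 s + phase_term5 s + phase_term6 s)) + (phase_term3 s + (phase_term4 s + (phase_term5 s + phase_term6 s))))%C by ring.
    eapply Rle_trans; [apply (Cmod_add_le _ _ _ _ J5 (Cmod_add_le _ _ _ _ J1 (Cmod_add_le _ _ _ _ J2 (Cmod_add_le _ _ _ _ J3 J4))))|].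
    assert (Pg : forall k, (1 <= k)%nat -> w * g ^ k <= w * g).
    { intros k Hk. apply Rmult_le_compat_l; [exact w0|]. destruct k as [|k]; [lia|]. simpl.
      rewrite <- (Rmult_1_r g) at 3. apply Rmult_le_compat_l; [lra|]. rewrite <- (pow1 k). apply pow_incr. lra. }
    pose proof (Pg 1%nat ltac:(lia)). pose proof (Pg 2%nat ltac:(lia)). pose proof (Pg 3%nat ltac:(lia)).
    pose proof (Pg 4%nat ltac:(lia)). pose proof (Pg 5%nat ltac:(lia)). lra. }
  pose proof (jet_exp g g0 w _ _ _ _ _ w0 HE wg J) as X. fold (main_poly s) in X.
  rewrite spiral_kernel_factor by lra.
  replace (gauss c s * Cexp (phase_excess s) - gauss c s * main_poly s)%C with (gauss c s * (Cexp (phase_excess s) - main_poly s))%C by ring.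
  rewrite Cmod_mult, gauss_mod.
  assert (G1 : exp (- (Re c * s ^ 2 / 2)) <= exp (- (w / 4))).
  { apply exp_le. unfold c. rewrite Re_scale_1p.
    unfold w. assert (T <= 2 * (1 + Re t)) by lra. assert (0 <= s ^ 2) by apply pow2_ge_0.
    assert (0 <= N * s ^ 2) by nra. nra. }
  assert (G5 : g ^ 5 <= (T / N) ^ 2 * (T * delta) * (1 + w) ^ 2).
  { replace (g ^ 5) with ((g ^ 2) ^ 2 * g) by ring.
    assert (Eg : g ^ 2 = T / N * w) by (unfold g, w; rewrite Es2; field; lra).
    rewrite Eg. replace ((T / N * w) ^ 2 * g) with ((T / N) ^ 2 * g * w ^ 2) by ring.
    assert (TN : 0 <= (T / N) ^ 2) by apply pow2_ge_0.
    apply Rmult_le_compat; [nra|apply pow2_ge_0| |apply pow_incr; lra].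
    apply Rmult_le_compat_l; [exact TN|]. unfold g. apply Rmult_le_compat_l; lra. }
  pose proof (poly_exp_bound w w0) as PE.
  assert (Q0 : 0 <= (T / N) ^ 2 * (T * delta)) by (apply Rmult_le_pos; [apply pow2_ge_0|nra]).
  apply Rle_trans with (exp (- (w / 4)) * (500 * (1 + w) ^ 5 * ((T / N) ^ 2 * (T * delta) * (1 + w) ^ 2))).
  - apply Rmult_le_compat; [left; apply exp_pos|apply Cmod_ge_0|exact G1|].
    apply Rle_trans with (1 := X). apply Rmult_le_compat_l; [|exact G5].
    pose proof (pow_le (1 + w) 5 ltac:(lra)). lra.
  - replace (exp (- (w / 4)) * (500 * (1 + w) ^ 5 * ((T / N) ^ 2 * (T * delta) * (1 + w) ^ 2))) with
      (500 * ((1 + w) ^ 7 * exp (- (w / 4))) * ((T / N) ^ 2 * (T * delta))) by ring.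
    apply Rmult_le_compat_r; [exact Q0|]. unfold local_const. lra.
Qed.
End Local.

(** * Integration of the local expansion *)

Section PolyGauss.
Variables (c : C) (d : R).
Hypothesis Hd : 0 < d.

(** Polynomials with complex coefficients times the Gaussian, as lists of coefficients
    and exponents, so that integration is a structural recursion. *)
Fixpoint poly_gauss (l : list (C * nat)) (s : R) : C :=
  match l with
  | nil => RtoC 0
  | cons (a, k) l' => (a * (RtoC (s ^ k) * gauss c s) + poly_gauss l' s)%C
  end.

Fixpoint poly_mom (l : list (C * nat)) : C :=
  match l with
  | nil => RtoC 0
  | cons (a, k) l' => (a * gauss_moment c d k + poly_mom l')%C
  end.

Lemma poly_gauss_cont l s : ccont (poly_gauss l) s.
Proof.
  induction l as [|[a k] l IH]; [apply ccont_const|].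
  apply (ccont_plus (fun s => a * (RtoC (s ^ k) * gauss c s))%C (poly_gauss l)); [|exact IH].
  apply (ccont_mult (fun _ => a) (fun s => RtoC (s ^ k) * gauss c s)%C); [apply ccont_const|apply powgauss_cont].
Qed.

Lemma CInt_poly_gauss l : CInt (poly_gauss l) (- d) d = poly_mom l.
Proof.
  induction l as [|[a k] l IH].
  - simpl. rewrite (CInt_FTC (fun _ => RtoC 0)); [ring|lra| |]; intros.
    + apply cderive_const. + apply ccont_const.
  - change (CInt (fun s => a * (RtoC (s ^ k) * gauss c s) + poly_gauss l s)%C (- d) d =
      (a * gauss_moment c d k + poly_mom l)%C).
    rewrite (CInt_plus (fun s => a * (RtoC (s ^ k) * gauss c s))%C (poly_gauss l)); [|lra| |].
    + rewrite (CInt_cmult a (fun s => RtoC (s ^ k) * gauss c s)%C); [|lra|intros; apply powgauss_cont].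
      rewrite IH. reflexivity.
    + intros s _. apply (ccont_mult (fun _ => a) (fun s => RtoC (s ^ k) * gauss c s)%C);
        [apply ccont_const|apply powgauss_cont].
    + intros; apply poly_gauss_cont.
Qed.
End PolyGauss.

(** Replacing each even power of s by its Gaussian moment, 3/c^2, 15/c^3, 105/c^4,
    945/c^5 and 10395/c^6 for s^4 to s^12, the terms of order 1/N and 1/N^2 are exactly
    the rational functions coef1 and coef2. *)
Lemma coef_identity (N : R) (t : C) : N <> 0 -> (1 + t)%C <> RtoC 0 ->
  let c := (RtoC N * (1 + t))%C in
  (1 + RtoC N * phase_coef4 t * (3 / c ^ 2)
    + (RtoC N * phase_coef3 t * (RtoC N * phase_coef3 t) / 2 + RtoC N * phase_coef6 t) * (15 / c ^ 3)
    + (RtoC N * phase_coef3 t * (RtoC N * phase_coef5 t) + RtoC N * phase_coef4 t * (RtoC N * phase_coef4 t) / 2) * (105 / c ^ 4)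
    + RtoC N * phase_coef3 t * (RtoC N * phase_coef3 t) * (RtoC N * phase_coef4 t) / 2 * (945 / c ^ 5)
    + RtoC N * phase_coef3 t * (RtoC N * phase_coef3 t) * (RtoC N * phase_coef3 t) * (RtoC N * phase_coef3 t) / 24 * (10395 / c ^ 6))%C
  = (1 + coef1 t / RtoC N + coef2 t / RtoC N ^ 2)%C.
Proof.
  intros HN H1 c. assert (HNC : RtoC N <> 0) by (intros K; apply RtoC_inj in K; lra).
  unfold c, coef1, coef2, wp2, wp4, phase_coef3, phase_coef4, phase_coef5, phase_coef6. field. split; assumption.
Qed.

Section KInt.
Variables (n : nat) (t : C) (delta : R).
Hypothesis Hn : (1 <= n)%nat.
Hypothesis Hu : 8 <= Re t.
Hypothesis Hv : 0 < Im t < PI / 2.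
Hypothesis Hw : (t * Cexp t = INR n * Ci / (2 * PI))%C.
Hypothesis Hd : 0 < delta <= 1 / 8.
Hypothesis HTd : Cmod t * delta <= 1.
Hypothesis Hsm : 5 * INR n * Cmod t ^ 2 * delta ^ 3 <= 1.
Let N := INR n.
Let T := Cmod t.
Let c := (RtoC N * (1 + t))%C.
Let e := exp (- (N * (1 + Re t) * delta ^ 2 / 2)).

Lemma Hv2 : 0 < Im t < 2.
Proof. pose proof PI_4. lra. Qed.

Let A3 := (RtoC N * phase_coef3 t)%C. Let A4 := (RtoC N * phase_coef4 t)%C.
Let A5 := (RtoC N * phase_coef5 t)%C. Let A6 := (RtoC N * phase_coef6 t)%C.
Let mpl : list (C * nat) :=
  ((RtoC 1, 0%nat) :: (A3, 3%nat) :: (A4, 4%nat) :: (A5, 5%nat) :: ((A3 * A3 / 2 + A6)%C, 6%nat) :: ((A3 * A4)%C, 7%nat)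
   :: ((A3 * A5 + A4 * A4 / 2)%C, 8%nat) :: ((A3 * A3 * A3 / 6)%C, 9%nat) :: ((A3 * A3 * A4 / 2)%C, 10%nat)
   :: ((A3 * A3 * A3 * A3 / 24)%C, 12%nat) :: nil).

Lemma main_poly_list s : (gauss c s * main_poly n t s)%C = poly_gauss c mpl s.
Proof.
  unfold mpl, poly_gauss, main_poly, phase_term3, phase_term4, phase_term5, phase_term6. fold N. fold A3 A4 A5 A6.
  rewrite !RtoC_pow. field.
Qed.

Lemma c_ge1 : 1 <= Cmod c.
Proof.
  apply Rle_trans with (2 := Re_le_Cmod c). unfold c. rewrite Re_scale_1p.
  pose proof (N_ge1 n Hn). fold N in H. nra.
Qed.

Lemma main_integral :
  Cmod (CInt (fun s => gauss c s * main_poly n t s)%C (- delta) delta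
    - gauss_moment c delta 0 * (1 + coef1 t / RtoC N + coef2 t / RtoC N ^ 2))%C <= 70000 * (N ^ 4 * T ^ 8) * e.
Proof.
  pose proof (N_ge1 n Hn) as N1. fold N in N1. pose proof (T_ge8 t Hu) as T8. fold T in T8.
  rewrite (CInt_ext _ (poly_gauss c mpl)) by (try lra; intros; apply main_poly_list).
  rewrite CInt_poly_gauss by lra.
  pose proof c_ge1 as Hc.
  destruct (gauss_moment_odds c delta Hc ltac:(lra)) as (O3 & O5 & O7 & O9).
  destruct (gauss_moment_evens c delta Hc ltac:(lra)) as (E4 & E6 & E8 & E10 & E12).
  assert (H1t : (1 + t)%C <> RtoC 0).
  { intros K. pose proof (f_equal Re K) as K'. destruct t; simpl in *. lra. }
  rewrite <- (coef_identity N t) by (try lra; exact H1t). fold c. fold A3 A4 A5 A6.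
  unfold mpl, poly_mom. rewrite O3, O5, O7, O9.
  set (b := gauss_moment c delta 0) in *.
  assert (Ee : exp (- (Re c * delta ^ 2 / 2)) = e) by (unfold e, c; now rewrite Re_scale_1p).
  rewrite Ee in E4, E6, E8, E10, E12.
  match goal with |- Cmod ?x <= _ => replace x with
    (A4 * (gauss_moment c delta 4 - 3 * b / c ^ 2) + ((A3 * A3 / 2 + A6) * (gauss_moment c delta 6 - 15 * b / c ^ 3)
     + ((A3 * A5 + A4 * A4 / 2) * (gauss_moment c delta 8 - 105 * b / c ^ 4)
     + (A3 * A3 * A4 / 2 * (gauss_moment c delta 10 - 945 * b / c ^ 5)
     + A3 * A3 * A3 * A3 / 24 * (gauss_moment c delta 12 - 10395 * b / c ^ 6)))))%C end.
  2:{ field. exact (c_neq0 c Hc). }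
  destruct (phase_coef_bounds t Hu) as (P3 & P4 & P5 & P6). fold T in P3, P4, P5, P6.
  assert (Sc : forall p m, Cmod p <= T ^ m -> Cmod (RtoC N * p)%C <= N * T ^ m).
  { intros p m H. rewrite Cmod_mult, Cmod_R, Rabs_pos_eq by lra. apply Rmult_le_compat_l; lra. }
  assert (B3 : Cmod A3 <= N * T ^ 2) by (apply Sc, P3). assert (B4 : Cmod A4 <= N * T ^ 3) by (apply Sc, P4).
  assert (B5 : Cmod A5 <= N * T ^ 4) by (apply Sc, P5). assert (B6 : Cmod A6 <= N * T ^ 5) by (apply Sc, P6).
  clear Sc.
  set (Z := N ^ 4 * T ^ 8).
  assert (Mul : forall x y a b', Cmod x <= a -> Cmod y <= b' -> Cmod (x * y)%C <= a * b').
  { intros x y a b' Hx Hy. rewrite Cmod_mult. apply Rmult_le_compat; auto using Cmod_ge_0. }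
  assert (Dv : forall x a k, 1 <= k -> Cmod x <= a -> Cmod (x / RtoC k)%C <= a).
  { intros x a k Hk Hx. rewrite Cmod_div, Cmod_R, Rabs_pos_eq by (try lra; intros K; apply RtoC_inj in K; lra).
    apply Rmult_le_reg_r with k; [lra|]. unfold Rdiv. rewrite Rmult_assoc, Rinv_l by lra.
    pose proof (Cmod_ge_0 x). nra. }
  assert (e0 : 0 < e) by apply exp_pos.
  assert (NT : forall i j, (i <= 4)%nat -> (j <= 8)%nat -> N ^ i * T ^ j <= Z).
  { intros i j Hi Hj. unfold Z. apply Rmult_le_compat; try (apply pow_le; lra); apply Rle_pow; lia || lra. }
  assert (Q4 : Cmod A4 <= Z).
  { apply Rle_trans with (1 := B4). pose proof (NT 1%nat 3%nat ltac:(lia) ltac:(lia)). lra. }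
  assert (Q6 : Cmod (A3 * A3 / 2 + A6)%C <= 2 * Z).
  { eapply Rle_trans; [apply (Cmod_add_le _ _ _ _ (Dv _ _ 2 ltac:(lra) (Mul _ _ _ _ B3 B3)) B6)|].
    pose proof (NT 2%nat 4%nat ltac:(lia) ltac:(lia)). pose proof (NT 1%nat 5%nat ltac:(lia) ltac:(lia)). lra. }
  assert (Q8 : Cmod (A3 * A5 + A4 * A4 / 2)%C <= 2 * Z).
  { eapply Rle_trans; [apply (Cmod_add_le _ _ _ _ (Mul _ _ _ _ B3 B5) (Dv _ _ 2 ltac:(lra) (Mul _ _ _ _ B4 B4)))|].
    pose proof (NT 2%nat 6%nat ltac:(lia) ltac:(lia)). lra. }
  assert (Q10 : Cmod (A3 * A3 * A4 / 2)%C <= Z).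
  { eapply Rle_trans; [apply (Dv _ _ 2 ltac:(lra) (Mul _ _ _ _ (Mul _ _ _ _ B3 B3) B4))|].
    pose proof (NT 3%nat 7%nat ltac:(lia) ltac:(lia)). lra. }
  assert (Q12 : Cmod (A3 * A3 * A3 * A3 / 24)%C <= Z).
  { eapply Rle_trans; [apply (Dv _ _ 24 ltac:(lra) (Mul _ _ _ _ (Mul _ _ _ _ (Mul _ _ _ _ B3 B3) B3) B3))|].
    pose proof (NT 4%nat 8%nat ltac:(lia) ltac:(lia)). lra. }
  eapply Rle_trans; [apply (Cmod_add_le _ _ _ _ (Mul _ _ _ _ Q4 E4) (Cmod_add_le _ _ _ _ (Mul _ _ _ _ Q6 E6)
    (Cmod_add_le _ _ _ _ (Mul _ _ _ _ Q8 E8) (Cmod_add_le _ _ _ _ (Mul _ _ _ _ Q10 E10) (Mul _ _ _ _ Q12 E12)))))|].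
  assert (Z0 : 0 <= Z * e).
  { apply Rmult_le_pos; [|lra]. unfold Z. apply Rmult_le_pos; apply pow_le; lra. }
  replace (Z * (8 * e) + (2 * Z * (42 * e) + (2 * Z * (296 * e) + (Z * (2666 * e) + Z * (29328 * e))))) with
    (32678 * (Z * e)) by ring.
  rewrite Rmult_assoc. lra.
Qed.

(** The left part of the spiral is a tail; on the symmetric interval the kernel is
    replaced by the Gaussian times main_poly, and the moments of the latter are
    evaluated. *)
Lemma spiral_kernel_integral :
  Cmod (CInt (spiral_kernel n t) (-1) delta - gauss_moment c delta 0 * (1 + coef1 t / RtoC N + coef2 t / RtoC N ^ 2))%C <=
   exp (- (N * Re t * delta ^ 2 / 4)) + local_const * ((T / N) ^ 2 * (T * delta)) * (2 * delta)
    + 70000 * (N ^ 4 * T ^ 8) * e.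
Proof.
  assert (Ck : forall s, ccont (spiral_kernel n t) s).
  { intros s. apply spiral_kernel_cont. }
  rewrite (CInt_Chasles (spiral_kernel n t) (-1) (- delta) delta) by (try lra; intros; apply Ck).
  pose proof (saddle_T_ge t) as TG.
  assert (Hud : Re t * delta <= 1) by nra.
  pose proof (left_tail_bound n t Hu delta Hd Hud) as LT. fold N in LT.
  assert (Cm : forall s, ccont (fun s => gauss c s * main_poly n t s)%C s).
  { intros s. apply (ccont_ext (poly_gauss c mpl)); [intros; symmetry; apply main_poly_list|apply poly_gauss_cont]. }
  assert (LP : Cmod (CInt (spiral_kernel n t) (- delta) delta - CInt (fun s => gauss c s * main_poly n t s)%C (- delta) delta)%C
     <= local_const * ((T / N) ^ 2 * (T * delta)) * (2 * delta)).
  { assert (E : (CInt (spiral_kernel n t) (- delta) delta - CInt (fun s => gauss c s * main_poly n t s)%C (- delta) delta)%C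
     = CInt (fun s => spiral_kernel n t s + - (1) * (gauss c s * main_poly n t s))%C (- delta) delta).
    { transitivity (CInt (spiral_kernel n t) (- delta) delta
        + - (1) * CInt (fun s => gauss c s * main_poly n t s)%C (- delta) delta)%C; [ring|].
      pose proof (CInt_cmult (- (1))%C (fun s => gauss c s * main_poly n t s)%C (- delta) delta
        ltac:(lra) (fun s _ => Cm s)) as CM.
      refine (eq_trans (f_equal (Cplus (CInt (spiral_kernel n t) (- delta) delta)) (eq_sym CM)) (eq_sym _)).
      apply (CInt_plus (spiral_kernel n t) (fun s => - (1) * (gauss c s * main_poly n t s))%C); [lra|intros; apply Ck|].
      intros s _. apply (ccont_mult (fun _ => (- (1))%C) (fun s => gauss c s * main_poly n t s)%C);
          [apply ccont_const|apply Cm]. }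
    rewrite E. replace (2 * delta) with (delta - - delta) by ring.
    apply CInt_norm_const; [lra| |].
    - intros s _. apply (ccont_plus (spiral_kernel n t) (fun s => - (1) * (gauss c s * main_poly n t s))%C); [apply Ck|].
      apply (ccont_mult (fun _ => (- (1))%C) (fun s => gauss c s * main_poly n t s)%C);
          [apply ccont_const|apply Cm].
    - intros s Hs. replace (spiral_kernel n t s + - (1) * (gauss c s * main_poly n t s))%C with
        (spiral_kernel n t s - gauss c s * main_poly n t s)%C by ring.
      apply (local_pointwise n t Hn Hu Hv2 delta Hd HTd Hsm s Hs). }
  pose proof main_integral as MI.
  match goal with |- Cmod ?x <= _ => replace x with
    (CInt (spiral_kernel n t) (-1) (- delta) + ((CInt (spiral_kernel n t) (- delta) delta - CInt (fun s => gauss c s * main_poly n t s)%C (- delta) delta)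
     + (CInt (fun s => gauss c s * main_poly n t s)%C (- delta) delta
        - gauss_moment c delta 0 * (1 + coef1 t / RtoC N + coef2 t / RtoC N ^ 2))))%C by ring end.
  eapply Rle_trans; [apply (Cmod_add_le _ _ _ _ LT (Cmod_add_le _ _ _ _ LP MI))|]. lra.
Qed.
End KInt.

(** * The Lambert point and the polar form of the main term *)

(** The equation says u cos v = v sin v and u sin v + v cos v > 0. The cotangent curve
    that bounds the range of the principal branch excludes cos v < 0 in the upper half-
    plane and every point of the lower one. *)
Lemma lambert_quadrant (x : R) (w : C) : 0 < x -> (w * Cexp w)%C = (0, x) ->
  - PI < Im w < PI ->
  (0 < Im w -> - (Im w * (cos (Im w) / sin (Im w))) <= Re w) ->
  (Im w < 0 -> - (Im w * (cos (Im w) / sin (Im w))) < Re w) ->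
  0 < Re w /\ 0 < Im w < PI / 2 /\ Re w * cos (Im w) = Im w * sin (Im w).
Proof.
  intros Hx E Hi Hpos Hneg. destruct w as [u v]. cbn [Re Im fst snd] in *.
  pose proof (exp_pos u) as Eu. pose proof PI_RGT_0 as P0.
  assert (E1 : exp u * (u * cos v - v * sin v) = 0).
  { apply (f_equal Re) in E. unfold Cexp in E. simpl in E. lra. }
  assert (E2 : exp u * (u * sin v + v * cos v) = x).
  { apply (f_equal Im) in E. unfold Cexp in E. simpl in E. lra. }
  assert (F1 : u * cos v = v * sin v).
  { apply Rmult_integral in E1. destruct E1; lra. }
  assert (F2 : 0 < u * sin v + v * cos v).
  { apply Rmult_lt_reg_l with (exp u); [exact Eu|]. lra. }
  pose proof (sin2_cos2 v) as SC. unfold Rsqr in SC.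
  destruct (Rtotal_order v 0) as [L|[Z|G]].
  -    exfalso. assert (S : sin v < 0) by (apply sin_lt_0_var; lra). specialize (Hneg L).
    assert (VS : 0 < v * sin v) by nra.
    destruct (Rtotal_order (cos v) 0) as [C1|[C1|C1]]; [|rewrite C1 in F1; lra|].
    + assert (U : u < 0) by nra.
      assert (0 < cos v / sin v).
      { unfold Rdiv. replace (cos v * / sin v) with ((- cos v) * / (- sin v)) by (field; lra).
        apply Rmult_lt_0_compat; [lra|apply Rinv_0_lt_compat; lra]. }
      nra.
    + assert (U : 0 < u) by nra. nra.
  - exfalso. subst v. rewrite sin_0, cos_0 in *. lra.
  - assert (S : 0 < sin v) by (apply sin_gt_0; lra). specialize (Hpos G).
    assert (VS : 0 < v * sin v) by nra.
    destruct (Rtotal_order (cos v) 0) as [C1|[C1|C1]]; [|rewrite C1 in F1; lra|].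
    + exfalso. assert (U : u < 0) by nra.
      assert (cos v / sin v < 0).
      { unfold Rdiv. assert (0 < / sin v) by now apply Rinv_0_lt_compat. nra. }
      nra.
    + assert (U : 0 < u) by nra. split; [exact U|]. split; [|exact F1]. split; [exact G|].
      destruct (Rlt_le_dec v (PI / 2)) as [Q|Q]; [exact Q|exfalso].
      assert (cos v <= 0) by (apply cos_le_0; lra). lra.
Qed.

Lemma is_lambertW0_facts n (w : C) : (1 <= n)%nat -> is_lambertW0 (INR n * Ci / (2 * PI))%C w ->
  0 < Re w /\ 0 < Im w < PI / 2 /\ Re w * cos (Im w) = Im w * sin (Im w) /\
  (w * Cexp w = INR n * Ci / (2 * PI))%C.
Proof.
  intros Hn (E & H1 & _ & H3 & H4).
  assert (N1 : 1 <= INR n) by (apply le_INR in Hn; exact Hn). pose proof PI_RGT_0 as P0.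
  assert (E' : (INR n * Ci / (2 * PI))%C = (0, INR n / (2 * PI))).
  { unfold Cdiv. rewrite <- RtoC_mult, <- RtoC_inv by lra. apply Ceq; simpl; field; lra. }
  destruct (lambert_quadrant (INR n / (2 * PI)) w) as (A1 & A2 & A3); auto.
  - apply Rdiv_lt_0_compat; lra.
  - now rewrite E.
Qed.

Lemma arg_complement u v : 0 < u -> 0 < v < PI / 2 -> u * cos v = v * sin v -> atan (v / u) = PI / 2 - v.
Proof.
  intros Hu Hv E. assert (C0 : 0 < cos v) by (apply cos_gt_0; lra). assert (S0 : 0 < sin v) by (apply sin_gt_0; lra).
  assert (T : tan (PI / 2 - v) = v / u).
  { unfold tan. rewrite cos_shift, sin_shift.
    apply Rmult_eq_reg_r with (u * sin v); [|nra].
    transitivity (u * cos v); [|rewrite E]; field; lra. }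
  rewrite <- T. apply atan_tan. lra.
Qed.

(** The gap y = PI/2 - v satisfies v cos y = u sin y, so it is at least of size v / (u +
    2): the spiral may be continued a little beyond the saddle point within the right
    half-plane. *)
Lemma arg_gap u v d : 0 < u -> 0 < v < PI / 2 -> u * cos v = v * sin v -> d * (u + 2) < 1 -> 0 < d ->
  v * (1 + d) < PI / 2.
Proof.
  intros Hu Hv E Hd Hd0. pose proof PI_4 as P4. set (y := PI / 2 - v).
  assert (y0 : 0 < y) by (unfold y; lra).
  assert (C1 : cos v = sin y) by (unfold y; now rewrite sin_shift).
  assert (S1 : sin v = cos y) by (unfold y; now rewrite cos_shift).
  rewrite C1, S1 in E. pose proof (cos_ge_lin y ltac:(lra)) as CL.
  pose proof (sin_abs_le y ltac:(lra)) as SL. apply Rabs_le_between in SL.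
  assert (v * (1 - y) <= u * y) by nra.
  assert (v <= y * (u + 2)) by nra.
  assert (v * d < y); [|unfold y in *; lra].
  apply Rmult_lt_reg_r with (u + 2); [lra|]. nra.
Qed.

(** Both are square roots of t with nonnegative real part, and that of the exponential
    is positive. *)
Lemma Csqrt_polar (t : C) : 0 < Re t -> 0 <= Im t ->
  Csqrt t = Cexp (RtoC (1 / 2) * Clog t)%C.
Proof.
  intros Hr Hi. destruct (Csqrt_spec t Hi) as (Q1 & Q2 & Q3). specialize (Q3 ltac:(lra)).
  set (q := Csqrt t) in *. set (p := Cexp (RtoC (1 / 2) * Clog t)%C).
  assert (P1 : (p * p)%C = t).
  { unfold p. rewrite <- Cexp_plus. rewrite <- (Cexp_Clog t Hr) at 3. f_equal.
    rewrite <- Cmult_plus_distr_r, <- RtoC_plus. replace (1 / 2 + 1 / 2) with 1 by field. ring. }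
  assert (Rp : 0 < Re p).
  { unfold p, Cexp. cbn [Re fst]. apply Rmult_lt_0_compat; [apply exp_pos|].
    replace (Im (RtoC (1 / 2) * Clog t)%C) with (1 / 2 * Im (Clog t)) by (destruct (Clog t); simpl; ring).
    unfold Clog. cbn [Im snd]. pose proof (atan_bound (Im t / Re t)). pose proof PI_RGT_0.
    apply cos_gt_0; lra. }
  assert (Rq : 0 < Re q).
  { destruct (Rle_lt_or_eq_dec 0 (Re q)) as [L|Z]; [lra|exact L|exfalso].
    assert (Iq : Im q = 0) by lra.
    assert (q = RtoC 0) by (apply Ceq; simpl; [now rewrite Z|exact Iq]).
    rewrite H, Cmult_0_l in Q1. rewrite <- Q1 in Hr. simpl in Hr. lra. }
  assert (Z : ((q - p) * (q + p))%C = RtoC 0).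
  { replace ((q - p) * (q + p))%C with (q * q - p * p)%C by ring. rewrite P1, Q1. ring. }
  destruct (Ceq_dec (q - p)%C 0) as [D|D].
  - replace q with (q - p + p)%C by ring. rewrite D. ring.
  - exfalso. apply (Cmult_neq_0 (q - p) (q + p) D); [|exact Z].
    intros K. apply (f_equal Re) in K. change (Re q + Re p = 0) in K. lra.
Qed.

Section Polar.
Variables (n : nat) (t : C) (alpha : R).
Hypothesis Hn : (1 <= n)%nat.
Hypothesis Hu : 0 < Re t.
Hypothesis Hv : 0 < Im t < PI / 2.
Hypothesis Hc : Re t * cos (Im t) = Im t * sin (Im t).

Definition amplitude : R := coefB t * exp (INR n * coefA t) / sqrt (INR n).
Definition phase : R := INR n * coefa t + coefb t - 2 * PI * alpha.
(** The product of the phase from the shift by alpha, the value t^(n+1) e^(-n/t) at the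
    saddle point, and the Gaussian factor. *)
Definition main_term : C :=
  (Cexp (- (2 * PI) * Ci * RtoC alpha) * (t ^ S n * Cexp (- (RtoC (INR n) / t)))
    * (RtoC (sqrt (2 * PI)) / (RtoC (sqrt (INR n)) * Csqrt (1 + t))))%C.

Lemma Re_inv_t : Re (/ t)%C = Re t / (Re t ^ 2 + Im t ^ 2).
Proof. destruct t; simpl. reflexivity. Qed.
Lemma Im_inv_t : Im (/ t)%C = - (Im t / (Re t ^ 2 + Im t ^ 2)).
Proof. destruct t; simpl. unfold Rdiv. ring. Qed.

Lemma ln_Cmod : ln (Cmod t) = / 2 * ln (Re t ^ 2 + Im t ^ 2).
Proof.
  assert (P : 0 < Re t ^ 2 + Im t ^ 2) by nra.
  assert (C0 : 0 < Cmod t) by (apply Cmod_sqr_pos, Hu).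
  rewrite <- Cmod2_alt. replace (Cmod t ^ 2) with (Cmod t * Cmod t) by ring.
  rewrite ln_mult by exact C0. field.
Qed.

(** The logarithm of the main term is n (Log t - 1/t) + Log t - Log (1 + t) / 2 - 2 pi i
    alpha plus a real number; coefA and coefa are the real and imaginary part of Log t -
    1/t, and coefb contains v because arg t = PI/2 - v. *)
Lemma main_term_polar : (2 * main_term)%C = (RtoC amplitude * (cos phase, sin phase))%C.
Proof.
  assert (N1 : 1 <= INR n) by (apply le_INR in Hn; exact Hn). pose proof PI_RGT_0 as P0.
  assert (I1 : Im (1 + t)%C = Im t) by (destruct t; simpl; ring).
  assert (R1 : Re (1 + t)%C = 1 + Re t) by (destruct t; simpl; ring).
  pose proof (Csqrt_polar (1 + t)%C ltac:(rewrite R1; lra) ltac:(rewrite I1; lra)) as Eq.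
  set (L := Clog t). set (L1 := Clog (1 + t)%C).
  assert (Et : t = Cexp L) by (symmetry; apply Cexp_Clog, Hu).
  assert (k0 : 0 < sqrt (INR n)) by (apply sqrt_lt_R0; lra).
  set (Sg := (RtoC (INR n) * (L - / t) + (L - RtoC (1 / 2) * L1) - 2 * PI * Ci * RtoC alpha)%C).
  assert (Et2 : (t / Csqrt (1 + t))%C = Cexp (L - RtoC (1 / 2) * L1)%C).
  { rewrite Eq. unfold Cdiv, Cminus. rewrite <- Cexp_opp. rewrite Et at 1. rewrite <- Cexp_plus. reflexivity. }
  assert (EW : main_term = (RtoC (sqrt (2 * PI) / sqrt (INR n)) * Cexp Sg)%C).
  { unfold main_term, Sg.
    replace (RtoC (INR n) * (L - / t) + (L - RtoC (1 / 2) * L1) - 2 * PI * Ci * RtoC alpha)%C with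
      (- (2 * PI) * Ci * RtoC alpha + (RtoC (INR n) * L + - (RtoC (INR n) / t)) + (L - RtoC (1 / 2) * L1))%C
      by (unfold Cdiv; ring).
    rewrite (Cexp_plus (_ + _)), (Cexp_plus (- (2 * PI) * Ci * RtoC alpha)), (Cexp_plus (RtoC (INR n) * L)).
    rewrite <- Et2, Cexp_mult_nat, <- Et, Cpow_S, RtoC_div by lra.
    field. split.
    - rewrite Eq. apply Cexp_neq0.
    - intros K. apply RtoC_inj in K. lra. }
  assert (ReS : Re Sg = INR n * coefA t + Re (L - RtoC (1 / 2) * L1)%C).
  { unfold Sg, coefA. rewrite <- ln_Cmod, <- Re_inv_t.
    set (Z := (L - RtoC (1 / 2) * L1)%C). unfold L, Clog. destruct (/ t)%C as [i1 i2], Z as [z1 z2]. simpl. ring. }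
  assert (ImS : Im Sg = phase).
  { unfold phase, coefa, coefb, Sg.
    replace (atan (Im t / (1 + Re t))) with (atan (Im (1 + t)%C / Re (1 + t)%C)) by now rewrite I1, R1.
    pose proof Im_inv_t as II. pose proof (arg_complement _ _ Hu Hv Hc) as AC.
    replace (Im t / (Re t ^ 2 + Im t ^ 2)) with (- Im (/ t)%C) by (rewrite II; ring).
    assert (IL : Im L = atan (Im t / Re t)) by reflexivity.
    assert (IL1 : Im L1 = atan (Im (1 + t)%C / Re (1 + t)%C)) by reflexivity.
    rewrite <- IL, <- IL1. rewrite <- IL in AC.
    clearbody L L1. destruct L as [l1 l2], L1 as [m1 m2], (/ t)%C as [i1 i2]. simpl in *.
    simpl. nra. }
  rewrite EW.
  assert (ES : Cexp Sg = (RtoC (exp (Re Sg)) * (cos phase, sin phase))%C).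
  { rewrite <- ImS. unfold Cexp. apply Ceq; simpl; ring. }
  rewrite ES. unfold amplitude, coefB. rewrite Et2, Cmod_Cexp, ReS, exp_plus.
  apply Ceq; simpl; field; lra.
Qed.

Lemma main_term_mod : Cmod main_term =
  saddle_mag n t * (Cmod t * sqrt (2 * PI) / (sqrt (INR n) * Cmod (Csqrt (1 + t)))).
Proof.
  assert (N1 : 1 <= INR n) by (apply le_INR in Hn; exact Hn).
  assert (k0 : 0 < sqrt (INR n)) by (apply sqrt_lt_R0; lra).
  assert (I1 : Im (1 + t)%C = Im t) by (destruct t; simpl; ring).
  assert (R1 : Re (1 + t)%C = 1 + Re t) by (destruct t; simpl; ring).
  pose proof (Csqrt_polar (1 + t)%C ltac:(rewrite R1; lra) ltac:(rewrite I1; lra)) as Eq.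
  assert (q0 : Csqrt (1 + t)%C <> 0) by (rewrite Eq; apply Cexp_neq0).
  unfold main_term, saddle_mag. rewrite Cpow_S.
  rewrite !Cmod_mult, Cmod_Cexp_i, Cmod_div.
  - rewrite !Cmod_mult, !Cmod_R, (Rabs_pos_eq (sqrt (INR n))), (Rabs_pos_eq (sqrt (2 * PI))) by (try lra; apply sqrt_pos).
    field. split; [|lra]. intros K. apply Cmod_eq_0 in K. contradiction.
  - apply Cmult_neq_0; [|exact q0]. intros K. apply RtoC_inj in K. lra.
Qed.

Lemma amplitude_main_term : amplitude = 2 * Cmod main_term /\ 0 < amplitude.
Proof.
  assert (N1 : 1 <= INR n) by (apply le_INR in Hn; exact Hn).
  assert (A : 0 < amplitude).
  { unfold amplitude, coefB.
    assert (0 < Cmod (t / Csqrt (1 + t))%C).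
    { apply Cmod_gt_0.
      assert (I1 : Im (1 + t)%C = Im t) by (destruct t; simpl; ring).
      assert (R1 : Re (1 + t)%C = 1 + Re t) by (destruct t; simpl; ring).
      rewrite (Csqrt_polar (1 + t)%C) by (rewrite ?R1, ?I1; lra).
      unfold Cdiv. rewrite <- Cexp_opp. apply Cmult_neq_0; [now apply Cmod_sqr_pos|apply Cexp_neq0]. }
    assert (0 < sqrt (2 * PI)) by (apply sqrt_lt_R0; pose proof PI_RGT_0; lra).
    apply Rdiv_lt_0_compat; [|apply sqrt_lt_R0; lra].
    apply Rmult_lt_0_compat; [nra|apply exp_pos]. }
  split; [|exact A].
  pose proof (f_equal Cmod main_term_polar) as E. rewrite !Cmod_mult, !Cmod_R, (Rabs_pos_eq 2), (Rabs_pos_eq amplitude) in E by lra.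
  rewrite E. replace (Cmod (cos phase, sin phase)) with 1; [ring|].
  unfold Cmod. cbn [fst snd]. pose proof (sin2_cos2 phase) as SC. unfold Rsqr in SC.
  replace (cos phase ^ 2 + sin phase ^ 2) with 1 by (simpl; lra). symmetry. apply sqrt_1.
Qed.
End Polar.

(** * Error estimates *)

Lemma Cmod_minus_le (a b : C) A B : Cmod a <= A -> Cmod b <= B -> Cmod (a - b) <= A + B.
Proof. intros. apply Cmod_add_le; [assumption|]. now rewrite Cmod_opp. Qed.

Lemma Cmod_monomial (k : R) (t : C) (j : nat) T : 0 <= k -> Cmod t = T -> Cmod (RtoC k * t ^ j) <= k * T ^ j.
Proof. intros Hk <-. rewrite Cmod_mult, Cmod_R, Cmod_pow, Rabs_pos_eq by exact Hk. lra. Qed.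

Lemma Cmod_one_plus_ge (t : C) : 8 <= Re t -> 1 <= Cmod (1 + t).
Proof.
  intros H. pose proof (Re_le_Cmod (1 + t)%C). assert (Re (1 + t)%C = 1 + Re t) by (destruct t; simpl; ring). lra.
Qed.

(** Since |1 + t| >= 1 the denominators can be dropped. *)
Lemma coef1_bound (t : C) : 8 <= Re t -> Cmod (coef1 t) <= 2 * Cmod t ^ 4.
Proof.
  intros Hu. pose proof (T_ge8 t Hu) as T8. pose proof (Cmod_one_plus_ge t Hu) as Q1. set (T := Cmod t) in *.
  assert (D0 : (1 + t)%C <> 0) by (intros K; rewrite K, Cmod_0 in Q1; lra).
  assert (W : Cmod (wp2 t) <= 2 + 18 * T ^ 1 + 20 * T ^ 2 + 3 * T ^ 3 + 2 * T ^ 4).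
  { unfold wp2. replace (18 * t)%C with (18 * t ^ 1)%C by (simpl; ring).
    repeat lazymatch goal with
      | |- Cmod (_ + _)%C <= _ => apply Cmod_add_le
      | |- Cmod (_ - _)%C <= _ => apply Cmod_minus_le
      | |- Cmod (_ * _)%C <= _ => apply Cmod_monomial; [lra|reflexivity]
      end.
    rewrite Cmod_R, Rabs_pos_eq; lra. }
  assert (P3 : 1 <= Cmod (1 + t) ^ 3) by (apply pow_R1_Rle; exact Q1).
  unfold coef1. rewrite Cmod_div, Cmod_mult, Cmod_R, Cmod_pow, Rabs_pos_eq by
    first [lra | apply Cmult_neq_0; [intros K; apply RtoC_inj in K; lra|now apply Cpow_nz]].
  apply Rle_trans with (Cmod (wp2 t) / 24).
  - unfold Rdiv. apply Rmult_le_compat_l; [apply Cmod_ge_0|]. apply Rinv_le_contravar; lra.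
  - assert (0 <= (T - 8) * T) by nra. assert (0 <= (T - 8) * T ^ 2) by nra. assert (0 <= (T - 8) * T ^ 3) by (assert (0 <= T ^ 3) by (apply pow_le; lra); nra).
    nra.
Qed.

Lemma coef2_bound (t : C) : 8 <= Re t -> Cmod (coef2 t) <= 60 * Cmod t ^ 8.
Proof.
  intros Hu. pose proof (T_ge8 t Hu) as T8. pose proof (Cmod_one_plus_ge t Hu) as Q1.
  assert (D0 : (1 + t)%C <> 0) by (intros K; rewrite K, Cmod_0 in Q1; lra). set (T := Cmod t) in *.
  assert (W : Cmod (wp4 t) <= 4 + 72 * T ^ 1 + 332 * T ^ 2 + 8028 * T ^ 3 + 19644 * T ^ 4 + 20280 * T ^ 5
     + 9911 * T ^ 6 + 1884 * T ^ 7 + 4 * T ^ 8).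
  { unfold wp4. replace (72 * t)%C with (72 * t ^ 1)%C by (simpl; ring).
    repeat lazymatch goal with
      | |- Cmod (_ + _)%C <= _ => apply Cmod_add_le
      | |- Cmod (_ - _)%C <= _ => apply Cmod_minus_le
      | |- Cmod (_ * _)%C <= _ => apply Cmod_monomial; [lra|reflexivity]
      end.
    rewrite Cmod_R, Rabs_pos_eq; lra. }
  assert (M : forall j, (j <= 8)%nat -> T ^ j <= T ^ 8) by (intros j Hj; apply Rle_pow; [lra|lia]).
  assert (P8 : 1 <= T ^ 8) by (apply pow_R1_Rle; lra).
  pose proof (M 1%nat ltac:(lia)). pose proof (M 2%nat ltac:(lia)). pose proof (M 3%nat ltac:(lia)).
  pose proof (M 4%nat ltac:(lia)). pose proof (M 5%nat ltac:(lia)). pose proof (M 6%nat ltac:(lia)).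
  pose proof (M 7%nat ltac:(lia)).
  unfold coef2. replace (60 * T ^ 8) with (53 * T ^ 8 + 7 * T ^ 8) by ring. apply Cmod_add_le.
  - assert (1 <= Cmod (1 + t) ^ 6) by (apply pow_R1_Rle; exact Q1).
    rewrite Cmod_div, Cmod_mult, Cmod_R, Cmod_pow, Rabs_pos_eq by
      first [lra | apply Cmult_neq_0; [intros K; apply RtoC_inj in K; lra|now apply Cpow_nz]].
    apply Rle_trans with (Cmod (wp4 t) / 1152); [|lra].
    unfold Rdiv. apply Rmult_le_compat_l; [apply Cmod_ge_0|]. apply Rinv_le_contravar; lra.
  - assert (1 <= Cmod (1 + t) ^ 2) by (apply pow_R1_Rle; exact Q1).
    assert (V : Cmod ((4 + 3 * t) * t ^ 2) <= 4 * T ^ 2 + 3 * T ^ 3).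
    { replace ((4 + 3 * t) * t ^ 2)%C with (4 * t ^ 2 + 3 * t ^ 3)%C by (simpl; ring).
      apply Cmod_add_le; (apply Cmod_monomial; [lra|reflexivity]). }
    rewrite Cmod_div, (Cmod_mult 2), Cmod_R, Cmod_pow, Rabs_pos_eq by
      first [lra | apply Cmult_neq_0; [intros K; apply RtoC_inj in K; lra|now apply Cpow_nz]].
    apply Rle_trans with (Cmod ((4 + 3 * t) * t ^ 2) / 1); [|lra].
    unfold Rdiv. apply Rmult_le_compat_l; [apply Cmod_ge_0|]. apply Rinv_le_contravar; lra.
Qed.

Lemma pow_exp_le y m : 0 <= y -> y ^ m * exp (- y) <= INR (fact m).
Proof.
  intros Hy. pose proof (pow_fact_le_exp y m Hy) as G. pose proof (INR_fact_pos m) as F0. pose proof (exp_pos y).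
  rewrite exp_Ropp. apply Rmult_le_reg_r with (exp y); [assumption|].
  rewrite Rmult_assoc, Rinv_l, Rmult_1_r by lra.
  apply Rmult_le_reg_r with (/ INR (fact m)); [now apply Rinv_0_lt_compat|].
  replace (INR (fact m) * exp y * / INR (fact m)) with (exp y) by (field; lra). exact G.
Qed.

(** The scale x = n^(1/40) makes all exponents integers: delta = x^(-16) is n^(-2/5),
    sqrt n is x^20, and |t| <= x. *)
Section Assembly.
Variables (n : nat) (t : C) (alpha : R) (gamma : nat -> R) (x : R).
Hypothesis Hn : (1 <= n)%nat.
Hypothesis Ha : 0 < alpha <= 1.
Hypothesis Hg : is_stieltjes alpha gamma.
Hypothesis Hu : 72 <= Re t.
Hypothesis Hv : 0 < Im t < PI / 2.
Hypothesis Hc : Re t * cos (Im t) = Im t * sin (Im t).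
Hypothesis Hw : (t * Cexp t)%C = (INR n * Ci / (2 * PI))%C.
Hypothesis Hx : x ^ 40 = INR n.
Hypothesis HT : Cmod t <= x.

Let N := INR n.
Let T := Cmod t.
Let M := saddle_mag n t.
Let W := main_term n t alpha.
Let correction := (coef1 t / RtoC N + coef2 t / RtoC N ^ 2)%C.
Let ex := exp (- (x ^ 8)).
Let delta := / x ^ 16.

Lemma x_ge72 : 72 <= x.
Proof. pose proof (Re_le_Cmod t). lra. Qed.

Lemma x_pow_ge1 j : 1 <= x ^ j.
Proof. pose proof x_ge72. apply pow_R1_Rle. lra. Qed.

Lemma x_pow_mono i j : (i <= j)%nat -> x ^ i <= x ^ j.
Proof. pose proof x_ge72. intros H1. apply Rle_pow; [lra|exact H1]. Qed.

Lemma x_pow_gap j : 72 * x ^ j <= x ^ S j.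
Proof. pose proof x_ge72. pose proof (x_pow_ge1 j). simpl. nra. Qed.

Lemma delta_facts : 0 < delta <= 1 / 8 /\ T * delta <= 1 /\ 5 * N * T ^ 2 * delta ^ 3 <= 1 /\
  Im t * (1 + delta) < PI / 2.
Proof.
  pose proof x_ge72 as X. pose proof (T_ge8 t ltac:(lra)) as T8. fold T in T8. fold T in HT.
  assert (D0 : 0 < delta) by (unfold delta; apply Rinv_0_lt_compat; pose proof (x_pow_ge1 16); lra).
  assert (D1 : x * delta <= / 72 / 8).
  { unfold delta. pose proof (x_pow_gap 1) as G1. pose proof (x_pow_gap 2) as G2. rewrite pow_1 in G1.
    apply Rmult_le_reg_r with (x ^ 16); [pose proof (x_pow_ge1 16); lra|].
    rewrite Rmult_assoc, Rinv_l by (pose proof (x_pow_ge1 16); lra).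
    pose proof (x_pow_mono 3 16 ltac:(lia)). lra. }
  assert (D2 : delta <= 1 / 8) by nra.
  split; [lra|]. split; [nra|]. split.
  - unfold N. rewrite <- Hx.
    assert (T2 : T ^ 2 <= x ^ 2) by (apply pow_incr; lra).
    apply Rle_trans with (5 * x ^ 40 * x ^ 2 * delta ^ 3).
    + apply Rmult_le_compat_r; [apply pow_le; lra|].
      apply Rmult_le_compat_l; [pose proof (x_pow_ge1 40); lra|exact T2].
    + replace (5 * x ^ 40 * x ^ 2 * delta ^ 3) with (5 * / x ^ 6) by (unfold delta; field; lra).
      pose proof (x_pow_mono 1 6 ltac:(lia)) as P. rewrite pow_1 in P.
      assert (/ x ^ 6 <= / 72) by (apply Rinv_le_contravar; lra). lra.
  - apply arg_gap with (u := Re t); try lra.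
    pose proof (Re_le_Cmod t) as RT. fold T in RT. nra.
Qed.

Lemma decay_le y : x ^ 8 <= y -> exp (- y) <= ex.
Proof. intros H1. unfold ex. apply exp_le. lra. Qed.

Lemma tail_le k : 1 <= k -> exp (- (N * (k * Re t) * delta ^ 2 / 4)) <= ex.
Proof.
  intros Hk. apply decay_le. unfold N. rewrite <- Hx. pose proof x_ge72.
  replace (x ^ 40 * (k * Re t) * delta ^ 2 / 4) with (x ^ 8 * (k * Re t) / 4) by (unfold delta; field; lra).
  pose proof (x_pow_ge1 8). assert (K : 4 <= k * Re t) by nra.
  apply Rmult_le_compat_l with (r := x ^ 8) in K; lra.
Qed.

(** T^n >= 72^n >= e^(2n) while n / T <= n; so bounded quantities are negligible against
    the main term. *)
Lemma mag_large : exp (x ^ 40) <= M.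
Proof.
  pose proof (saddle_mag_ge n t ltac:(lra) Hv Hw) as G. fold M T N in G.
  assert (T72 : 72 <= T) by (unfold T; pose proof (Re_le_Cmod t); lra).
  pose proof (N_ge1 n Hn) as N1. fold N in N1.
  apply Rle_trans with (2 := G). rewrite Hx. fold N.
  assert (A1 : exp (- N) <= exp (- (N / T))).
  { apply exp_le. assert (N / T <= N / 1); [|lra].
    unfold Rdiv. apply Rmult_le_compat_l; [lra|]. apply Rinv_le_contravar; lra. }
  assert (A2 : exp N * exp N <= T ^ n).
  { unfold N. replace (INR n) with (INR n * 1) by ring. rewrite exp_mult_nat.
    rewrite <- Rpow_mult_distr. pose proof exp_le_3. pose proof (exp_pos 1). apply pow_incr. split; nra. }
  pose proof (exp_pos N) as E0.
  apply Rle_trans with ((exp N * exp N) * exp (- N)); [rewrite exp_Ropp; right; field; lra|].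
  apply Rmult_le_compat; [nra|apply Rlt_le, exp_pos|exact A2|exact A1].
Qed.

Lemma second_le : T ^ n * exp (- (5 / 4 * (N / T))) <= M * ex.
Proof.
  pose proof (saddle_mag_ge n t ltac:(lra) Hv Hw) as G. fold M T N in G.
  assert (T72 : 72 <= T) by (unfold T; pose proof (Re_le_Cmod t); lra).
  pose proof x_ge72 as X.
  assert (D : exp (- (N / T / 4)) <= ex).
  { apply decay_le. unfold N. rewrite <- Hx.
    assert (x ^ 39 <= x ^ 40 / T).
    { replace (x ^ 39) with (x ^ 40 / x) by (field; lra). unfold Rdiv.
      apply Rmult_le_compat_l; [pose proof (x_pow_ge1 40); lra|]. apply Rinv_le_contravar; [lra|exact HT]. }
    pose proof (x_pow_gap 8). pose proof (x_pow_mono 9 39 ltac:(lia)). pose proof (x_pow_ge1 8). lra. }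
  replace (- (5 / 4 * (N / T))) with (- (N / T) + - (N / T / 4)) by (field; lra).
  rewrite exp_plus, <- Rmult_assoc. apply Rmult_le_compat; try exact G; try exact D; [|apply Rlt_le, exp_pos].
  apply Rmult_le_pos; [apply pow_le; lra|apply Rlt_le, exp_pos].
Qed.

(** The main term is saddle_mag times |t| sqrt (2 pi) / (x^20 |q|) with q^2 = 1 + t, and
    |q| <= |t|. *)
Lemma mag_le_main : M <= Cmod W * x ^ 20.
Proof.
  pose proof x_ge72 as X. unfold W. rewrite main_term_mod by (try exact Hn; try exact Hv; lra). fold M T.
  assert (SN : sqrt (INR n) = x ^ 20).
  { rewrite <- Hx. replace (x ^ 40) with (x ^ 20 * x ^ 20) by ring. apply sqrt_square.
    pose proof (x_pow_ge1 20). lra. }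
  rewrite SN. set (q := Csqrt (1 + t)).
  assert (I1 : Im (1 + t)%C = Im t) by (destruct t; simpl; ring).
  assert (R1 : Re (1 + t)%C = 1 + Re t) by (destruct t; simpl; ring).
  destruct (Csqrt_spec (1 + t)%C ltac:(lra)) as (Q & _). fold q in Q.
  assert (Q2 : Cmod q * Cmod q = Cmod (1 + t)) by (rewrite <- Cmod_mult, Q; reflexivity).
  assert (T72 : 72 <= T) by (unfold T; pose proof (Re_le_Cmod t); lra).
  pose proof (Cmod_one_plus_ge t ltac:(lra)) as B1. pose proof (Cmod_ge_0 q) as q0.
  assert (B2 : Cmod (1 + t) <= 1 + T).
  { apply Cmod_add_le; [|unfold T; lra]. rewrite Cmod_1. lra. }
  assert (S1 : 1 <= sqrt (2 * PI)).
  { rewrite <- sqrt_1 at 1. apply sqrt_le_1_alt. pose proof PI2_1. lra. }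
  assert (qT1 : Cmod q <= T) by (apply Rnot_lt_le; intros K; nra).
  assert (qT : Cmod q <= T * sqrt (2 * PI)) by nra.
  assert (qp : 0 < Cmod q) by nra.
  assert (M0 : 0 < M) by (pose proof mag_large; pose proof (exp_pos (x ^ 40)); lra).
  replace (M * (T * sqrt (2 * PI) / (x ^ 20 * Cmod q)) * x ^ 20) with (M * (T * sqrt (2 * PI) / Cmod q))
    by (field; split; [lra|pose proof (x_pow_ge1 20); lra]).
  rewrite <- (Rmult_1_r M) at 1. apply Rmult_le_compat_l; [lra|].
  apply Rmult_le_reg_r with (Cmod q); [exact qp|]. unfold Rdiv. rewrite Rmult_assoc, Rinv_l by lra. lra.
Qed.

Lemma correction_bound : Cmod (1 + correction) <= 100 * x ^ 8.
Proof.
  pose proof (N_ge1 n Hn) as N1. fold N in N1.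
  pose proof (coef1_bound t ltac:(lra)) as C1. pose proof (coef2_bound t ltac:(lra)) as C2.
  assert (T4 : Cmod t ^ 4 <= x ^ 4) by (apply pow_incr; split; [apply Cmod_ge_0|exact HT]).
  assert (T8 : Cmod t ^ 8 <= x ^ 8) by (apply pow_incr; split; [apply Cmod_ge_0|exact HT]).
  pose proof (x_pow_mono 4 8 ltac:(lia)). pose proof (x_pow_ge1 8).
  assert (N0 : RtoC N <> 0) by (intros K; apply RtoC_inj in K; lra).
  assert (G : forall (z : C) k, 1 <= k -> Cmod (z / RtoC k) <= Cmod z).
  { intros z k Hk. rewrite Cmod_div by (intros K; apply RtoC_inj in K; lra).
    rewrite Cmod_R, Rabs_pos_eq by lra. rewrite <- (Rdiv_1_r (Cmod z)) at 2. unfold Rdiv.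
    apply Rmult_le_compat_l; [apply Cmod_ge_0|apply Rinv_le_contravar; lra]. }
  replace (100 * x ^ 8) with (1 + (2 * x ^ 8 + (100 * x ^ 8 - 2 * x ^ 8 - 1))) by ring.
  apply Cmod_add_le; [rewrite Cmod_1; lra|]. unfold correction. apply Cmod_add_le.
  - pose proof (G (coef1 t) N N1). lra.
  - rewrite <- RtoC_pow. pose proof (G (coef2 t) (N ^ 2) ltac:(apply pow_R1_Rle; exact N1)). lra.
Qed.

Let Econst := Cexp (- (2 * PI) * Ci * RtoC alpha)%C.

(** Two errors: that of the integral of the kernel, multiplied by the value at the
    saddle point, and that of the Gaussian integral, multiplied by the main term. *)
Lemma saddle_error : Cmod (Econst * spiral_int n t delta - W * (1 + correction)) <=
  M * x * (70001 * x ^ 168 * ex + 2 * local_const / x ^ 109) + Cmod W * (200 * x ^ 8 * ex).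
Proof.
  pose proof x_ge72 as X. destruct delta_facts as (D1 & D2 & D3 & D4).
  pose proof (N_ge1 n Hn) as N1. fold N in N1.
  assert (T0 : 0 <= T) by apply Cmod_ge_0. fold T in HT.
  assert (M0 : 0 < M) by (pose proof mag_large; pose proof (exp_pos (x ^ 40)); lra).
  assert (ex0 : 0 < ex) by apply exp_pos.
  pose proof (spiral_kernel_integral n t delta Hn ltac:(lra) Hv Hw D1 D2 D3) as KI. fold N T in KI.
  pose proof (tail_le 1 ltac:(lra)) as T1. rewrite Rmult_1_l in T1.
  assert (T2 : exp (- (N * (1 + Re t) * delta ^ 2 / 2)) <= ex).
  { apply Rle_trans with (exp (- (N * (2 * Re t) * delta ^ 2 / 4))); [|apply tail_le; lra].
    apply exp_le. assert (0 <= N * delta ^ 2) by (apply Rmult_le_pos; [lra|apply pow_le; lra]). nra. }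
  assert (I1 : Im (1 + t)%C = Im t) by (destruct t; simpl; ring).
  assert (R1 : Re (1 + t)%C = 1 + Re t) by (destruct t; simpl; ring).
  pose proof PI_4 as P4.
  pose proof (gauss_integral N delta t ltac:(lra) ltac:(lra) ltac:(lra) ltac:(lra)) as GI.
  set (I := CInt (spiral_kernel n t) (-1) delta) in *. set (m := gauss_moment (RtoC N * (1 + t)) delta 0) in *.
  assert (Em : m = CInt (gauss (RtoC N * (1 + t))) (- delta) delta).
  { unfold m, gauss_moment. apply CInt_ext; [lra|]. intros s _. simpl. ring. }
  rewrite <- Em in GI. set (q := Csqrt (1 + t)) in *.
  destruct (Csqrt_spec (1 + t)%C ltac:(lra)) as (Q & _). fold q in Q.
  pose proof (Cmod_one_plus_ge t ltac:(lra)) as B1.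
  assert (q0 : q <> 0).
  { intros K. rewrite K in Q. rewrite <- Q, Cmult_0_l, Cmod_0 in B1. lra. }
  assert (k0 : 0 < sqrt N) by (apply sqrt_lt_R0; lra).
  assert (p0 : 0 < sqrt (2 * PI)) by (apply sqrt_lt_R0; pose proof PI_RGT_0; lra).
  assert (k0' : RtoC (sqrt N) <> 0) by (intros K; apply RtoC_inj in K; lra).
  assert (p0' : RtoC (sqrt (2 * PI)) <> 0) by (intros K; apply RtoC_inj in K; lra).
  set (r := (m * RtoC (sqrt N) * q / RtoC (sqrt (2 * PI)))%C) in *.
  set (P := (t ^ S n * Cexp (- (RtoC N / t)))%C).
  assert (EW : W = (Econst * P * (RtoC (sqrt (2 * PI)) / (RtoC (sqrt N) * q)))%C) by reflexivity.
  assert (Es : spiral_int n t delta = (P * I)%C) by reflexivity.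
  assert (Er : (W * r = Econst * P * m)%C).
  { rewrite EW. unfold r. field. repeat split; assumption. }
  set (kp := (1 + correction)%C).
  assert (KI' : Cmod (I - m * kp) <= 70001 * x ^ 168 * ex + 2 * local_const / x ^ 109).
  { unfold kp, correction. rewrite Cplus_assoc. apply Rle_trans with (1 := KI).
    assert (K0 : 0 < local_const) by (unfold local_const; assert (0 < 4 ^ 7) by (apply pow_lt; lra); lra).
    assert (T8 : T ^ 8 <= x ^ 8) by (apply pow_incr; lra).
    assert (T3 : T ^ 3 <= x ^ 3) by (apply pow_incr; lra).
    assert (d0 : 0 < delta ^ 2) by (apply pow_lt; lra).
    replace (70001 * x ^ 168 * ex + 2 * local_const / x ^ 109) with
      (x ^ 168 * ex + 2 * local_const / x ^ 109 + 70000 * x ^ 168 * ex) by ring.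
    apply Rplus_le_compat; [apply Rplus_le_compat|].
    - pose proof (x_pow_ge1 168). nra.
    - replace (local_const * ((T / N) ^ 2 * (T * delta)) * (2 * delta)) with ((2 * local_const * / N ^ 2 * delta ^ 2) * T ^ 3) by (field; lra).
      apply Rle_trans with ((2 * local_const * / N ^ 2 * delta ^ 2) * x ^ 3).
      + apply Rmult_le_compat_l; [|exact T3]. apply Rmult_le_pos; [|lra].
        apply Rmult_le_pos; [lra|]. apply Rlt_le, Rinv_0_lt_compat, pow_lt. lra.
      + right. unfold N. rewrite <- Hx. unfold delta. field. lra.
    - replace (x ^ 168) with (N ^ 4 * x ^ 8) by (unfold N; rewrite <- Hx; ring).
      assert (0 <= N ^ 4) by (apply pow_le; lra). pose proof (exp_pos (- (N * (1 + Re t) * delta ^ 2 / 2))).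
      rewrite Rmult_assoc, (Rmult_assoc 70000). apply Rmult_le_compat_l; [lra|].
      apply Rmult_le_compat; [|lra| |exact T2].
      + apply Rmult_le_pos; [assumption|apply pow_le; lra].
      + apply Rmult_le_compat_l; assumption. }
  rewrite Es. replace (Econst * (P * I) - W * kp)%C with (Econst * P * (I - m * kp) + W * ((r - 1) * kp))%C.
  2: { replace (W * ((r - 1) * kp))%C with (W * r * kp - W * kp)%C by ring. rewrite Er. ring. }
  apply Cmod_add_le; rewrite Cmod_mult.
  - apply Rmult_le_compat; [apply Cmod_ge_0|apply Cmod_ge_0| |exact KI'].
    rewrite Cmod_mult. unfold Econst. rewrite Cmod_Cexp_i, Rmult_1_l.
    unfold P. rewrite Cpow_S, <- Cmult_assoc, Cmod_mult. change (T * M <= M * x). nra.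
  - apply Rmult_le_compat_l; [apply Cmod_ge_0|]. rewrite Cmod_mult.
    replace (200 * x ^ 8 * ex) with ((2 * ex) * (100 * x ^ 8)) by ring.
    apply Rmult_le_compat; [apply Cmod_ge_0|apply Cmod_ge_0|lra|exact correction_bound].
Qed.

Lemma stieltjes_error :
  Rabs (gamma n - 1 / alpha * ln alpha ^ n - 2 * Re (W * (1 + correction))%C) <=
  M * (200000 * x ^ 169 * ex + 4 * local_const / x ^ 108) + Cmod W * (400 * x ^ 8 * ex).
Proof.
  pose proof x_ge72 as X. destruct delta_facts as (D1 & D2 & D3 & D4).
  pose proof (N_ge1 n Hn) as N1. fold N in N1.
  pose proof (Re_le_Cmod t) as RT. fold T in RT.
  pose proof (stieltjes_formula alpha gamma n Ha Hg) as SF.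
  set (X0 := alpha + 1 / 2) in *.
  assert (HX : 1 / 2 <= X0 <= 3 / 2) by (unfold X0; lra).
  pose proof (contour_bound n t alpha delta (M * exp (- (N * Re t * delta ^ 2 / 4)) / delta)
    (T ^ n * exp (- (5 / 4 * (N / T)))) Ha ltac:(lra) Hv ltac:(lra) D4 Hw (saddle_neq0 t ltac:(lra))
    (ray_bound n t ltac:(lra) Hv Hw delta D1 ltac:(nra) D4)
    (second_harmonic_bound n T (Re t) X0 Hn ltac:(lra) RT HX (saddle_mod n t Hv Hw))) as CB.
  fold Econst X0 in CB.
  pose proof saddle_error as SE. pose proof second_le as SL.
  pose proof (tail_le 1 ltac:(lra)) as T1. rewrite Rmult_1_l in T1.
  assert (ex0 : 0 < ex) by apply exp_pos. pose proof mag_large as ML. pose proof (exp_pos (x ^ 40)) as E40.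
  assert (L1 : Rabs (ln X0 ^ S n / INR (S n)) <= M * ex).
  { apply Rle_trans with 1.
    - unfold Rdiv. rewrite Rabs_mult, <- RPow_abs, Rabs_inv, (Rabs_pos_eq (INR (S n))) by apply pos_INR.
      assert (Rabs (ln X0) ^ S n <= 1 ^ S n) by (apply pow_incr; split; [apply Rabs_pos|now apply ln_half_abs]).
      rewrite pow1 in H. rewrite S_INR. fold N.
      assert (/ (N + 1) <= / 1) by (apply Rinv_le_contravar; lra).
      assert (0 < / (N + 1)) by (apply Rinv_0_lt_compat; lra).
      rewrite Rinv_1 in *. pose proof (pow_le (Rabs (ln X0)) (S n) (Rabs_pos _)). nra.
    - assert (1 <= exp (x ^ 40) * ex).
      { unfold ex. rewrite <- exp_plus. apply exp_ge1. pose proof (x_pow_mono 8 40 ltac:(lia)). lra. }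
      nra. }
  assert (L2 : 1 <= M * ex).
  { assert (1 <= exp (x ^ 40) * ex).
    { unfold ex. rewrite <- exp_plus. apply exp_ge1. pose proof (x_pow_mono 8 40 ltac:(lia)). lra. }
    nra. }
  assert (B1 : M * exp (- (N * Re t * delta ^ 2 / 4)) / delta <= M * (x ^ 16 * ex)).
  { unfold Rdiv. replace (/ delta) with (x ^ 16) by (unfold delta; now rewrite Rinv_inv).
    rewrite Rmult_assoc. apply Rmult_le_compat_l; [lra|]. rewrite Rmult_comm.
    apply Rmult_le_compat_l; [pose proof (x_pow_ge1 16); lra|exact T1]. }
  set (Z := (Econst * spiral_int n t delta)%C) in *. set (Y := (W * (1 + correction))%C) in *.
  replace (gamma n - 1 / alpha * ln alpha ^ n - 2 * Re Y) with
    ((2 * log_moment X0 n - 2 * Re Z) + (2 * Re (Z - Y)%C - ln X0 ^ S n / INR (S n))).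
  2: { rewrite SF. change (Re (Z - Y)%C) with (Re Z - Re Y). field. split; [lra|apply not_0_INR; lia]. }
  apply Rle_trans with (1 := Rabs_triang _ _).
  apply Rle_trans with (Rabs (2 * log_moment X0 n - 2 * Re Z) + (2 * Cmod (Z - Y) + Rabs (ln X0 ^ S n / INR (S n)))).
  { apply Rplus_le_compat_l. unfold Rminus. apply Rle_trans with (1 := Rabs_triang _ _). rewrite Rabs_Ropp.
    apply Rplus_le_compat_r. rewrite Rabs_mult, (Rabs_pos_eq 2) by lra. apply Rmult_le_compat_l; [lra|].
    apply Rle_trans with (2 := Rmax_Cmod _). apply Rmax_l. }
  assert (Q16 : x ^ 16 <= x ^ 169) by (apply x_pow_mono; lia).
  pose proof (x_pow_ge1 169) as Q.
  assert (F1 : M * ex <= M * (x ^ 169 * ex)) by (apply Rmult_le_compat_l; [lra|]; nra).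
  assert (F2 : M * (x ^ 16 * ex) <= M * (x ^ 169 * ex)) by (apply Rmult_le_compat_l; [lra|]; nra).
  replace (M * x * (70001 * x ^ 168 * ex + 2 * local_const / x ^ 109)) with
    (70001 * (M * (x ^ 169 * ex)) + M * (2 * local_const / x ^ 108)) in SE by (field; lra).
  replace (M * (200000 * x ^ 169 * ex + 4 * local_const / x ^ 108) + Cmod W * (400 * x ^ 8 * ex)) with
    (200000 * (M * (x ^ 169 * ex)) + 2 * (M * (2 * local_const / x ^ 108)) + 2 * (Cmod W * (200 * x ^ 8 * ex)))
    by (field; lra).
  lra.
Qed.

Definition error_const : R := 201000 * INR (fact 40) + 4 * local_const.

(** Every error but one carries ex = e^(-x^8), which beats the powers of x; the
    remaining one is x^20 x^80 times a multiple of x^(-108). *)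
Lemma relative_error :
  N ^ 2 * Rabs (gamma n - 1 / alpha * ln alpha ^ n - 2 * Re (W * (1 + correction))%C) <= Cmod W * (error_const / x).
Proof.
  pose proof x_ge72 as X. pose proof mag_le_main as MW. pose proof (Cmod_ge_0 W) as W0.
  assert (K0 : 0 < local_const) by (unfold local_const; assert (0 < 4 ^ 7) by (apply pow_lt; lra); lra).
  assert (ex0 : 0 < ex) by apply exp_pos.
  unfold error_const. pose proof (INR_fact_pos 40) as F0.
  pose proof (pow_exp_le (x ^ 8) 40 ltac:(pose proof (x_pow_ge1 8); lra)) as EX.
  rewrite <- pow_mult in EX. change (8 * 40)%nat with 320%nat in EX. fold ex in EX.
  generalize dependent (INR (fact 40)). intros F F0 EX.
  apply Rle_trans with (N ^ 2 * (Cmod W * x ^ 20 * (200000 * x ^ 169 * ex + 4 * local_const / x ^ 108) + Cmod W * (400 * x ^ 8 * ex))).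
  - apply Rmult_le_compat_l; [apply pow2_ge_0|]. apply Rle_trans with (1 := stieltjes_error).
    apply Rplus_le_compat_r. apply Rmult_le_compat_r; [|exact MW].
    apply Rplus_le_le_0_compat.
    + pose proof (x_pow_ge1 169). nra.
    + apply Rlt_le, Rdiv_lt_0_compat; [lra|]. pose proof (x_pow_ge1 108). lra.
  - replace (N ^ 2) with (x ^ 80) by (unfold N; rewrite <- Hx; ring).
    replace (x ^ 80 * (Cmod W * x ^ 20 * (200000 * x ^ 169 * ex + 4 * local_const / x ^ 108) + Cmod W * (400 * x ^ 8 * ex)))
      with (Cmod W * ((200000 * (x ^ 270 * ex) + 4 * local_const * / x ^ 7 + 400 * (x ^ 89 * ex)) / x)) by (field; lra).
    apply Rmult_le_compat_l; [exact W0|]. unfold Rdiv.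
    apply Rmult_le_compat_r; [apply Rlt_le, Rinv_0_lt_compat; lra|].
    pose proof (x_pow_mono 270 320 ltac:(lia)). pose proof (x_pow_mono 89 320 ltac:(lia)).
    assert (x ^ 270 * ex <= F) by (apply Rle_trans with (2 := EX); apply Rmult_le_compat_r; lra).
    assert (x ^ 89 * ex <= F) by (apply Rle_trans with (2 := EX); apply Rmult_le_compat_r; lra).
    assert (/ x ^ 7 <= / 1) by (apply Rinv_le_contravar; [lra|apply x_pow_ge1]). rewrite Rinv_1 in *.
    nra.
Qed.
End Assembly.

(** * Growth of the Lambert point and the asymptotic expansion *)

(** The scale parameter, defined through the logarithm to be positive. *)
Definition root40 (n : nat) : R := exp (ln (INR n) / 40).

Lemma root40_pow n : (1 <= n)%nat -> root40 n ^ 40 = INR n.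
Proof.
  intros Hn. pose proof (N_ge1 n Hn) as N1. unfold root40. rewrite <- exp_mult_nat.
  replace (INR 40 * (ln (INR n) / 40)) with (ln (INR n)) by (simpl; field). apply exp_ln. lra.
Qed.

Lemma root40_large K : exists n0, forall n, (n0 <= n)%nat -> K < root40 n.
Proof.
  destruct (INR_unbounded ((Rabs K + 1) ^ 40)) as [m Hm]. exists (S m). intros n Hn.
  pose proof (Rabs_pos K). pose proof (Rle_abs K).
  apply Rlt_le_trans with (Rabs K + 1); [lra|]. apply Rnot_lt_le. intros L.
  pose proof (exp_pos (ln (INR n) / 40)) as E0. fold (root40 n) in E0.
  assert (P : root40 n ^ 40 <= (Rabs K + 1) ^ 40) by (apply pow_incr; lra).
  rewrite root40_pow in P by lia. assert (INR m <= INR n) by (apply le_INR; lia). lra.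
Qed.

(** From |t| e^u = n / (2 pi) with |t| <= u + 2, u cannot stay below 72 for large n, and
    u <= ln n = 80 ln (sqrt x), which is much smaller than x. *)
Lemma lambert_growth n (t : C) x : 0 < Re t -> 0 < Im t < PI / 2 ->
  (t * Cexp t)%C = (INR n * Ci / (2 * PI))%C -> x ^ 40 = INR n -> 6561 + 600 * exp 72 < x ->
  72 <= Re t /\ Cmod t <= x.
Proof.
  intros Hu Hv Hw Hx HK. pose proof (saddle_mod n t Hv Hw) as SM. pose proof PI_4 as P4. pose proof PI2_1 as P2.
  pose proof (exp_pos 72) as E72. pose proof (exp_pos (Re t)) as Eu.
  assert (TU : Cmod t <= Re t + 2).
  { apply Rle_trans with (1 := Cmod_le_sum t). rewrite !Rabs_pos_eq; lra. }
  assert (XN : x <= INR n).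
  { rewrite <- Hx. rewrite <- (pow_1 x) at 1. apply Rle_pow; [lra|lia]. }
  assert (SM' : Cmod t * exp (Re t) * (2 * PI) = INR n) by (rewrite SM; field; lra).
  assert (U72 : 72 <= Re t).
  { apply Rnot_lt_le. intros L. assert (exp (Re t) <= exp 72) by (apply exp_le; lra).
    assert (Cmod t * exp (Re t) <= 74 * exp 72) by (apply Rmult_le_compat; try lra; apply Cmod_ge_0). nra. }
  split; [exact U72|]. pose proof (Re_le_Cmod t) as RT.
  assert (EN : exp (Re t) <= x ^ 40).
  { rewrite Hx, <- SM'. assert (exp (Re t) * 1 <= exp (Re t) * (Cmod t * (2 * PI))); [|lra].
    apply Rmult_le_compat_l; [lra|nra]. }
  assert (s0 : 0 < sqrt x) by (apply sqrt_lt_R0; lra).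
  assert (ss : sqrt x * sqrt x = x) by (apply sqrt_sqrt; lra).
  assert (UL : Re t <= 80 * ln (sqrt x)).
  { rewrite <- (ln_exp (Re t)). apply Rle_trans with (ln (x ^ 40)); [apply ln_le_mono; [exact Eu|exact EN]|].
    rewrite ln_pow by lra. rewrite <- ss at 1. rewrite ln_mult by exact s0. simpl; lra. }
  pose proof (ln_le_sub1 (sqrt x) s0) as LS.
  assert (81 <= sqrt x) by (apply Rnot_lt_le; intros L; nra). nra.
Qed.

Lemma Re_main_term n (t : C) alpha : (1 <= n)%nat -> 0 < Re t -> 0 < Im t < PI / 2 ->
  Re t * cos (Im t) = Im t * sin (Im t) ->
  2 * Re (main_term n t alpha * (1 + (coef1 t / RtoC (INR n) + coef2 t / RtoC (INR n) ^ 2)))%C =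
  amplitude n t * (cos (phase n t alpha) * (1 + coefc1 t / INR n + coefc2 t / INR n ^ 2)
    - sin (phase n t alpha) * (coefd1 t / INR n + coefd2 t / INR n ^ 2)).
Proof.
  intros Hn Hu Hv Hc. pose proof (N_ge1 n Hn) as N1. pose proof (main_term_polar n t alpha Hn Hu Hv Hc) as WP.
  set (k := (1 + (coef1 t / RtoC (INR n) + coef2 t / RtoC (INR n) ^ 2))%C).
  assert (Rk : Re k = 1 + coefc1 t / INR n + coefc2 t / INR n ^ 2 /\ Im k = coefd1 t / INR n + coefd2 t / INR n ^ 2).
  { unfold k, coefc1, coefc2, coefd1, coefd2, Cdiv. rewrite <- RtoC_pow, <- !RtoC_inv by (try apply pow_nonzero; lra).
    destruct (coef1 t), (coef2 t). simpl. split; field; lra. }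
  destruct Rk as [<- <-].
  transitivity (Re (2 * main_term n t alpha * k)%C).
  - destruct (main_term n t alpha), k. simpl. ring.
  - rewrite WP. destruct k. simpl. ring.
Qed.

Theorem mainTheorem3 :
  forall (alpha : R) (gamma : nat -> R) (t0 : nat -> C),
    0 < alpha <= 1 ->
    is_stieltjes alpha gamma ->
    (forall n : nat, (1 <= n)%nat ->
       is_lambertW0 (INR n * Ci / (2 * PI))%C (t0 n)) ->
    exists eps : nat -> R,
      is_lim_seq eps 0 /\
      forall n : nat, (1 <= n)%nat ->
        let t := t0 n in
        let theta := INR n * coefa t + coefb t - 2 * PI * alpha in
        gamma n - 1 / alpha * ln alpha ^ n =
          coefB t * exp (INR n * coefA t) / sqrt (INR n) *
          (cos theta * (1 + coefc1 t / INR n + coefc2 t / INR n ^ 2)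
           - sin theta * (coefd1 t / INR n + coefd2 t / INR n ^ 2)
           + eps n / INR n ^ 2).
Proof.
  intros alpha gamma t0 Ha Hg HL.
  set (main := fun n => cos (phase n (t0 n) alpha) * (1 + coefc1 (t0 n) / INR n + coefc2 (t0 n) / INR n ^ 2)
    - sin (phase n (t0 n) alpha) * (coefd1 (t0 n) / INR n + coefd2 (t0 n) / INR n ^ 2)).
  set (D := fun n => gamma n - 1 / alpha * ln alpha ^ n).
  exists (fun n => INR n ^ 2 * (D n / amplitude n (t0 n) - main n)). split.
  - apply is_lim_seq_spec. intros e. destruct e as [e He]. simpl.
    destruct (root40_large (6561 + 600 * exp 72 + Rabs error_const / e)) as [n0 Hn0]. exists (S n0). intros n Hnn.
    assert (Hn : (1 <= n)%nat) by lia. specialize (Hn0 n ltac:(lia)).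
    destruct (is_lambertW0_facts n (t0 n) Hn (HL n Hn)) as (Hu & Hv & Hc & Hw).
    pose proof (root40_pow n Hn) as Hx. set (x := root40 n) in *. set (t := t0 n) in *.
    assert (Q : 0 <= Rabs error_const / e).
    { apply Rmult_le_pos; [apply Rabs_pos|apply Rlt_le, Rinv_0_lt_compat, He]. }
    pose proof (exp_pos 72) as E72.
    destruct (lambert_growth n t x Hu Hv Hw Hx ltac:(lra)) as [U72 HT].
    pose proof (relative_error n t alpha gamma x Hn Ha Hg U72 Hv Hc Hw Hx HT) as RE.
    rewrite (Re_main_term n t alpha Hn Hu Hv Hc) in RE.
    destruct (amplitude_main_term n t alpha Hn Hu Hv Hc) as [AW A0].
    change (INR n ^ 2 * Rabs (D n - amplitude n t * main n) <= Cmod (main_term n t alpha) * (error_const / x)) in RE.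
    replace (Cmod (main_term n t alpha)) with (amplitude n t / 2) in RE by (rewrite AW; field).
    set (A := amplitude n t) in *.
    assert (KX : Rabs (error_const / x) <= e).
    { unfold Rdiv. rewrite Rabs_mult, (Rabs_pos_eq (/ x)) by (apply Rlt_le, Rinv_0_lt_compat; lra).
      apply Rmult_le_reg_r with x; [lra|]. rewrite Rmult_assoc, Rinv_l by lra.
      replace (Rabs error_const * 1) with (e * (Rabs error_const / e)) by (field; lra). apply Rmult_le_compat_l; lra. }
    change (Rabs (INR n ^ 2 * (D n / A - main n) - 0) < e).
    rewrite Rminus_0_r, Rabs_mult, (Rabs_pos_eq (INR n ^ 2)) by apply pow2_ge_0.
    replace (D n / A - main n) with ((D n - A * main n) / A) by (field; lra).
    unfold Rdiv. rewrite Rabs_mult, (Rabs_pos_eq (/ A)) by (apply Rlt_le, Rinv_0_lt_compat; exact A0).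
    apply Rmult_lt_reg_r with A; [exact A0|]. rewrite !Rmult_assoc, Rinv_l, Rmult_1_r by lra.
    pose proof (Rle_abs (error_const / x)). apply Rle_lt_trans with (1 := RE). nra.
  - intros n Hn. cbv zeta.
    destruct (is_lambertW0_facts n (t0 n) Hn (HL n Hn)) as (Hu & Hv & Hc & _).
    destruct (amplitude_main_term n (t0 n) alpha Hn Hu Hv Hc) as [_ A0]. pose proof (N_ge1 n Hn) as N1.
    change (D n = amplitude n (t0 n) * (main n + INR n ^ 2 * (D n / amplitude n (t0 n) - main n) / INR n ^ 2)).
    field. split; lra.
Qed.
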